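(* Consider the stochastic gradient tracking iteration described in the context, under the function, network and gradient-noise assumptions of the context with $\mu>0$ and $\sigma>0$; let $\kappa=L/\mu$ and $\bar\alpha=\frac{\delta}{\sqrt{320}\,L\sqrt{Q\kappa}}$. There is an absolute constant $c>0$ such that for every horizon $K\ge1$ there exists a stepsize $\alpha\in(0,\bar\alpha]$, depending on $K$, for which $$\mathbb{E}\|\bar x^K-x^\star\|^2\le\widetilde{\mathcal O}\left(\frac{\sigma^2}{NK}+\frac{\tau^3\sigma^2}{(1-\lambda)^3K^2}+C_0\exp\left(-\frac{c(1-\lambda)^2K}{\kappa^{3/2}\tau^2}\right)\right),$$ where $$C_0=\widetilde X_0+\frac{16\bar\alpha L}{\delta N}\|\widehat{\mathbf x}^0\|^2+\frac{32\bar\alpha^3L}{\eta^2\delta N}\|\nabla\mathbf f(\mathbf x^\star)\|^2$$ is independent of $K$. Moreover, with such a stepsize, linear speedup is achieved, i.e. $$\mathbb{E}\|\bar x^K-x^\star\|^2\le\widetilde{\mathcal O}\left(\frac{\sigma^2}{NK}\right)$$ for every $K\ge K_{\mathrm{transient}}$, with transient time $$K_{\mathrm{transient}}=\widetilde{\mathcal O}\left(\frac{\kappa^{3/2}\tau^2}{(1-\lambda)^2}+\frac{N\kappa\tau^3}{(1-\lambda)^3}\right).$$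
   Context: **Problem and algorithm.** $N,d\ge1$ are integers; agent $i\in\{1,\dots,N\}$ has a differentiable objective $f_i:\mathbb{R}^d\to\mathbb{R}$, $f_i(x)=\mathbb{E}[F_i(x;\xi_i)]$, and $f=\frac1N\sum_{i=1}^N f_i$. $\nabla F_i(x;\xi)$ is the stochastic gradient in $x$. Given mixing matrices $W_k=(w_{ij}^k)\in\mathbb{R}^{N\times N}$, stepsize $\alpha>0$, initial points $x_i^0\in\mathbb{R}^d$ and $g_i^0=\nabla F_i(x_i^0;\xi_i^0)$, stochastic gradient tracking is, for $k\ge0$, $$x_i^{k+1}=\sum_{j=1}^N w_{ij}^k(x_j^k-\alpha g_j^k),\qquad g_i^{k+1}=\sum_{j=1}^N w_{ij}^k g_j^k+\nabla F_i(x_i^{k+1};\xi_i^{k+1})-\nabla F_i(x_i^k;\xi_i^k).$$ **Function assumption.** Each $f_i$ is $L$-smooth (gradient $L$-Lipschitz) and $\mu$-strongly convex with $0<\mu\le L$. $f$ admits a minimizer $x^\star$. **Network assumption.** $\{W_k\}_{k\ge0}$ is deterministic and each $W_k$ is nonnegative and doubly stochastic ($W_k\mathbf 1=\mathbf 1$, $\mathbf 1^{\mathsf T}W_k=\mathbf 1^{\mathsf T}$). With $\Pi=\frac1N\mathbf 1\mathbf 1^{\mathsf T}$ and $\widetilde W_k=W_k-\Pi$, there are an integer $\tau\ge1$ and $\lambda\in[0,1)$ with $\|\widetilde W_{k+\tau-1}\cdots\widetilde W_k\|_2\le\lambda$ for all $k\ge0$. Let $\Delta_\lambda=1-\lambda$.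 **Gradient-noise assumption.** $\mathcal F^k$ is the information ($\sigma$-algebra) available immediately before the samples $\xi_1^k,\dots,\xi_N^k$ are drawn; it contains the initialization and all iterates and samples generated up to iteration $k-1$ (so $x_i^k$ is $\mathcal F^k$-measurable). Conditioned on $\mathcal F^k$, the samples $\xi_1^k,\dots,\xi_N^k$ are mutually independent and, for every $i$, $\mathbb{E}[\nabla F_i(x_i^k;\xi_i^k)-\nabla f_i(x_i^k)\mid\mathcal F^k]=0$ and $\mathbb{E}[\|\nabla F_i(x_i^k;\xi_i^k)-\nabla f_i(x_i^k)\|^2\mid\mathcal F^k]\le\sigma^2$. The initial iterates $x_i^0$ are deterministic. **Notation.** $\mathbf x^k=\mathrm{col}\{x_1^k,\dots,x_N^k\}\in\mathbb{R}^{Nd}$; $\nabla\mathbf f(\mathbf x)=\mathrm{col}\{\nabla f_i(x_i)\}_{i=1}^N$; $\mathbf x^\star=\mathbf 1\otimes x^\star$; $\bar x^k=\frac1N\sum_i x_i^k$; $\widehat{\mathbf x}^k=(\mathbf I-\Pi\otimes I_d)\mathbf x^k$; $\widetilde X_0=\|\bar x^0-x^\star\|^2$; $\eta=\frac{\Delta_\lambda}{2\tau}$; $\delta=\frac{1-\lambda^2}{\tau}$; $Q=1+\frac{8}{\eta^2}=1+\frac{32\tau^2}{\Delta_\lambda^2}$. **Meaning of $\widetilde{\mathcal O}$.** $\widetilde{\mathcal O}(\cdot)$ hides constants depending only on $\mu$ and $L$ and logarithmic factors, i.e. $a\le\widetilde{\mathcal O}(b)$ means $a\le C(\ln T_K)^p\,b$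 with an absolute exponent $p\ge 0$, a constant $C$ depending only on $\mu,L$, and $T_K=\max\bigl\{e,\frac{\mu^2NC_0K}{2\sigma^2}\bigr\}$. In particular, $K\ge K_{\mathrm{transient}}$ means $K\ge C(\ln T_K)^p\bigl(\frac{\kappa^{3/2}\tau^2}{(1-\lambda)^2}+\frac{N\kappa\tau^3}{(1-\lambda)^3}\bigr)$ for suitable such $C,p$. *)

(* Defs.v *)
From HB Require Import structures.
From mathcomp Require Import all_boot all_order all_algebra.
From mathcomp Require Import all_classical all_reals all_analysis.
Export numFieldNormedType.Exports.

Set Implicit Arguments.
Unset Strict Implicit.
Unset Printing Implicit Defensive.

Import Order.TTheory GRing.Theory Num.Theory.

Local Open Scope classical_set_scope.
Local Open Scope ring_scope.

(* Points of R^d are row vectors.  A stacked vector col{x_1, ..., x_N} of R^(N d)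
   is the N x d matrix with rows x_i: the action of A (x) I_d becomes A *m _, and
   the Euclidean norm of the stacked vector becomes the Frobenius norm.  The norm
   `|_| of the library is the sup norm, whence the definitions below. *)

Definition sqnorm (R : realType) (m n : nat) (A : 'M[R]_(m, n)) : R :=
  \sum_i \sum_j A i j ^+ 2.

Definition enorm (R : realType) (m n : nat) (A : 'M[R]_(m, n)) : R :=
  Num.sqrt (sqnorm A).

Definition dotv (R : realType) (d : nat) (u v : 'rV[R]_d) : R :=
  \sum_j u 0 j * v 0 j.

Definition opnorm2 (R : realType) (N : nat) (A : 'M[R]_N) : R :=
  sup [set enorm (A *m v) | v in [set v : 'cV[R]_N | enorm v <= 1]].

Definition stack (R : realType) (N d : nat) (x : 'I_N -> 'rV[R]_d) : 'M[R]_(N, d) :=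
  \matrix_(i < N) x i.

Definition avg (R : realType) (N d : nat) (x : 'I_N -> 'rV[R]_d) : 'rV[R]_d :=
  N%:R^-1 *: \sum_i x i.

Definition grad (R : realType) (d : nat) (f : 'rV[R]_d -> R) (x : 'rV[R]_d) :
    'rV[R]_d :=
  \row_j 'D_(delta_mx 0 j) f x.

Definition smooth (R : realType) (d : nat) (L : R) (f : 'rV[R]_d -> R) : Prop :=
  (forall x, differentiable f x) /\
  (forall x y, enorm (grad f x - grad f y) <= L * enorm (x - y)).

Definition strongly_convex (R : realType) (d : nat) (mu : R)
    (f : 'rV[R]_d -> R) : Prop :=
  forall x y,
    f x + dotv (grad f x) (y - x) + mu / 2 * sqnorm (y - x) <= f y.

Definition mean_objective (R : realType) (N d : nat) (f : 'I_N -> 'rV[R]_d -> R)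
    (x : 'rV[R]_d) : R :=
  N%:R^-1 * \sum_i f i x.

Definition function_assumption (R : realType) (N d : nat) (mu L : R)
    (f : 'I_N -> 'rV[R]_d -> R) (xstar : 'rV[R]_d) : Prop :=
  [/\ forall i, smooth L (f i),
      forall i, strongly_convex mu (f i) &
      forall y, mean_objective f xstar <= mean_objective f y].

(* Pi = (1/N) 1 1^T *)
Definition avg_mx (R : realType) (N : nat) : 'M[R]_N := const_mx N%:R^-1.

Definition doubly_stochastic (R : realType) (N : nat) (A : 'M[R]_N) : Prop :=
  [/\ forall i j, 0 <= A i j,
      A *m const_mx 1 = const_mx 1 :> 'cV[R]_N &
      const_mx 1 *m A = const_mx 1 :> 'rV[R]_N].

(* The list rev (iota k tau) is k + tau - 1, ..., k, so that the matrix product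
   is ordered with the latest factor on the left. *)
Definition network_assumption (R : realType) (N : nat) (W : nat -> 'M[R]_N)
    (tau : nat) (lambda : R) : Prop :=
  [/\ forall k, doubly_stochastic (W k),
      (1 <= tau)%N,
      0 <= lambda < 1 &
      forall k,
        opnorm2 (\big[mulmx/1%:M]_(l <- rev (iota k tau)) (W l - avg_mx R N))
          <= lambda].

Definition sgrad (R : realType) (d : nat) (X : Type) (F : 'rV[R]_d -> X -> R)
    (x : 'rV[R]_d) (s : X) : 'rV[R]_d :=
  grad (F ^~ s) x.

(* The pair (x^k, g^k) along the realization s k i of the samples xi_i^k. *)
Fixpoint sgt (R : realType) (N d : nat) (X : 'I_N -> Type)
    (F : forall i, 'rV[R]_d -> X i -> R) (W : nat -> 'M[R]_N) (alpha : R)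
    (x0 : 'I_N -> 'rV[R]_d) (s : nat -> forall i, X i) (k : nat) :
    ('I_N -> 'rV[R]_d) * ('I_N -> 'rV[R]_d) :=
  match k with
  | 0 => (x0, fun i => sgrad (F i) (x0 i) (s 0%N i))
  | k'.+1 =>
    let (x, g) := sgt F W alpha x0 s k' in
    let x' := fun i => \sum_j W k' i j *: (x j - alpha *: g j) in
    (x', fun i => \sum_j W k' i j *: g j
                  + sgrad (F i) (x' i) (s k'.+1 i) - sgrad (F i) (x i) (s k' i))
  end.

(* D i is the law of xi_i.  R^d carries the product sigma-algebra of d.-tuple R;
   the last clause makes the iterates random vectors. *)
Definition oracle_assumption (R : realType) (N d : nat)
    (f : 'I_N -> 'rV[R]_d -> R)
    (dX : 'I_N -> measure_display) (X : forall i, measurableType (dX i))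
    (D : forall i, probability (X i) R)
    (F : forall i, 'rV[R]_d -> X i -> R) : Prop :=
  [/\ forall i x, (D i).-integrable setT (fun s => (F i x s)%:E),
      forall i x, (f i x)%:E = (\int[D i]_s (F i x s)%:E)%E,
      forall i s x, differentiable (F i ^~ s) x &
      forall i j, measurable_fun setT (fun p : d.-tuple R * X i =>
        sgrad (F i) (\row_l tnth p.1 l) p.2 0 j)].

Definition measurable_wrt (T : Type) (G : set (set T))
    (d' : measure_display) (T' : measurableType d') (Y : T -> T') : Prop :=
  forall B, measurable B -> G (Y @^-1` B).

(* Z is a version of E[Y | G]. *)
Definition is_cond_exp (R : realType) (dT : measure_display)
    (T : measurableType dT) (P : probability T R) (G : set (set T))
    (Y Z : T -> R) : Prop :=
  [/\ P.-integrable setT (EFin \o Y),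
      P.-integrable setT (EFin \o Z),
      measurable_wrt G Z &
      forall A, G A ->
        (\int[P]_(w in A) (Y w)%:E = \int[P]_(w in A) (Z w)%:E)%E].

(* Product rule for conditional probabilities; it covers subfamilies since B i
   may be the whole space. *)
Definition cond_independent (R : realType) (dT : measure_display)
    (T : measurableType dT) (P : probability T R) (G : set (set T))
    (N : nat) (dX : 'I_N -> measure_display) (X : forall i, measurableType (dX i))
    (Y : forall i, T -> X i) : Prop :=
  forall B : (forall i, set (X i)), (forall i, measurable (B i)) ->
    exists Z : 'I_N -> T -> R,
      (forall i, is_cond_exp P G \1_(Y i @^-1` B i) (Z i)) /\
      is_cond_exp P G \1_[set w | forall i, B i (Y i w)] (fun w => \prod_i Z i w).

Section GradientNoise.
Context (R : realType) (N d : nat) (f : 'I_N -> 'rV[R]_d -> R).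
Context (dX : 'I_N -> measure_display) (X : forall i, measurableType (dX i)).
Context (F : forall i, 'rV[R]_d -> X i -> R).
Context (W : nat -> 'M[R]_N) (alpha : R) (x0 : 'I_N -> 'rV[R]_d).
Context (dT : measure_display) (T : measurableType dT).
Context (xi : nat -> forall i, {mfun T >-> X i}).

Definition iterate (k : nat) (w : T) : 'I_N -> 'rV[R]_d :=
  (sgt (@F) W alpha x0 (fun l i => @xi l i w) k).1.

Definition tracker (k : nat) (w : T) : 'I_N -> 'rV[R]_d :=
  (sgt (@F) W alpha x0 (fun l i => @xi l i w) k).2.

Definition noise (k : nat) (i : 'I_N) (w : T) : 'rV[R]_d :=
  sgrad (@F i) (iterate k w i) (@xi k i w) - grad (f i) (iterate k w i).

Definition noise_assumption (P : probability T R) (Fil : nat -> set (set T))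
    (sigma : R) : Prop :=
  [/\ (forall k, sigma_algebra setT (Fil k) /\ Fil k `<=` measurable),
      (forall k i j, measurable_wrt (Fil k) (fun w => iterate k w i 0 j)) /\
      (forall k l i, (l < k)%N ->
        [/\ measurable_wrt (Fil k) (@xi l i),
            forall j, measurable_wrt (Fil k) (fun w => iterate l w i 0 j) &
            forall j, measurable_wrt (Fil k) (fun w => tracker l w i 0 j)]),
      forall k, cond_independent P (Fil k) (@xi k),
      forall k i j,
        is_cond_exp P (Fil k) (fun w => noise k i w 0 j) (fun _ => 0) &
      forall k i, exists Z : T -> R,
        is_cond_exp P (Fil k) (fun w => sqnorm (noise k i w)) Z /\
        {ae P, forall w, Z w <= sigma ^+ 2}].

End GradientNoise.

Section Constants.
Context (R : realType) (N d : nat).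
Context (mu L : R) (tau : nat) (lambda : R).

Definition kappa : R := L / mu.
Definition eta : R := (1 - lambda) / (2 * tau%:R).
Definition delta : R := (1 - lambda ^+ 2) / tau%:R.
Definition Qcst : R := 1 + 8 / eta ^+ 2.

Definition alphabar : R :=
  delta / (Num.sqrt 320 * L * Num.sqrt (Qcst * kappa)).

Definition C0 (f : 'I_N -> 'rV[R]_d -> R) (xstar : 'rV[R]_d)
    (x0 : 'I_N -> 'rV[R]_d) : R :=
  sqnorm (avg x0 - xstar)
  + 16 * alphabar * L / (delta * N%:R) * sqnorm ((1%:M - avg_mx R N) *m stack x0)
  + 32 * alphabar ^+ 3 * L / (eta ^+ 2 * delta * N%:R)
    * sqnorm (stack (fun i => grad (f i) xstar)).

End Constants.

Definition Tlog (R : realType) (mu sigma : R) (N : nat) (c0 : R) (K : nat) : R :=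
  Num.max (expR 1) (mu ^+ 2 * N%:R * c0 * K%:R / (2 * sigma ^+ 2)).

(* a <= Otilde(b) reads a <= Otilde C p T b: p is to be absolute and C to depend
   on mu and L only. *)
Definition Otilde (R : realType) (C p t b : R) : R := C * (ln t `^ p) * b.

(* Main.v *)
Require Import Defs.
From HB Require Import structures.
From mathcomp Require Import all_boot all_order all_algebra.
From mathcomp Require Import all_classical all_reals all_analysis measurable_realfun.
From mathcomp Require Import ring lra.

(** The proof follows three coupled errors: the distance X of the mean iterate
    to the optimum, the consensus error, and the deviation of the trackers
    from the gradients that they track.

    The mean iterate performs a gradient step at perturbed points.  Comparing
    function values at the agents' points and at their mean, it contracts by
    1 - a mu at the price of 3 a L / N times the consensus error
    ([inexact_gradient_step]).  The network contracts only over windows of tau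
    steps; the sum of the squared norms of the next tau transitions
    ([window_energy]) is a quadratic form that decreases at every single step.
    With suitable weights, X plus the two window energies is a Lyapunov
    function that loses a factor 1 - a mu / 2 per step as soon as
    a^2 L^2 kappa is small against delta^4
    ([lyapunov_deterministic_step]), and its initial value is at most C0
    ([lyapunov0_le_C0]).

    The deviation of the trackers is measured before the samples of the current
    step are drawn ([track_dev]).  Hence each component of the next state is
    known from the past up to a linear image of fresh noise, and the cross
    terms vanish in expectation ([expect_sqnormD]).  In the mean iterate the
    noises of the agents are averaged; they are pairwise orthogonal by
    conditional independence ([cond_independent_orth]), which divides their
    variance by N ([expect_row_mean]).  This gives linear speedup.  In the two
    energies the noise costs a^3 L sigma^2 / delta^3 per step, the origin of the
    term tau^3 sigma^2 / ((1 - lambda)^3 K^2).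

    Summing the recursion ([expect_error]) leaves
    (1 - a mu / 2)^K C0 + O(a sigma^2 / N + a^2 sigma^2 / delta^3).  The smaller
    of alphabar / 2 and 2 ln T / (mu K) is a good stepsize for the horizon K
    ([horizon_bound]), and the transient time is the horizon from which the
    first term dominates ([transient_bound]). *)

Import Order.TTheory GRing.Theory Num.Theory.

Local Open Scope classical_set_scope.
Local Open Scope ring_scope.

Set Implicit Arguments.
Unset Strict Implicit.
Unset Printing Implicit Defensive.

(** * Sub-sigma-algebras *)

(** A sigma-algebra generates itself, so measurability with respect to G is
    measurability on the type that carries G, where the closure properties of
    measurable functions are available. *)
Lemma measurable_wrtP {T : pointedType} {G : set (set T)} {d'}
    {T' : measurableType d'} {Y : T -> T'} : sigma_algebra setT G ->
  measurable_wrt G Y <->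
  measurable_fun setT (Y : g_sigma_algebraType G -> T').
Proof.
move=> sG; split => [mY _ B mB|mY B mB].
- by rewrite setTI; apply: sub_sigma_algebra; exact: mY.
- have := mY measurableT B mB.
  by rewrite setTI [X in X _ -> _](sigma_algebra_id sG).
Qed.

Section SubSigmaAlgebra.
Context {R : realType} {dT : measure_display} {T : measurableType dT}.
Context (P : probability T R) (G : set (set T)).
Hypothesis sG : sigma_algebra setT G.
Hypothesis GT : G `<=` measurable.

Import HBSimple HBNNSimple.

Lemma measurable_wrt_fun d' (T' : measurableType d') (Y : T -> T') :
  measurable_wrt G Y -> measurable_fun setT Y.
Proof. by move=> mY _ B mB; rewrite setTI; apply/GT/mY. Qed.

Local Notation TG := (g_sigma_algebraType G).

(** Z is a limit of G-measurable simple functions below it; for these, the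
    integral is a finite combination of integrals of Y over sets of G.
    Domination by the integrable product passes to the limit. *)
Let orth_ge0 (Y Z : T -> R) :
  P.-integrable setT (EFin \o Y) ->
  (forall A, G A -> (\int[P]_(w in A) (Y w)%:E = 0)%E) ->
  measurable_wrt G Z -> (forall w, 0 <= Z w) ->
  P.-integrable setT (fun w => (Z w * Y w)%:E) ->
  (\int[P]_w (Z w * Y w)%:E = 0)%E.
Proof.
move=> iY Y0 mZ Z0 iZY.
have mZG : @measurable_fun _ _ TG R setT Z by apply/measurable_wrtP.
have mEZ : @measurable_fun _ _ TG (\bar R) setT (EFin \o Z) by exact/measurable_EFinP.
pose g n := nnsfun_approx (@measurableT _ TG) mEZ n.
have GE B : measurable B -> forall n, G (g n @^-1` B).
  move=> mB n; have := @measurable_funPT _ _ _ _ (g n) measurableT B mB.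
  by rewrite setTI [X in X _ -> _](sigma_algebra_id sG).
have mg n : measurable_fun setT (g n : T -> R).
  by move=> _ B mB; rewrite setTI; apply/GT/GE.
have mY := measurable_int P iY.
have ig n : P.-integrable setT (fun w => (g n w * Y w)%:E).
  apply: (le_integrable measurableT _ _ iZY).
    by apply/measurable_EFinP/measurable_funM => //; exact/measurable_EFinP.
  move=> w _; rewrite lee_fin !normrM ler_wpM2r// ger0_norm//.
  rewrite ger0_norm// -lee_fin /g nnsfun_approxE.
  by apply: (@le_approx _ TG _ setT (EFin \o Z)) => // x _; rewrite lee_fin.
have g0 n : (\int[P]_w (g n w * Y w)%:E = 0)%E.
  under eq_integral.
    move=> w _; rewrite (@fimfunE _ _ (g n) w) fsbig_finite//=.
    rewrite mulr_suml -sumEFin.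
    under eq_bigr => r _ do rewrite -mulrA EFinM.
    over.
  rewrite integral_sum//; last first.
    move=> r; apply: integrableZl => //.
    apply: (le_integrable measurableT _ _ iY).
      apply/measurable_EFinP/measurable_funM; last exact/measurable_EFinP.
      by apply: measurable_indic; apply: GT; exact: GE.
    move=> w _; rewrite lee_fin normrM; apply: ler_piMl => //.
    by rewrite ger0_norm// indicE; case: (_ \in _).
  apply: big1 => r _; rewrite integralZl//; last first.
    apply: (le_integrable measurableT _ _ iY).
      apply/measurable_EFinP/measurable_funM; last exact/measurable_EFinP.
      by apply: measurable_indic; apply: GT; exact: GE.
    move=> w _; rewrite lee_fin normrM; apply: ler_piMl => //.
    by rewrite ger0_norm// indicE; case: (_ \in _).
  rewrite -[RHS](mule0 r%:E); congr (_ * _)%E.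
  rewrite -[RHS](Y0 (g n @^-1` [set r])); last exact: GE.
  rewrite [RHS]integral_mkcond; apply: eq_integral => w _.
  by rewrite patchE indicE; case: ifPn => _; rewrite ?mul1r ?mul0r.
have [] := @dominated_convergence _ T R P setT measurableT
  (fun n w => (g n w * Y w)%:E) (fun w => (Z w * Y w)%:E)
  (fun w => `|Z w * Y w|%:E) _ _ _ _ _.
- by move=> n; exact: (measurable_int P).
- exact: (measurable_int P).
- apply: aeW => w _.
  have := @cvg_nnsfun_approx _ TG R setT measurableT (EFin \o Z) mEZ _ w I.
  move=> /(_ _)/fine_cvgP[].
    by move=> x _ /=; rewrite lee_fin.
  move=> _ /= h; apply/cvg_EFin; first exact: nearW.
  by apply: cvgM; [exact: h|exact: cvg_cst].
- exact: integrable_norm.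
- apply: aeW => w n _; rewrite lee_fin !normrM ler_wpM2r// !ger0_norm//.
  rewrite -lee_fin /g nnsfun_approxE.
  by apply: (@le_approx _ TG _ setT (EFin \o Z)) => // x _; rewrite lee_fin.
move=> _ _; under eq_fun do rewrite g0.
by move=> /(cvg_lim (@ereal_hausdorff _)) <-; rewrite lim_cst.
Qed.

Lemma integral_orth (Y Z : T -> R) :
  P.-integrable setT (EFin \o Y) ->
  (forall A, G A -> (\int[P]_(w in A) (Y w)%:E = 0)%E) ->
  measurable_wrt G Z ->
  P.-integrable setT (fun w => (Z w * Y w)%:E) ->
  (\int[P]_w (Z w * Y w)%:E = 0)%E.
Proof.
move=> iY Y0 mZ iZY.
have mZG : @measurable_fun _ _ TG R setT Z by apply/measurable_wrtP.
have mY : measurable_fun setT Y by apply/measurable_EFinP/(measurable_int P iY).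
have ipart (Z' : T -> R) : measurable_wrt G Z' -> (forall w, `|Z' w| <= `|Z w|) ->
    P.-integrable setT (fun w => (Z' w * Y w)%:E).
  move=> mZ' le; apply: (le_integrable measurableT _ _ iZY).
    apply/measurable_EFinP/measurable_funM => //; exact: measurable_wrt_fun.
  by move=> w _; rewrite lee_fin !normrM ler_wpM2r.
have mp : measurable_wrt G (Z^\+)%R.
  by apply/measurable_wrtP => //; apply: measurable_funrpos.
have mn : measurable_wrt G (Z^\-)%R.
  by apply/measurable_wrtP => //; apply: measurable_funrneg.
have ip : P.-integrable setT (fun w => (Z^\+%R w * Y w)%:E).
  apply: ipart => // w; rewrite /funrpos ger0_norm ?le_max ?lexx ?orbT//.
  by rewrite ge_max normr_ge0 andbT ler_norm.
have i_n : P.-integrable setT (fun w => (Z^\-%R w * Y w)%:E).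
  apply: ipart => // w; rewrite /funrneg ger0_norm ?le_max ?lexx ?orbT//.
  by rewrite ge_max normr_ge0 andbT -normrN ler_norm.
under eq_integral => w _ do rewrite -{1}(funrposBneg Z) /= mulrBl EFinB.
rewrite integralB// orth_ge0 ?orth_ge0 ?subee//.
Qed.

End SubSigmaAlgebra.

(** By the McShane formula, h x is the infimum over rational points q of
    h q + C |x - q|, so that the preimage of an open half-line is a countable
    union of measurable sets. *)
Lemma measurable_fun_lipschitz {R : realType} {dT} {T : measurableType dT} {d : nat}
    (h : 'rV[R]_d -> R) (C : R) (Y : T -> 'rV[R]_d) :
  0 <= C ->
  (forall x y, `|h x - h y| <= C * \sum_j `|x 0 j - y 0 j|) ->
  (forall j, measurable_fun setT (fun w => Y w 0 j)) ->
  measurable_fun setT (fun w => h (Y w)).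
Proof.
move=> C0 hL mY.
apply: (measurability _ (RGenInftyO.measurableE R)) => /= _ [_ [t ->] <-].
rewrite setTI.
pose e (q : 'rV[rat]_d) : 'rV[R]_d := map_mx ratr q.
pose F q w := h (e q) + C * \sum_j `|Y w 0 j - e q 0 j|.
have -> : (fun w => h (Y w)) @^-1` `]-oo, t[%classic =
    \bigcup_q (F q @^-1` `]-oo, t[%classic).
  apply/seteqP; split => w /=; rewrite in_itv /=; last first.
    move=> [q _] /=; rewrite in_itv/=; apply: le_lt_trans.
    rewrite -lerBlDl; exact: le_trans (ler_norm _) (hL _ _).
  move=> ht.
  (* C + 1 and d + 1 are positive even when C or d is 0. *)
  pose eps := (t - h (Y w)) / (2 * (C + 1) * d.+1%:R).
  have C1 : 0 < C + 1 by rewrite ltr_wpDl.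
  have eps0 : 0 < eps.
    by rewrite divr_gt0 ?subr_gt0// !mulr_gt0.
  have hq j : exists q : rat, `|Y w 0 j - ratr q| < eps.
    have : Y w 0 j - eps < Y w 0 j + eps by lra.
    move=> /rat_in_itvoo[q]; rewrite in_itv/= => /andP[q1 q2]; exists q.
    by rewrite ltr_norml; apply/andP; split; lra.
  have [q Hq] := choice hq.
  exists (\row_j q j) => //=; rewrite in_itv /= /F.
  set S := \sum_j _.
  have SE : S <= eps * d%:R.
    rewrite mulrC -[d in d%:R]card_ord mulr_natl -sumr_const.
    by apply: ler_sum => j _; rewrite !mxE ltW.
  have hle : h (e (\row_j q j)) <= h (Y w) + C * S.
    rewrite -lerBlDl; apply: le_trans (ler_norm _) _.
    by rewrite distrC; exact: hL.
  have S0 : 0 <= S by apply: sumr_ge0.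
  have : (C + 1) * S * 2 < t - h (Y w).
    have -> : t - h (Y w) = (C + 1) * (eps * d.+1%:R) * 2.
      have := pnatr_eq0 R d.+1; rewrite /eps; move: (d.+1%:R : R) => D D0.
      by field; rewrite D0 (gt_eqF C1).
    rewrite ltr_pM2r// ltr_pM2l//; apply: le_lt_trans SE _.
    by rewrite ltr_pM2l// ltr_nat.
  rewrite mulrDl mul1r => H.
  by lra.
apply: countable_bigcupT_measurable => // q.
rewrite -[X in measurable X]setTI; apply: (_ : measurable_fun setT (F q)) => //.
apply: measurable_funD => //; apply: measurable_funM => //.
apply: measurable_sum => j; apply: measurableT_comp => //.
by apply: measurable_funB => //; exact: mY.
Qed.

(** * Random variables with conditional mean zero *)
Section CondMeanZero.
Context {R : realType} {dT : measure_display} {T : measurableType dT}.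
Variable (P : probability T R).
Implicit Types (G : set (set T)) (Y Z : T -> R).

Definition intble Y := P.-integrable setT (EFin \o Y).
Definition expect Y : R := \int[P]_w Y w.

Lemma expectD Y Z : intble Y -> intble Z ->
  expect (fun w => Y w + Z w) = expect Y + expect Z.
Proof. exact: RintegralD. Qed.

Lemma expectB Y Z : intble Y -> intble Z ->
  expect (fun w => Y w - Z w) = expect Y - expect Z.
Proof. exact: RintegralB. Qed.

Lemma expectZ a Y : intble Y -> expect (fun w => a * Y w) = a * expect Y.
Proof. exact: RintegralZl. Qed.

Lemma intbleD Y Z : intble Y -> intble Z -> intble (fun w => Y w + Z w).
Proof. exact: integrableD. Qed.

Lemma intbleB Y Z : intble Y -> intble Z -> intble (fun w => Y w - Z w).
Proof.
by move=> iY iZ; have := integrableB measurableT iY iZ; exact: eq_integrable.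
Qed.

Lemma intbleZ a Y : intble Y -> intble (fun w => a * Y w).
Proof. exact: integrableZl. Qed.

Lemma intble_cst a : intble (fun=> a).
Proof. exact: finite_measure_integrable_cst. Qed.

Lemma expect_cst a : expect (fun=> a) = a.
Proof.
by rewrite /expect Rintegral_cst//= -[setT in P setT]/setT probability_setT mulr1.
Qed.

Lemma le_expect Y Z : intble Y -> intble Z -> (forall w, Y w <= Z w) ->
  expect Y <= expect Z.
Proof. by move=> iY iZ YZ; apply: le_Rintegral => // w _; exact: YZ. Qed.

Lemma eq_expect Y Z : Y =1 Z -> expect Y = expect Z.
Proof. by move=> /funext ->. Qed.

Lemma intble_sum (I : finType) (Y : I -> T -> R) :
  (forall i, intble (Y i)) -> intble (fun w => \sum_i Y i w).
Proof.
move=> iY; rewrite /intble (_ : _ \o _ = fun w => (\sum_i (Y i w)%:E)%E).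
  by apply: integrable_sum => // i _; exact: iY.
by apply/funext => w; rewrite /= sumEFin.
Qed.

Lemma expect_sum (I : finType) (Y : I -> T -> R) :
  (forall i, intble (Y i)) ->
  expect (fun w => \sum_i Y i w) = \sum_i expect (Y i).
Proof.
move=> iY; rewrite /expect /Rintegral.
under eq_integral do rewrite -sumEFin.
rewrite integral_sum//.
rewrite -[RHS]/(fine (\sum_i expect (Y i))%:E) -sumEFin; congr fine.
apply: eq_bigr => i _; rewrite /expect /Rintegral fineK//.
by apply: integrable_fin_num => //; exact: iY.
Qed.

Lemma intble_le Y Z : measurable_fun setT Y -> (forall w, `|Y w| <= Z w) ->
  intble Z -> intble Y.
Proof.
move=> mY YZ iZ; apply: (le_integrable measurableT _ _ iZ).
  exact/measurable_EFinP.
move=> w _ /=; rewrite lee_fin; apply: le_trans (YZ w) _; exact: ler_norm.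
Qed.

Lemma intble_measurable Y : intble Y -> measurable_fun setT Y.
Proof. by move=> iY; apply/measurable_EFinP/(measurable_int P iY). Qed.

Lemma intble_bounded_mul Y Z : measurable_fun setT Z -> (forall w, `|Z w| <= 1) ->
  intble Y -> intble (fun w => Z w * Y w).
Proof.
move=> mZ Z1 iY; apply: (@intble_le _ (fun w => `|Y w|)).
- by apply: measurable_funM => //; exact: intble_measurable.
- by move=> w; rewrite normrM ler_piMl.
- exact: integrable_norm.
Qed.

Lemma intble_bounded Y : measurable_fun setT Y -> (forall w, `|Y w| <= 1) ->
  intble Y.
Proof. by move=> mY Y1; apply: (intble_le mY Y1); exact: intble_cst. Qed.

Lemma integral_expect A Y : measurable A -> intble Y ->
  (\int[P]_(w in A) (Y w)%:E = (expect (fun w => \1_A w * Y w))%:E)%E.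
Proof.
move=> mA iY; rewrite /expect /Rintegral fineK; last first.
  apply: integrable_fin_num => //; apply: intble_bounded_mul => // w.
  by rewrite indicE; case: (_ \in _); rewrite ?normr1 ?normr0.
rewrite [LHS]integral_mkcond; apply: eq_integral => w _.
by rewrite patchE indicE; case: ifPn => _; rewrite ?mul1r ?mul0r.
Qed.

(** E[Y | G] = 0, stated without choosing a version of the conditional
    expectation. *)
Definition cond_mean_zero G Y :=
  intble Y /\ forall A, G A -> expect (fun w => \1_A w * Y w) = 0.

Lemma cond_mean_zeroB G Y Y' : G `<=` measurable ->
  cond_mean_zero G Y -> cond_mean_zero G Y' ->
  cond_mean_zero G (fun w => Y w - Y' w).
Proof.
move=> GT [iY Y0] [iY' Y0']; split; first exact: intbleB.
move=> A GA; rewrite (@eq_expect _ (fun w => \1_A w * Y w - \1_A w * Y' w)).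
  have b w : `|\1_A w : R| <= 1.
    by rewrite indicE; case: (_ \in _); rewrite ?normr1 ?normr0.
  have mA : measurable_fun setT (\1_A : T -> R) by apply: measurable_indic; exact: GT.
  rewrite expectB ?Y0 ?Y0' ?subr0//; exact: intble_bounded_mul.
by move=> w; rewrite mulrBr.
Qed.

Lemma cond_exp_mean_zero G Y Z : G `<=` measurable ->
  is_cond_exp P G Y Z -> cond_mean_zero G (fun w => Y w - Z w).
Proof.
move=> GT [iY iZ mZ YZ]; split; first exact: intbleB.
move=> A GA; have mA := GT _ GA.
have b w : `|\1_A w : R| <= 1.
  by rewrite indicE; case: (_ \in _); rewrite ?normr1 ?normr0.
have mi : measurable_fun setT (\1_A : T -> R) by exact: measurable_indic.
rewrite (@eq_expect _ (fun w => \1_A w * Y w - \1_A w * Z w)); last first.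
  by move=> w; rewrite mulrBr.
rewrite expectB; [|exact: intble_bounded_mul..].
have := YZ _ GA; rewrite !integral_expect// => -[->].
by rewrite subrr.
Qed.

(** Multipliers known given G can be taken out of the conditional expectation. *)
Lemma cond_mean_zero_orth G Y Z : sigma_algebra setT G -> G `<=` measurable ->
  cond_mean_zero G Y -> measurable_wrt G Z -> intble (fun w => Z w * Y w) ->
  expect (fun w => Z w * Y w) = 0.
Proof.
move=> sG GT [iY Y0] mZ iZY.
rewrite /expect /Rintegral (integral_orth sG GT iY)// => A GA.
by rewrite integral_expect ?Y0//; exact: GT.
Qed.

(** Dynkin's pi-lambda theorem: the sets over which Y integrates to 0 form a
    lambda-system. *)
Lemma cond_mean_zero_generated (C : set (set T)) Y :
  C `<=` measurable -> setI_closed C -> C setT ->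
  cond_mean_zero C Y -> cond_mean_zero <<s C >> Y.
Proof.
move=> CT CI CsetT [iY Y0]; split => //.
suff : <<s C >> `<=` [set A | measurable A /\ (\int[P]_(w in A) (Y w)%:E = 0)%E].
  by move=> h A /h[mA]; rewrite integral_expect// => -[].
apply: lambda_system_subset => //; last first.
  by move=> A CA /=; have mA := CT _ CA; rewrite integral_expect// Y0.
apply/dynkin_lambda_system; split => /=.
- by split => //; have mA := CT _ CsetT; rewrite integral_expect// Y0.
- move=> A [mA A0]; split; first exact: measurableC.
  have := integral_setU_EFin P mA (measurableC mA) (f := Y).
  rewrite setUv A0 => /(_ (intble_measurable iY)).
  have -> : [disjoint A & ~` A] by apply/disj_setPCl.
  move=> /(_ isT); rewrite add0e => <-.
  by rewrite integral_expect ?Y0//; exact: CT.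
- move=> F tF h.
  have mF k : measurable (F k) by have [] := h k.
  split; first exact: bigcupT_measurable.
  rewrite integral_bigcup//; last first.
    by apply: integrableS iY => //; exact: bigcupT_measurable.
  by apply: eseries0 => i _ _; have [] := h i.
Qed.
End CondMeanZero.

(** * Conditional independence *)
Section MeasurableWrt.
Context {R : realType} {dT : measure_display} {T : measurableType dT}.
Variable (G : set (set T)).
Hypothesis sG : sigma_algebra setT G.
Implicit Types (Y Z : T -> R) (A : set T).

Lemma measurable_wrt_ltr Y Z : measurable_wrt G Y -> measurable_wrt G Z ->
  G [set w | Y w < Z w].
Proof.
move=> /(measurable_wrtP sG) mY /(measurable_wrtP sG) mZ.
have := @measurable_funB _ _ _ _ _ _ mZ mY measurableT _ (measurable_itv `]0, +oo[).
rewrite [X in X _ -> _](sigma_algebra_id sG); congr G.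
by apply/seteqP; split => w /=; rewrite in_itv/= andbT subr_gt0 // => -[].
Qed.

Lemma measurable_wrt_cst d' (T' : measurableType d') (a : T') :
  measurable_wrt G (fun=> a).
Proof. by apply/measurable_wrtP => //; exact: measurable_cst. Qed.

Lemma measurable_wrt_indic A : G A -> measurable_wrt G (\1_A : T -> R).
Proof.
move=> GA; apply/measurable_wrtP => //.
by apply: (@measurable_indic _ (g_sigma_algebraType G)); exact: sub_sigma_algebra.
Qed.

Lemma measurable_wrtM Y Z : measurable_wrt G Y -> measurable_wrt G Z ->
  measurable_wrt G (fun w => Y w * Z w).
Proof.
move=> /(measurable_wrtP sG) mY /(measurable_wrtP sG) mZ.
by apply/measurable_wrtP => //; exact: measurable_funM.
Qed.

End MeasurableWrt.

Section ConditionalIndependence.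
Context {R : realType} {dT : measure_display} {T : measurableType dT}.
Variable (P : probability T R) (G : set (set T)).
Hypothesis sG : sigma_algebra setT G.
Hypothesis GT : G `<=` measurable.
Implicit Types (Y Z : T -> R) (A : set T).

Lemma normr_indic_le1 A w : `|\1_A w : R| <= 1.
Proof. by rewrite indicE; case: (_ \in _); rewrite ?normr1 ?normr0. Qed.

(** A nonnegative integrand with integral 0 vanishes almost everywhere.  This
    transfers to versions of conditional expectations the inequalities between
    the variables that they represent. *)
Lemma cond_mean_zero_null_set Y A (s : R) : cond_mean_zero P G Y -> G A ->
  (forall w, A w -> 0 < s * Y w) -> {ae P, forall w, ~ A w}.
Proof.
move=> [iY Y0] GA sY.
have i1 : intble P (fun w => \1_A w * Y w).
  apply: intble_bounded_mul => //; last exact: normr_indic_le1.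
  by apply: measurable_indic; exact: GT.
have p w : 0 <= s * (\1_A w * Y w).
  rewrite mulrCA indicE; case: (boolP (w \in A)) => [/set_mem /sY /ltW|_].
    by rewrite mul1r.
  by rewrite mul0r.
have : (\int[P]_w `|(s * (\1_A w * Y w))%:E| = 0)%E.
  under eq_integral => w _ do rewrite gee0_abs ?lee_fin//.
  rewrite -(@fineK _ (integral _ _ _)).
    by rewrite -[fine _]/(expect P _) expectZ// Y0// mulr0.
  by apply: integrable_fin_num => //; exact: intbleZ.
move/ae_eq_integral_abs => /(_ measurableT) H.
have /H : measurable_fun setT (fun w => (s * (\1_A w * Y w))%:E).
  by apply: (measurable_int P); exact: intbleZ.
apply: filterS => w /(_ I) /= [] E Aw; have := sY _ Aw.
by move: E; rewrite indicE mem_set// mul1r => ->; rewrite ltxx.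
Qed.

Lemma cond_mean_zero_ae Y Y' : cond_mean_zero P G Y -> intble P Y' ->
  {ae P, forall w, Y w = Y' w} -> cond_mean_zero P G Y'.
Proof.
move=> [iY Y0] iY' YY'; split => // A GA; rewrite -(Y0 _ GA).
have m1 : measurable_fun setT (\1_A : T -> R) by apply: measurable_indic; exact: GT.
congr fine; apply: ae_eq_integral => //.
- by apply/measurable_EFinP/measurable_funM => //; exact: intble_measurable iY'.
- by apply/measurable_EFinP/measurable_funM => //; exact: intble_measurable iY.
- by apply: filterS YY' => w /= ->.
Qed.

Lemma cond_exp_unique Y Z Z' : is_cond_exp P G Y Z -> is_cond_exp P G Y Z' ->
  {ae P, forall w, Z w = Z' w}.
Proof.
move=> cZ cZ'; have [_ iZ mZ _] := cZ; have [_ iZ' mZ' _] := cZ'.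
have c := cond_mean_zeroB GT (cond_exp_mean_zero GT cZ') (cond_exp_mean_zero GT cZ).
have := cond_mean_zero_null_set (s := 1) c (measurable_wrt_ltr sG mZ' mZ).
have := cond_mean_zero_null_set (s := -1) c (measurable_wrt_ltr sG mZ mZ').
move=> /(_ _)/wrap[|h1]; first by move=> w /= ?; lra.
move=> /(_ _)/wrap[|h2]; first by move=> w /= ?; lra.
apply: filterS2 h1 h2 => w /= /negP + /negP; rewrite -!leNgt => a b.
by apply/eqP; rewrite eq_le a b.
Qed.

(** A version of a conditional probability lies in [0, 1] only almost
    everywhere.  Clipping makes the bound hold everywhere, so that products with
    integrable variables are integrable. *)
Definition clip (a : R) : R := Num.max 0 (Num.min 1 a).

Lemma clip_bounds a : 0 <= clip a <= 1.
Proof. by rewrite /clip le_max lexx /= ge_max ler01 ge_min lexx. Qed.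

Lemma clip_id a : ~ (a < 0) -> ~ (1 < a) -> clip a = a.
Proof.
move=> /negP + /negP; rewrite -!leNgt => a0 a1.
by rewrite /clip (min_idPr a1) (max_idPr a0).
Qed.

Lemma measurable_wrt_clip Z : measurable_wrt G Z -> measurable_wrt G (clip \o Z).
Proof.
move=> /(measurable_wrtP sG) mZ; apply/measurable_wrtP => //.
by apply: measurable_maxr; [exact: measurable_cst|apply: measurable_minr; [exact: measurable_cst|]].
Qed.

Lemma cond_exp_indic_clip B Z : is_cond_exp P G \1_B Z ->
  {ae P, forall w, Z w = clip (Z w)}.
Proof.
move=> cZ; have [_ iZ mZ _] := cZ.
have c := cond_exp_mean_zero GT cZ.
have := cond_mean_zero_null_set (s := -1) c
  (measurable_wrt_ltr sG (measurable_wrt_cst sG (1 : R)) mZ).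
have := cond_mean_zero_null_set (s := 1) c
  (measurable_wrt_ltr sG mZ (measurable_wrt_cst sG (0 : R))).
move=> /(_ _)/wrap[|h1].
  by move=> w /= ?; rewrite indicE; case: (_ \in _) => /=; lra.
move=> /(_ _)/wrap[|h2].
  by move=> w /= ?; rewrite indicE; case: (_ \in _) => /=; lra.
by apply: filterS2 h1 h2 => w /= a b; rewrite clip_id.
Qed.

Context (N : nat) (dX : 'I_N -> measure_display).
Context (X : forall i, measurableType (dX i)) (xi : forall i, T -> X i).
Hypothesis mxi : forall i, measurable_fun setT (xi i).
Hypothesis indep : cond_independent P G xi.

(** The product rule is used for the family that is Bi at i, Bj at j and the
    whole space elsewhere: versions of the probability of the whole space equal
    1 almost everywhere and drop out of the product. *)
Lemma cond_independent_pair i j (Bi : set (X i)) (Bj : set (X j)) : i != j ->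
  measurable Bi -> measurable Bj ->
  exists Zi Zj : T -> R, [/\ measurable_wrt G Zi /\ measurable_wrt G Zj,
    (forall w, `|Zi w| <= 1) /\ (forall w, `|Zj w| <= 1),
    cond_mean_zero P G (fun w => \1_(xi i @^-1` Bi) w - Zi w),
    cond_mean_zero P G (fun w => \1_(xi j @^-1` Bj) w - Zj w) &
    cond_mean_zero P G (fun w =>
      \1_(xi i @^-1` Bi) w * \1_(xi j @^-1` Bj) w - Zi w * Zj w)].
Proof.
move=> ij mBi mBj.
pose S k := set (X k).
pose B := @eqtype.dfwith _ S (@eqtype.dfwith _ S (fun k => [set: X k]) i Bi) j Bj.
have Bj_ : B j = Bj by rewrite /B eqtype.dfwith_in.
have Bi_ : B i = Bi by rewrite /B eqtype.dfwith_out 1?eq_sym// eqtype.dfwith_in.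
have Bk k : k != i -> k != j -> B k = setT.
  by move=> ki kj; rewrite /B eqtype.dfwith_out 1?eq_sym// eqtype.dfwith_out 1?eq_sym.
have mB k : measurable (B k).
  have [->|kj] := eqVneq k j; first by rewrite Bj_.
  have [->|ki] := eqVneq k i; first by rewrite Bi_.
  by rewrite Bk.
have [Z [cZ cprod]] := indep mB.
have mZ k : measurable_wrt G (Z k) by have [] := cZ k.
have clip1 k w : `|clip (Z k w)| <= 1.
  by have /andP[a0 a1] := clip_bounds (Z k w); rewrite ger0_norm.
have mclip k : measurable_wrt G (clip \o Z k) by exact: measurable_wrt_clip.
have iclip k : intble P (clip \o Z k).
  by apply: intble_bounded; [exact: (measurable_wrt_fun GT (mclip k))|exact: clip1].
have iind A : measurable A -> intble P (\1_A : T -> R).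
  move=> mA; apply: intble_bounded; first exact: measurable_indic.
  exact: normr_indic_le1.
have mpre k C : measurable C -> measurable (xi k @^-1` C).
  by move=> mC; rewrite -[X in measurable X]setTI; exact: mxi.
have zclip k : {ae P, forall w, Z k w = clip (Z k w)}.
  exact: cond_exp_indic_clip (cZ k).
have z1 k : k != i -> k != j -> {ae P, forall w, Z k w = 1}.
  move=> ki kj; apply: (cond_exp_unique (cZ k)).
  rewrite Bk// preimage_setT.
  have i1 := iind _ (@measurableT _ T).
  split => //; first exact: intble_cst.
    exact: measurable_wrt_cst.
  by move=> A GA; apply: eq_integral => w _; rewrite indicE in_setT.
exists (clip \o Z i), (clip \o Z j); split => //.
- by split => w; exact: clip1.
- apply: cond_mean_zero_ae (cond_exp_mean_zero GT (cZ i)) _ _.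
    by apply: intbleB => //; apply/iind/mpre.
  by rewrite Bi_; apply: filterS (zclip i) => w /= <-.
- apply: cond_mean_zero_ae (cond_exp_mean_zero GT (cZ j)) _ _.
    by apply: intbleB => //; apply/iind/mpre.
  by rewrite Bj_; apply: filterS (zclip j) => w /= <-.
- apply: cond_mean_zero_ae (cond_exp_mean_zero GT cprod) _ _.
    apply: intbleB; apply: intble_bounded_mul.
    + by apply: measurable_indic; exact: mpre.
    + exact: normr_indic_le1.
    + by apply/iind/mpre.
    + exact: (measurable_wrt_fun GT (mclip i)).
    + exact: clip1.
    + exact: iclip.
  have ind w : \1_[set w | forall k, B k (xi k w)] w =
      \1_(xi i @^-1` Bi) w * \1_(xi j @^-1` Bj) w :> R.
    rewrite !indicE -natrM mulnb; congr (_%:R); congr nat_of_bool.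
    apply/idP/andP => [/set_mem h|[/set_mem hi /set_mem hj]].
      by split; apply/mem_set => /=; rewrite -?Bi_ -?Bj_.
    apply/mem_set => k.
    have [->|kj] := eqVneq k j; first by rewrite Bj_.
    have [->|ki] := eqVneq k i; first by rewrite Bi_.
    by rewrite Bk.
  have z1all : {ae P, forall w k, k != i -> k != j -> Z k w = 1}.
    apply: filter_forall => k.
    have [->|kj] := eqVneq k j; first by apply: aeW.
    have [->|ki] := eqVneq k i; first by apply: aeW.
    by apply: filterS (z1 _ ki kj).
  apply: filterS3 z1all (zclip i) (zclip j) => w h /= <- <-.
  rewrite ind (bigD1 i)//= (bigD1 j) 1?eq_sym//= big1 ?mulr1// => k /andP[ki kj].
  exact: h.
Qed.

(** A pi-system that generates the sigma-algebra spanned by G and xi i. *)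
Definition joint_sets i : set (set T) :=
  [set C | exists A B, [/\ G A, measurable B & C = A `&` xi i @^-1` B]].

Lemma joint_sets_measurable i : joint_sets i `<=` measurable.
Proof.
move=> _ [A [B [GA mB ->]]]; apply: measurableI; first exact: GT.
by rewrite -[X in measurable X]setTI; exact: mxi.
Qed.

Lemma joint_sets_setI i : setI_closed (joint_sets i).
Proof.
move=> _ _ [A [B [GA mB ->]]] [A' [B' [GA' mB' ->]]].
exists (A `&` A'), (B `&` B'); split; last by rewrite preimage_setI setIACA.
  rewrite -(sigma_algebra_id sG).
  by apply: (@measurableI _ (g_sigma_algebraType G)); exact: sub_sigma_algebra.
exact: measurableI.
Qed.

Lemma joint_setsT i : joint_sets i setT.
Proof.
exists setT, setT; split => //; last by rewrite preimage_setT setTI.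
by case: sG => s0 sC _; rewrite -(setD0 setT); exact: sC.
Qed.

Lemma joint_sigma_sub i : <<s joint_sets i >> `<=` measurable.
Proof.
apply: smallest_sub; first exact: sigma_algebra_measurable.
exact: joint_sets_measurable.
Qed.

Lemma joint_sigma_algebra i : sigma_algebra setT <<s joint_sets i >>.
Proof. exact: smallest_sigma_algebra. Qed.

Lemma sub_joint_sigma i : G `<=` <<s joint_sets i >>.
Proof.
move=> A GA; apply: sub_sigma_algebra; exists A, setT; split => //.
by rewrite preimage_setT setIT.
Qed.

Lemma measurable_wrt_joint i : measurable_wrt <<s joint_sets i >> (xi i).
Proof.
move=> B mB; apply: sub_sigma_algebra; exists setT, B; split => //.
  by case: sG => s0 sC _; rewrite -(setD0 setT); exact: sC.
by rewrite setTI.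
Qed.

Let mindic A : measurable A -> measurable_fun setT (\1_A : T -> R).
Proof. exact: measurable_indic. Qed.

Let indic_setI A A' w : \1_(A `&` A') w = \1_A w * \1_A' w :> R.
Proof. by rewrite indicI. Qed.

(** Given G, xi i carries no information on xi j: a version of the probability
    of xi j in B given G is also a version given G and xi i.  On a generating
    set, where xi i is in Bi, the difference splits through the versions for the
    pair (Bi, B) into three variables centred given G, each with a multiplier
    known given G. *)
Lemma cond_independent_orth_joint i j (B : set (X j)) : i != j -> measurable B ->
  exists Z : T -> R, [/\ measurable_wrt G Z, forall w, `|Z w| <= 1 &
    cond_mean_zero P <<s joint_sets i >> (fun w => \1_(xi j @^-1` B) w - Z w)].
Proof.
move=> ij mB.
have [Z0 [Z [[_ mZ] [_ Z1] _ cZ _]]] := cond_independent_pair ij measurableT mB.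
exists Z; split => //.
apply: cond_mean_zero_generated; [exact: joint_sets_measurable|
  exact: joint_sets_setI|exact: joint_setsT|].
split; first by case: cZ.
move=> _ [A [Bi [GA mBi ->]]].
have [Zi [Zj [[mZi mZj] [Zi1 Zj1] cZi cZj cZij]]] := cond_independent_pair ij mBi mB.
have mA := mindic (GT GA).
have fun_of V : measurable_wrt G V -> measurable_fun setT V.
  by move=> mV; exact: (measurable_wrt_fun GT mV).
have cD := cond_mean_zeroB GT cZ cZj.
have wA := measurable_wrt_indic sG GA.
have M1 V V' w : `|V w : R| <= 1 -> `|V' w : R| <= 1 -> `|V w * V' w| <= 1.
  by move=> ? ?; rewrite normrM mulr_ile1.
have i1 : intble P (fun w => \1_A w * (\1_(xi i @^-1` Bi) w * \1_(xi j @^-1` B) w - Zi w * Zj w)).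
  by apply: intble_bounded_mul => //; [exact: normr_indic_le1|case: cZij].
have i2 : intble P (fun w => (\1_A w * Z w) * (\1_(xi i @^-1` Bi) w - Zi w)).
  apply: intble_bounded_mul; last by case: cZi.
    by apply: measurable_funM => //; exact: fun_of.
  by move=> w; apply: M1 => //; exact: normr_indic_le1.
have i3 : intble P (fun w => (\1_A w * Zi w) *
    ((\1_(xi j @^-1` B) w - Z w) - (\1_(xi j @^-1` B) w - Zj w))).
  apply: intble_bounded_mul; last by case: cD.
    by apply: measurable_funM => //; exact: fun_of.
  by move=> w; apply: M1 => //; exact: normr_indic_le1.
rewrite (@eq_expect _ _ _ _ _ (fun w =>
  (\1_A w * (\1_(xi i @^-1` Bi) w * \1_(xi j @^-1` B) w - Zi w * Zj w)
   - (\1_A w * Z w) * (\1_(xi i @^-1` Bi) w - Zi w))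
   + (\1_A w * Zi w) *
    ((\1_(xi j @^-1` B) w - Z w) - (\1_(xi j @^-1` B) w - Zj w)))); last first.
  by move=> w; rewrite indic_setI; ring.
rewrite expectD//; last exact: intbleB.
rewrite expectB//.
rewrite (cond_mean_zero_orth sG GT cZij)//.
rewrite (cond_mean_zero_orth sG GT cZi)//; last exact: (measurable_wrtM sG).
rewrite (cond_mean_zero_orth sG GT cD)//; last exact: (measurable_wrtM sG).
by rewrite subrr addr0.
Qed.

(** Given G and xi j, the variable a is still centred: on a generating set the
    indicator of xi j in B may be replaced by a G-measurable version of its
    probability, because a is known given G and xi i.  Then b is a multiplier. *)
Lemma cond_independent_orth i j (a b : T -> R) : i != j ->
  measurable_wrt <<s joint_sets i >> a -> measurable_wrt <<s joint_sets j >> b ->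
  cond_mean_zero P G a -> intble P (fun w => b w * a w) ->
  expect P (fun w => b w * a w) = 0.
Proof.
move=> ij ma mb ca iab; have [ia _] := ca.
have mfa := intble_measurable ia.
apply: (cond_mean_zero_orth (@joint_sigma_algebra j) (@joint_sigma_sub j)) => //.
apply: cond_mean_zero_generated; [exact: joint_sets_measurable|
  exact: joint_sets_setI|exact: joint_setsT|].
split => // _ [A [B [GA mB ->]]].
have [Z [mZ Z1 cZ]] := cond_independent_orth_joint ij mB.
have mA := mindic (GT GA).
have mfZ : measurable_fun setT Z by exact: (measurable_wrt_fun GT mZ).
have mpre : measurable_fun setT (\1_(xi j @^-1` B) : T -> R).
  by apply: mindic; rewrite -[X in measurable X]setTI; exact: mxi.
have i1 : intble P (fun w => (\1_A w * Z w) * a w).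
  apply: intble_bounded_mul => //; first exact: measurable_funM.
  by move=> w; rewrite normrM mulr_ile1//; exact: normr_indic_le1.
have i2 : intble P (fun w => (\1_A w * a w) * (\1_(xi j @^-1` B) w - Z w)).
  have -> : (fun w => (\1_A w * a w) * (\1_(xi j @^-1` B) w - Z w)) =
      (fun w => (\1_A w * \1_(xi j @^-1` B) w) * a w - (\1_A w * Z w) * a w).
    by apply/funext => w; ring.
  apply: intbleB => //; apply: intble_bounded_mul => //.
    exact: measurable_funM.
  by move=> w; rewrite normrM mulr_ile1//; exact: normr_indic_le1.
rewrite (@eq_expect _ _ _ _ _ (fun w =>
  (\1_A w * a w) * (\1_(xi j @^-1` B) w - Z w) + (\1_A w * Z w) * a w)); last first.
  by move=> w; rewrite indic_setI; ring.
rewrite expectD// (cond_mean_zero_orth (@joint_sigma_algebra i) (@joint_sigma_sub i) cZ)//; last first.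
  apply: (measurable_wrtM (@joint_sigma_algebra i)) => //.
  by apply: (measurable_wrt_indic (@joint_sigma_algebra i)); exact: sub_joint_sigma.
rewrite (cond_mean_zero_orth sG GT ca)// ?addr0//.
exact: (measurable_wrtM sG) (measurable_wrt_indic sG GA) mZ.
Qed.

End ConditionalIndependence.

(** * Frobenius norms and mixing matrices *)
Section SquaredNorm.
Context {R : realType}.

Definition mdot m n (A B : 'M[R]_(m, n)) : R := \sum_i \sum_j A i j * B i j.

Lemma sqnorm_ge0 m n (A : 'M[R]_(m, n)) : 0 <= sqnorm A.
Proof. by apply: sumr_ge0 => i _; apply: sumr_ge0 => j _; exact: sqr_ge0. Qed.

Lemma sqnorm0 m n : sqnorm (0 : 'M[R]_(m, n)) = 0.
Proof.
by apply: big1 => i _; apply: big1 => j _; rewrite mxE expr0n.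
Qed.

Lemma sqnormZ m n a (A : 'M[R]_(m, n)) : sqnorm (a *: A) = a ^+ 2 * sqnorm A.
Proof.
rewrite /sqnorm mulr_sumr; apply: eq_bigr => i _; rewrite mulr_sumr.
by apply: eq_bigr => j _; rewrite mxE exprMn.
Qed.

Lemma sqnormN m n (A : 'M[R]_(m, n)) : sqnorm (- A) = sqnorm A.
Proof. by rewrite -scaleN1r sqnormZ sqrrN expr1n mul1r. Qed.

Lemma sqnormD m n (A B : 'M[R]_(m, n)) :
  sqnorm (A + B) = sqnorm A + 2 * mdot A B + sqnorm B.
Proof.
rewrite /sqnorm /mdot mulr_sumr -!big_split; apply: eq_bigr => i _.
rewrite mulr_sumr -!big_split; apply: eq_bigr => j _ /=.
by rewrite mxE; ring.
Qed.

Lemma sqnormD_young m n (b : R) (A B : 'M[R]_(m, n)) : 0 < b ->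
  sqnorm (A + B) <= (1 + b) * sqnorm A + (1 + b^-1) * sqnorm B.
Proof.
move=> b0; rewrite /sqnorm !mulr_sumr -big_split; apply: ler_sum => i _.
rewrite !mulr_sumr -big_split; apply: ler_sum => j _ /=; rewrite mxE.
set x := A i j; set y := B i j.
rewrite -subr_ge0.
have -> : (1 + b) * x ^+ 2 + (1 + b^-1) * y ^+ 2 - (x + y) ^+ 2 =
  b^-1 * (b * x - y) ^+ 2 by field; rewrite gt_eqF.
by rewrite mulr_ge0 ?sqr_ge0// invr_ge0 ltW.
Qed.

Lemma sqnormD_le2 m n (A B : 'M[R]_(m, n)) :
  sqnorm (A + B) <= 2 * sqnorm A + 2 * sqnorm B.
Proof. by have := sqnormD_young A B ltr01; rewrite invr1. Qed.

Lemma sqnorm_col m n (A : 'M[R]_(m, n)) : sqnorm A = \sum_j sqnorm (col j A).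
Proof.
rewrite /sqnorm exchange_big; apply: eq_bigr => j _; apply: eq_bigr => i _.
by rewrite big_ord1 mxE.
Qed.

Lemma sqnorm_row m n (A : 'M[R]_(m, n)) : sqnorm A = \sum_i sqnorm (row i A).
Proof.
rewrite /sqnorm; apply: eq_bigr => i _; rewrite big_ord1.
by apply: eq_bigr => j _; rewrite mxE.
Qed.

Lemma cauchy_schwarz (I : finType) (u v : I -> R) :
  (\sum_i u i * v i) ^+ 2 <= (\sum_i u i ^+ 2) * (\sum_i v i ^+ 2).
Proof.
set a := \sum_i u i ^+ 2; set b := \sum_i v i ^+ 2; set c := \sum_i u i * v i.
have a0 : 0 <= a by apply: sumr_ge0 => i _; exact: sqr_ge0.
have [a_eq0|an0] := eqVneq a 0.
  have u0 i : u i = 0.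
    have /eqP := a_eq0; rewrite psumr_eq0; last by move=> ? _; exact: sqr_ge0.
    by move=> /allP /(_ i (mem_index_enum _)); rewrite /= sqrf_eq0 => /eqP.
  rewrite /c big1; last by move=> i _; rewrite u0 mul0r.
  by rewrite expr0n /= a_eq0 mul0r.
have apos : 0 < a by rewrite lt_def an0.
have : 0 <= \sum_i (a * v i - c * u i) ^+ 2 by apply: sumr_ge0 => i _; exact: sqr_ge0.
have -> : \sum_i (a * v i - c * u i) ^+ 2 = a * (a * b - c ^+ 2).
  rewrite (eq_bigr (fun i => a ^+ 2 * v i ^+ 2 + (- 2 * a * c) * (u i * v i)
    + c ^+ 2 * u i ^+ 2)); last by move=> i _; ring.
  by rewrite !big_split /= -!mulr_sumr -/a -/b -/c; ring.
by rewrite pmulr_rge0// subr_ge0.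
Qed.

Lemma sqnorm_mulmx_le m n p (A : 'M[R]_(m, n)) (B : 'M[R]_(n, p)) :
  sqnorm (A *m B) <= sqnorm A * sqnorm B.
Proof.
rewrite [sqnorm B]sqnorm_col mulr_sumr [leLHS]sqnorm_col; apply: ler_sum => j _.
rewrite /sqnorm mulr_suml; apply: ler_sum => i _.
rewrite big_ord1 !mxE; apply: le_trans (cauchy_schwarz _ _) _.
rewrite ler_wpM2l//; first by apply: sumr_ge0 => ? _; exact: sqr_ge0.
by apply: ler_sum => k _; rewrite big_ord1 mxE.
Qed.

Lemma sqnorm_enorm m n (A : 'M[R]_(m, n)) : enorm A ^+ 2 = sqnorm A.
Proof. by rewrite sqr_sqrtr ?sqnorm_ge0. Qed.

(** The supremum that defines the operator norm is over a set bounded by the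
    Frobenius norm, hence is an upper bound.  A matrix acts on a stack column by
    column. *)
Lemma opnorm2_le N (A : 'M[R]_N) c n (B : 'M[R]_(N, n)) :
  opnorm2 A <= c -> sqnorm (A *m B) <= c ^+ 2 * sqnorm B.
Proof.
move=> Ac; rewrite [sqnorm B]sqnorm_col mulr_sumr [leLHS]sqnorm_col.
apply: ler_sum => j _; rewrite colE -mulmxA -colE; move: (col j B) => v.
have [v0|vn0] := eqVneq (sqnorm v) 0.
  by apply: le_trans (sqnorm_mulmx_le _ _) _; rewrite v0 !mulr0.
have vpos : 0 < sqnorm v by rewrite lt_def vn0 sqnorm_ge0.
have ev : 0 < enorm v by rewrite sqrtr_gt0.
set u := (enorm v)^-1 *: v.
have u1 : sqnorm u = 1.
  by rewrite sqnormZ -[sqnorm v]sqnorm_enorm exprVn mulVf// expf_neq0// gt_eqF.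
have Au : enorm (A *m u) <= c.
  apply: le_trans Ac; apply: ub_le_sup; last first.
    by exists u => //=; rewrite /enorm u1 sqrtr1.
  exists (Num.sqrt (sqnorm A)) => _ [x /= x1 <-].
  rewrite /enorm ler_sqrt ?sqnorm_ge0//; apply: le_trans (sqnorm_mulmx_le _ _) _.
  rewrite ler_piMr ?sqnorm_ge0// -sqnorm_enorm expr_le1//; exact: sqrtr_ge0.
have vE : v = enorm v *: u by rewrite /u scalerA mulfV ?scale1r// gt_eqF.
clearbody u; rewrite vE -scalemxAr !sqnormZ u1 mulr1 mulrC ler_wpM2r ?sqr_ge0//.
rewrite -sqnorm_enorm lerXn2r// ?nnegrE ?sqrtr_ge0//.
exact: le_trans (sqrtr_ge0 _) Au.
Qed.

Lemma jensen_sqr (I : finType) (w v : I -> R) :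
  (forall i, 0 <= w i) -> \sum_i w i = 1 ->
  (\sum_i w i * v i) ^+ 2 <= \sum_i w i * v i ^+ 2.
Proof.
move=> w0 w1; set m := \sum_i _.
have : 0 <= \sum_i w i * (v i - m) ^+ 2.
  by apply: sumr_ge0 => i _; rewrite mulr_ge0// sqr_ge0.
rewrite (eq_bigr (fun i => w i * v i ^+ 2 + (- 2 * m) * (w i * v i) + m ^+ 2 * w i));
  last by move=> i _; ring.
rewrite !big_split /= -!mulr_sumr w1 -/m.
by set s := \sum_i _; lra.
Qed.

End SquaredNorm.

Section Mixing.
Context {R : realType} {N : nat}.
Hypothesis N0 : (0 < N)%N.
Implicit Types (W : 'M[R]_N).
Local Notation Pi := (avg_mx R N).

Let Nn0 : (N%:R : R) != 0. Proof. by rewrite pnatr_eq0 -lt0n. Qed.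

Lemma mulmx_avg W : doubly_stochastic W -> W *m Pi = Pi.
Proof.
move=> [_ W1 _]; apply/matrixP => i j; rewrite !mxE.
under eq_bigr => k _ do rewrite mxE.
rewrite -mulr_suml; have /matrixP /(_ i 0) := W1; rewrite !mxE.
by under eq_bigr => k _ do rewrite mxE mulr1; move=> ->; rewrite mul1r.
Qed.

Lemma avg_mulmx W : doubly_stochastic W -> Pi *m W = Pi.
Proof.
move=> [_ _ W1]; apply/matrixP => i j; rewrite !mxE.
under eq_bigr => k _ do rewrite mxE.
rewrite -mulr_sumr; have /matrixP /(_ 0 j) := W1; rewrite !mxE.
by under eq_bigr => k _ do rewrite mxE mul1r; move=> ->; rewrite mulr1.
Qed.

Lemma avg_stochastic : doubly_stochastic Pi.
Proof.
split; first by move=> i j; rewrite mxE invr_ge0.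
- apply/matrixP => i j; rewrite !mxE.
  under eq_bigr => k _ do rewrite !mxE mulr1.
  by rewrite sumr_const card_ord -(mulr_natl N%:R^-1) mulfV.
- apply/matrixP => i j; rewrite !mxE.
  under eq_bigr => k _ do rewrite !mxE mul1r.
  by rewrite sumr_const card_ord -(mulr_natl N%:R^-1) mulfV.
Qed.

Lemma avg_idem : Pi *m Pi = Pi.
Proof. exact: mulmx_avg avg_stochastic. Qed.

Lemma sqnorm_stochastic W n (B : 'M[R]_(N, n)) :
  doubly_stochastic W -> sqnorm (W *m B) <= sqnorm B.
Proof.
move=> [W0 W1 W1']; rewrite sqnorm_col [leRHS]sqnorm_col; apply: ler_sum => j _.
rewrite /sqnorm; under eq_bigr do rewrite big_ord1 !mxE.
under [leRHS]eq_bigr do rewrite big_ord1 !mxE.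
have rs i : \sum_k W i k = 1.
  have /matrixP /(_ i 0) := W1; rewrite !mxE.
  by under eq_bigr => k _ do rewrite mxE mulr1.
have cs k : \sum_i W i k = 1.
  have /matrixP /(_ 0 k) := W1'; rewrite !mxE.
  by under eq_bigr => i _ do rewrite mxE mul1r.
apply: (@le_trans _ _ (\sum_i \sum_k W i k * B k j ^+ 2)).
  by apply: ler_sum => i _; exact: jensen_sqr.
rewrite exchange_big /=; apply: ler_sum => k _.
by rewrite -mulr_suml cs mul1r.
Qed.

Lemma sum_sqr_center (b : 'I_N -> R) (y : R) :
  let m := N%:R^-1 * \sum_i b i in
  \sum_i (b i - y) ^+ 2 = \sum_i (b i - m) ^+ 2 + N%:R * (m - y) ^+ 2.
Proof.
move=> m; have mE : \sum_i b i = N%:R * m by rewrite /m mulVKf.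
rewrite (eq_bigr (fun i => (b i - m) ^+ 2 + (2 * (m - y) * b i
  + (y ^+ 2 - m ^+ 2)))); last by move=> i _; ring.
rewrite big_split /= big_split /= -mulr_sumr mE sumr_const card_ord -(mulr_natl (y ^+ 2 - m ^+ 2)).
by ring.
Qed.

Definition row_mean n (B : 'M[R]_(N, n)) : 'rV[R]_n := N%:R^-1 *: \sum_i row i B.

Lemma row_meanE n (B : 'M[R]_(N, n)) j : row_mean B 0 j = N%:R^-1 * \sum_i B i j.
Proof. by rewrite mxE summxE; under eq_bigr do rewrite mxE. Qed.

Lemma avg_mulmxE n (B : 'M[R]_(N, n)) i j : (Pi *m B) i j = row_mean B 0 j.
Proof. by rewrite mxE row_meanE mulr_sumr; under eq_bigr do rewrite mxE. Qed.

(** Pythagoras for the splitting of a stack into its mean and its deviation from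
    the mean. *)
Lemma sqnorm_center_split n (B : 'M[R]_(N, n)) (y : 'rV[R]_n) :
  \sum_i sqnorm (row i B - y) =
  sqnorm ((1%:M - Pi) *m B) + N%:R * sqnorm (row_mean B - y).
Proof.
rewrite /sqnorm big_ord1 mulr_sumr.
under eq_bigr do rewrite big_ord1.
rewrite exchange_big [in RHS]exchange_big -big_split; apply: eq_bigr => j _ /=.
rewrite !mxE summxE; under eq_bigr do rewrite !mxE.
rewrite sum_sqr_center; congr (_ + _).
  apply: eq_bigr => i _; rewrite mulmxBl mul1mx !mxE; congr ((_ - _) ^+ 2).
  by rewrite mulr_sumr; under [RHS]eq_bigr do rewrite mxE.
by under [in RHS]eq_bigr do rewrite mxE.
Qed.

Lemma sqnorm_center_le n (B : 'M[R]_(N, n)) : sqnorm ((1%:M - Pi) *m B) <= sqnorm B.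
Proof.
have := sqnorm_center_split B 0; under eq_bigr do rewrite subr0.
rewrite -sqnorm_row => ->.
by rewrite lerDl mulr_ge0// sqnorm_ge0.
Qed.

Lemma row_mean_mulmx n W (B : 'M[R]_(N, n)) : doubly_stochastic W ->
  row_mean (W *m B) = row_mean B.
Proof.
move=> dW; apply/rowP => j; pose i : 'I_N := Ordinal N0.
by rewrite -(avg_mulmxE _ i) mulmxA avg_mulmx// avg_mulmxE.
Qed.

Lemma sqnorm_row_mean n (B : 'M[R]_(N, n)) :
  N%:R * sqnorm (row_mean B) <= sqnorm B.
Proof.
have := sqnorm_center_split B 0; under eq_bigr do rewrite subr0.
rewrite -sqnorm_row => ->; rewrite subr0.
by rewrite lerDr sqnorm_ge0.
Qed.

Lemma sqnorm_mixing_sub1 W n (B : 'M[R]_(N, n)) : doubly_stochastic W ->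
  sqnorm ((W - 1%:M) *m B) <= 4 * sqnorm B.
Proof.
move=> dW; rewrite mulmxBl mul1mx; apply: le_trans (sqnormD_le2 _ _) _.
by rewrite sqnormN; have := sqnorm_stochastic B dW; lra.
Qed.

Lemma deviation_center W : doubly_stochastic W -> (W - Pi) *m (1%:M - Pi) = W - Pi.
Proof.
move=> dW; rewrite mulmxBr mulmx1 mulmxBl mulmx_avg// avg_idem.
by rewrite subrr subr0.
Qed.

Lemma center_deviation W : doubly_stochastic W -> (1%:M - Pi) *m W = W - Pi.
Proof. by move=> dW; rewrite mulmxBl mul1mx avg_mulmx. Qed.

Lemma sqnorm_deviation W n (B : 'M[R]_(N, n)) : doubly_stochastic W ->
  sqnorm ((W - Pi) *m B) <= sqnorm B.
Proof.
move=> dW; rewrite -center_deviation// -mulmxA.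
exact: le_trans (sqnorm_center_le _) (sqnorm_stochastic _ dW).
Qed.

End Mixing.

(** * Energy over a window of tau steps *)
Section Lyapunov.
Context {R : realType} {N : nat}.
Variables (W : nat -> 'M[R]_N) (tau : nat) (lambda : R).
Hypothesis N0 : (0 < N)%N.
Hypothesis HW : network_assumption W tau lambda.
Local Notation Wt k := (W k - avg_mx R N).

Definition transition k s : 'M[R]_N :=
  \big[mulmx/1%:M]_(l <- rev (iota k s)) Wt l.

Lemma transition0 k : transition k 0 = 1%:M.
Proof. by rewrite /transition big_nil. Qed.

(** The recursion unrolls the oldest factor, the one that acts first. *)
Lemma transitionS k s : transition k s.+1 = transition k.+1 s *m Wt k.
Proof.
rewrite /transition /= rev_cons -cats1 big_cat_nested.
elim: (rev _) => [|l r IH]; first by rewrite !big_nil mul1mx big_cons big_nil mulmx1.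
by rewrite big_cons IH [in RHS]big_cons mulmxA.
Qed.

Let dW k : doubly_stochastic (W k). Proof. by case: HW. Qed.

Lemma transition_contraction k s n (B : 'M[R]_(N, n)) :
  sqnorm (transition k s *m B) <= sqnorm B.
Proof.
elim: s k B => [|s IH] k B; first by rewrite transition0 mul1mx.
rewrite transitionS -mulmxA; apply: le_trans (IH _ _) _.
exact: sqnorm_deviation.
Qed.

Lemma transition_window k n (B : 'M[R]_(N, n)) :
  sqnorm (transition k tau *m B) <= lambda ^+ 2 * sqnorm B.
Proof. by case: HW => _ _ _ /(_ k); exact: opnorm2_le. Qed.

(** The network is a contraction only over tau consecutive steps, whereas this
    quadratic form decreases at every step.  It lies between the squared norm
    and tau times the squared norm. *)
Definition window_energy k n (B : 'M[R]_(N, n)) : R :=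
  \sum_(s < tau) sqnorm (transition k s *m B).

Lemma window_energy_ge0 k n (B : 'M[R]_(N, n)) : 0 <= window_energy k B.
Proof. by apply: sumr_ge0 => s _; exact: sqnorm_ge0. Qed.

Lemma window_energy_le k n (B : 'M[R]_(N, n)) : window_energy k B <= tau%:R * sqnorm B.
Proof.
rewrite -[tau in tau%:R]card_ord mulr_natl -sumr_const.
by apply: ler_sum => s _; exact: transition_contraction.
Qed.

(** Shifting the window drops the term s = 0, the squared norm itself, and adds
    the term s = tau, at most lambda^2 times the squared norm. *)
Lemma window_energy_step k n (B : 'M[R]_(N, n)) :
  window_energy k.+1 (Wt k *m B) <= window_energy k B - (1 - lambda ^+ 2) * sqnorm B.
Proof.
have E : window_energy k.+1 (Wt k *m B) + sqnorm B =
    window_energy k B + sqnorm (transition k tau *m B).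
  transitivity (\sum_(s < tau.+1) sqnorm (transition k s *m B)).
    rewrite big_ord_recl transition0 mul1mx addrC; congr (_ + _).
    by apply: eq_bigr => s _; rewrite /= transitionS mulmxA.
  by rewrite big_ord_recr.
by have := transition_window k B; lra.
Qed.

Lemma window_energyD_young k n (b : R) (A B : 'M[R]_(N, n)) : 0 < b ->
  window_energy k (A + B) <= (1 + b) * window_energy k A + (1 + b^-1) * window_energy k B.
Proof.
move=> b0; rewrite /window_energy !mulr_sumr -big_split; apply: ler_sum => s _ /=.
by rewrite mulmxDr; exact: sqnormD_young.
Qed.

End Lyapunov.

(** * The mean iterate as an inexact gradient method *)
Section InexactGradientStep.
Context {R : realType} {N d : nat}.
Variables (mu L : R) (f : 'I_N -> 'rV[R]_d -> R) (xs : 'rV[R]_d).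
Hypotheses (N0 : (0 < N)%N) (mu0 : 0 < mu) (muL : mu <= L).
Hypothesis Hf : function_assumption mu L f xs.
Implicit Types (B : 'M[R]_(N, d)) (x y u v : 'rV[R]_d).

Let L0 : 0 < L. Proof. exact: lt_le_trans muL. Qed.
Let NR0 : 0 < (N%:R : R). Proof. by rewrite ltr0n. Qed.

Lemma dotvDr u x y : dotv u (x + y) = dotv u x + dotv u y.
Proof.
by rewrite /dotv -big_split; apply: eq_bigr => j _; rewrite mxE mulrDr.
Qed.

Lemma dotvNr u x : dotv u (- x) = - dotv u x.
Proof. by rewrite /dotv -sumrN; apply: eq_bigr => j _; rewrite mxE mulrN. Qed.

Lemma dotvZr u a x : dotv u (a *: x) = a * dotv u x.
Proof. by rewrite /dotv mulr_sumr; apply: eq_bigr => j _; rewrite mxE mulrCA. Qed.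

Lemma dotvC u v : dotv u v = dotv v u.
Proof. by apply: eq_bigr => j _; rewrite mulrC. Qed.

Lemma sqnorm_dotv u : sqnorm u = dotv u u.
Proof. by rewrite /sqnorm big_ord1; apply: eq_bigr => j _; rewrite expr2. Qed.

Lemma sqnormB_dotv u v : sqnorm (u - v) = sqnorm u - 2 * dotv u v + sqnorm v.
Proof.
by rewrite !sqnorm_dotv !(dotvDr, dotvNr) ![dotv (u - v) _]dotvC !(dotvDr, dotvNr)
  [dotv v u]dotvC; ring.
Qed.

Lemma dotv_le_enorm u v : dotv u v <= enorm u * enorm v.
Proof.
rewrite -sqrtrM ?sqnorm_ge0//; apply: le_trans (ler_norm _) _.
rewrite -sqrtr_sqr ler_sqrt ?mulr_ge0 ?sqnorm_ge0//.
by rewrite /sqnorm !big_ord1; exact: cauchy_schwarz.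
Qed.

Lemma grad_sqnorm_lipschitz i x y :
  sqnorm (grad (f i) x - grad (f i) y) <= L ^+ 2 * sqnorm (x - y).
Proof.
have [/(_ i) [_ /(_ x y) h] _ _] := Hf.
rewrite -!sqnorm_enorm -exprMn lerXn2r// nnegrE ?mulr_ge0 ?sqrtr_ge0//.
exact: ltW.
Qed.

(** Convexity at y bounds the increase by the slope at y, and the Lipschitz
    condition compares this slope with the one at x.  The constant L replaces
    the sharp L / 2. *)
Lemma descent i x y :
  f i y <= f i x + dotv (grad (f i) x) (y - x) + L * sqnorm (y - x).
Proof.
have [/(_ i) [_ /(_ y x) h] /(_ i) sc _] := Hf.
have := sc y x; rewrite -[x - y]opprB dotvNr sqnormN => H.
have H2 : dotv (grad (f i) y - grad (f i) x) (y - x) <= L * sqnorm (y - x).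
  apply: le_trans (dotv_le_enorm _ _) _; rewrite -sqnorm_enorm expr2 mulrA.
  by rewrite ler_wpM2r// sqrtr_ge0.
have H3 : dotv (grad (f i) y - grad (f i) x) (y - x) =
    dotv (grad (f i) y) (y - x) - dotv (grad (f i) x) (y - x).
  by rewrite dotvC dotvDr dotvNr ![dotv (y - x) _]dotvC.
have : 0 <= mu / 2 * sqnorm (y - x) by rewrite mulr_ge0 ?sqnorm_ge0 ?divr_ge0 ?ltW.
by lra.
Qed.

Definition grads B : 'M[R]_(N, d) := \matrix_i grad (f i) (row i B).

Lemma dotv_row_mean B v : dotv (row_mean B) v = N%:R^-1 * \sum_i dotv (row i B) v.
Proof.
rewrite dotvC dotvZr; congr (_ * _).
elim/big_rec2: _ => [|i a u _ <-]; last by rewrite dotvDr [dotv v _]dotvC.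
by rewrite /dotv big1// => j _; rewrite mxE mulr0.
Qed.

Lemma le_mean (a b : 'I_N -> R) : (forall i, a i <= b i) ->
  N%:R^-1 * \sum_i a i <= N%:R^-1 * \sum_i b i.
Proof. by move=> ab; rewrite ler_wpM2l ?invr_ge0 ?ler0n//; exact: ler_sum. Qed.

Lemma mean_cst (a : R) : N%:R^-1 * \sum_(i < N) a = a.
Proof. by rewrite sumr_const card_ord -(mulr_natl a) mulKf// gt_eqF. Qed.

(** For each agent, strong convexity from x_i to xs and descent from x_i to the
    mean bound the inner product by function values.  The consensus error then
    enters with coefficient L; a comparison of gradients would give L kappa and
    spoil the power 3/2 of kappa in the rate. *)
Lemma inexact_gradient B :
  dotv (row_mean (grads B)) (xs - row_mean B) <=
  mean_objective f xs - mean_objective f (row_mean B)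
  + L / N%:R * sqnorm ((1%:M - avg_mx R N) *m B)
  - mu / 2 * sqnorm (row_mean B - xs).
Proof.
set b := row_mean B; set h := sqnorm _.
have H i : dotv (row i (grads B)) (xs - b) <=
    f i xs - f i b + L * sqnorm (row i B - b) - mu / 2 * sqnorm (row i B - xs).
  rewrite rowK; have [_ /(_ i) sc _] := Hf.
  have h1 := sc (row i B) xs; have h2 := descent i (row i B) b.
  have -> : xs - b = (xs - row i B) - (b - row i B) by rewrite opprB addrA subrK.
  rewrite dotvDr dotvNr -[sqnorm (row i B - b)]sqnormN -[sqnorm (row i B - xs)]sqnormN !opprB.
  by lra.
rewrite dotv_row_mean; apply: le_trans (le_mean H) _.
rewrite !big_split /= !mulrDr !sumrN -!mulr_sumr !sqnorm_center_split//.
rewrite -/b subrr sqnorm0 mulr0 addr0 -/h /mean_objective !mulrN.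
have h0 : 0 <= mu / 2 * h / N%:R.
  by rewrite divr_ge0 ?mulr_ge0 ?sqnorm_ge0// ltW.
set X := sqnorm _.
have -> : N%:R^-1 * (mu / 2 * (h + N%:R * X)) = mu / 2 * h / N%:R + mu / 2 * X.
  by field; rewrite gt_eqF.
by rewrite [N%:R^-1 * (L * h)]mulrCA mulrAC; lra.
Qed.

(** The descent step of length 1 / (2 L) from b along the mean gradient cannot
    reach a value below the minimum. *)
Lemma mean_gradient_gap b :
  sqnorm (row_mean (grads (\matrix_i b))) <=
  4 * L * (mean_objective f b - mean_objective f xs).
Proof.
set m := row_mean _; have [_ _ opt] := Hf.
pose y := b - (2 * L)^-1 *: m.
have yb : y - b = - ((2 * L)^-1 *: m) by rewrite /y addrAC subrr add0r.
have := opt y.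
have H i := descent i b y.
have : mean_objective f y <= mean_objective f b + dotv m (y - b) + L * sqnorm (y - b).
  apply: le_trans (le_mean H) _; rewrite !big_split /= !mulrDr mean_cst.
  rewrite dotv_row_mean; under [in leRHS]eq_bigr do rewrite !rowK.
  by rewrite lexx.
rewrite yb dotvNr dotvZr sqnormN sqnormZ -sqnorm_dotv.
set s := sqnorm m; set Fy := mean_objective f y; set Fb := mean_objective f b.
set F := mean_objective f xs => h1 h2.
have : F <= Fb - s / (4 * L).
  apply: le_trans h2 (le_trans h1 _); rewrite le_eqVlt; apply/orP; left; apply/eqP.
  by field; rewrite gt_eqF.
have -> : (F <= Fb - s / (4 * L)) = (s / (4 * L) <= Fb - F).
  by rewrite lerBrDr -lerBrDl.
by rewrite ler_pdivrMr ?mulr_gt0// mulrC.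
Qed.

Lemma sqnorm_grads_sub B B' : sqnorm (grads B - grads B') <= L ^+ 2 * sqnorm (B - B').
Proof.
rewrite sqnorm_row [sqnorm (B - B')]sqnorm_row mulr_sumr; apply: ler_sum => i _.
by rewrite !linearB /= !rowK; exact: grad_sqnorm_lipschitz.
Qed.

Lemma sqnorm_sub_cst B v : sqnorm (B - \matrix_i v) =
  sqnorm ((1%:M - avg_mx R N) *m B) + N%:R * sqnorm (row_mean B - v).
Proof.
rewrite -sqnorm_center_split// sqnorm_row; apply: eq_bigr => i _.
by rewrite linearB /= rowK.
Qed.

Lemma row_meanB B B' : row_mean (B - B') = row_mean B - row_mean B'.
Proof.
rewrite /row_mean -scalerBr -sumrB; congr (_ *: _); apply: eq_bigr => i _.
exact: linearB.
Qed.

(** The squared gradient costs 8 a^2 L times the gap in function value, which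
    the inner product, with 2 a times the gap, pays for when 4 a L <= 1. *)
Lemma inexact_gradient_step B (a : R) : 0 < a -> 4 * a * L <= 1 ->
  sqnorm (row_mean B - xs - a *: row_mean (grads B)) <=
  (1 - a * mu) * sqnorm (row_mean B - xs)
  + 3 * a * L / N%:R * sqnorm ((1%:M - avg_mx R N) *m B).
Proof.
move=> a0 aL; set b := row_mean B; set h := sqnorm ((_ - _) *m _).
rewrite (sqnormB_dotv (b - xs)) dotvZr sqnormZ.
have H1 := inexact_gradient B; rewrite -/b -/h in H1.
have {H1}: - dotv (b - xs) (row_mean (grads B)) <= 
  mean_objective f xs - mean_objective f b + L / N%:R * h - mu / 2 * sqnorm (b - xs).
  by apply: le_trans H1; rewrite dotvC -dotvNr opprB.
have H2 := mean_gradient_gap b.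
have H3 : sqnorm (row_mean (grads B)) <=
    2 * (L ^+ 2 / N%:R * h) + 2 * sqnorm (row_mean (grads (\matrix_i b))).
  have -> : row_mean (grads B) = row_mean (grads B - grads (\matrix_i b))
     + row_mean (grads (\matrix_i b)) by rewrite row_meanB subrK.
  apply: le_trans (sqnormD_le2 _ _) _; rewrite lerD2r ler_wpM2l//.
  have := sqnorm_row_mean N0 (grads B - grads (\matrix_i b)).
  move=> /le_trans /(_ (sqnorm_grads_sub _ _)); rewrite sqnorm_sub_cst -/b.
  rewrite subrr sqnorm0 mulr0 addr0 -/h => H.
  by rewrite mulrAC ler_pdivlMr// mulrC.
have [_ _ /(_ b) opt] := Hf.
set G := sqnorm (row_mean (grads B)) in H3 *.
set G' := sqnorm (row_mean (grads _)) in H2 H3.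
set D := dotv _ _; set X := sqnorm _.
set gap := mean_objective f b - mean_objective f xs in H2.
have gap0 : 0 <= gap by rewrite subr_ge0.
rewrite -[mean_objective f xs - _]opprB -/gap => H1.
have hN0 : 0 <= h / N%:R by rewrite divr_ge0// sqnorm_ge0.
rewrite (_ : L / N%:R * h = L * (h / N%:R)) in H1; last by field; rewrite gt_eqF.
rewrite (_ : L ^+ 2 / N%:R * h = L ^+ 2 * (h / N%:R)) in H3; last by field; rewrite gt_eqF.
rewrite (_ : 3 * a * L / N%:R * h = 3 * a * L * (h / N%:R)); last by field; rewrite gt_eqF.
set q := h / N%:R in H1 H3 hN0 *.
have e1 : a ^+ 2 * G <= a ^+ 2 * (2 * (L ^+ 2 * q) + 8 * L * gap).
  by rewrite ler_wpM2l ?sqr_ge0//; lra.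
have e2 : a ^+ 2 * (2 * (L ^+ 2 * q) + 8 * L * gap) <= a * (L * q + 2 * gap).
  have -> : a ^+ 2 * (2 * (L ^+ 2 * q) + 8 * L * gap) =
    a * ((2 * a * L) * (L * q) + (4 * a * L) * (2 * gap)) by ring.
  rewrite ler_wpM2l ?(ltW a0)//; apply: lerD; rewrite ler_piMl//.
  - by rewrite mulr_ge0// ltW.
  - have : 0 < a * L by rewrite mulr_gt0.
    by move: aL; rewrite -!mulrA; lra.
  - by rewrite mulr_ge0.
have e3 : 2 * a * (- D) <= 2 * a * (- gap + L * q - mu / 2 * X).
  by apply: ler_wpM2l; [rewrite mulr_ge0// ltW|exact: H1].
have e4 : 2 * a * (- gap + L * q - mu / 2 * X) + a * (L * q + 2 * gap) = 3 * a * L * q - a * mu * X.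
  by field.
by lra.
Qed.

End InexactGradientStep.

(** * One step without noise *)
Section StepScalars.
Context {R : realType}.
Variables (a mu L dl : R).
Hypotheses (a0 : 0 < a) (mu0 : 0 < mu) (muL : mu <= L).
Hypotheses (dl0 : 0 < dl) (dl1 : dl <= 1).
Hypothesis small : 18432 * a ^+ 2 * L ^+ 3 <= mu * dl ^+ 4.

Let L0 : 0 < L. Proof. exact: lt_le_trans muL. Qed.

Lemma stepsize_sqr : 18432 * (a * L) ^+ 2 <= dl ^+ 4.
Proof.
rewrite -(ler_pM2l L0); apply: le_trans (_ : mu * dl ^+ 4 <= _).
  by apply: le_trans small; rewrite le_eqVlt; apply/orP; left; apply/eqP; ring.
by rewrite ler_wpM2r// exprn_ge0// ltW.
Qed.

Lemma stepsize_lin : 128 * (a * L) <= dl ^+ 2.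
Proof.
rewrite -ler_sqr ?nnegrE ?exprn_ge0 ?mulr_ge0 ?(ltW a0) ?(ltW L0) ?(ltW dl0)// exprMn -exprM.
apply: le_trans stepsize_sqr.
by rewrite ler_wpM2r ?sqr_ge0//; lra.
Qed.

Let aL0 : 0 < a * L. Proof. exact: mulr_gt0. Qed.
Let dl2 : dl ^+ 2 <= dl. Proof. by rewrite expr2 ler_piMr// ltW. Qed.

Lemma stepsize_mu : 128 * (a * mu) <= dl.
Proof.
apply: le_trans dl2; apply: le_trans stepsize_lin.
by rewrite !ler_wpM2l// ltW.
Qed.

Lemma stepsize_L : 4 * a * L <= 1.
Proof. by have := stepsize_lin; have := aL0; have := dl2; move: dl1; rewrite -mulrA; lra. Qed.

(** Weights of the consensus and tracking energies in the Lyapunov function, up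
    to the factor 1 / (N tau).  The first one lets the decrease of the consensus
    energy pay for the consensus error in the mean iterate, the second one lets
    the decrease of the tracking energy pay for the tracking error in the
    consensus step. *)
Definition consensus_weight : R := 16 * a * L / dl.
Definition tracking_weight : R := 24 * consensus_weight * a ^+ 2 / dl ^+ 2.

Lemma consensus_weight_gt0 : 0 < consensus_weight. Proof. by rewrite divr_gt0// !mulr_gt0. Qed.
Lemma tracking_weight_gt0 : 0 < tracking_weight.
Proof.
apply: divr_gt0; last exact: exprn_gt0.
apply: mulr_gt0; last exact: exprn_gt0.
by apply: mulr_gt0 => //; exact: consensus_weight_gt0.
Qed.

(** X, H, V and D are the squared errors of the mean, the consensus, the
    trackers and the gradients, per agent; p and q are the normalized energies.
    The decisive loop goes from X through D to the two energies and back to X: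
    its gain 4704 a^3 L^3 / dl^4 has to stay below a mu / 2, whence the bound on
    the stepsize. *)
Lemma step_scalars (X H V D p q : R) : 0 <= X -> 0 <= H -> 0 <= V ->
  D <= L ^+ 2 * (H + X) -> p <= H -> q <= V ->
  (1 - a * mu) * X + 3 * a * L * H
  + consensus_weight * (p - dl / 2 * H + 6 * a ^+ 2 / dl * (V + D))
  + tracking_weight * (q - dl / 2 * V + 12 / dl * D)
  <= (1 - a * mu / 2) * (X + consensus_weight * p + tracking_weight * q).
Proof.
move=> X0 H0 V0 DD pH qV.
have dn0 : dl != 0 by rewrite gt_eqF.
have t1 : consensus_weight * (6 * a ^+ 2 / dl * V) = tracking_weight * dl / 4 * V.
  by rewrite /tracking_weight; field.
(* D may be replaced by its bound only in a product with a nonnegative factor,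
   so its two coefficients are added first. *)
have t2 : consensus_weight * (6 * a ^+ 2 / dl * D) + tracking_weight * (12 / dl * D) =
   consensus_weight * (6 * a ^+ 2 * (dl ^+ 2 + 48) / dl ^+ 3) * D by rewrite /tracking_weight; field.
have dle : 6 * a ^+ 2 * (dl ^+ 2 + 48) / dl ^+ 3 <= 294 * a ^+ 2 / dl ^+ 3.
  rewrite ler_wpM2r ?invr_ge0 ?exprn_ge0 ?(ltW dl0)//.
  have -> : 294 * a ^+ 2 = 6 * a ^+ 2 * 49 by ring.
  apply: ler_wpM2l; first by apply: mulr_ge0 => //; exact: sqr_ge0.
  by have := dl2; move: dl1; lra.
have c0 : 0 <= 6 * a ^+ 2 * (dl ^+ 2 + 48) / dl ^+ 3.
  by rewrite divr_ge0 ?exprn_ge0 ?ltW// mulr_gt0 ?ltr_wpDl ?sqr_ge0// mulr_gt0 ?exprn_gt0.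
have t2' : consensus_weight * (6 * a ^+ 2 * (dl ^+ 2 + 48) / dl ^+ 3) * D <=
    consensus_weight * (294 * a ^+ 2 / dl ^+ 3) * (L ^+ 2 * (H + X)).
  apply: (@le_trans _ _ (consensus_weight * (6 * a ^+ 2 * (dl ^+ 2 + 48) / dl ^+ 3)
    * (L ^+ 2 * (H + X)))).
    by rewrite ler_wpM2l// mulr_ge0// ltW// consensus_weight_gt0.
  apply: ler_wpM2r; first by apply: mulr_ge0; [exact: sqr_ge0|exact: addr_ge0].
  by rewrite ler_wpM2l// ltW// consensus_weight_gt0.
have k3 : 294 * a ^+ 2 / dl ^+ 3 * L ^+ 2 <= dl / 16.
  rewrite mulrAC ler_pdivrMr ?exprn_gt0//; have := stepsize_sqr.
  have : 0 <= dl ^+ 4 by rewrite exprn_ge0// ltW.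
  by rewrite exprMn exprSr; lra.
have t3 : consensus_weight * (294 * a ^+ 2 / dl ^+ 3) * (L ^+ 2 * H) <= consensus_weight * (dl / 16) * H.
  by rewrite mulrA ler_wpM2r// -mulrA ler_wpM2l// ltW// consensus_weight_gt0.
have k4 : consensus_weight * (294 * a ^+ 2 / dl ^+ 3) * L ^+ 2 <= a * mu / 2.
  have -> : consensus_weight * (294 * a ^+ 2 / dl ^+ 3) * L ^+ 2 =
    a * (4704 * a ^+ 2 * L ^+ 3) / dl ^+ 4 by rewrite /consensus_weight; field.
  rewrite ler_pdivrMr ?exprn_gt0//.
  have -> : a * mu / 2 * dl ^+ 4 = a * (mu * dl ^+ 4 / 2) by field.
  rewrite ler_wpM2l ?(ltW a0)//.
  have : 0 <= mu * dl ^+ 4 by rewrite mulr_ge0 ?exprn_ge0 ?ltW.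
  by move: small; lra.
have t4 : consensus_weight * (294 * a ^+ 2 / dl ^+ 3) * (L ^+ 2 * X) <= a * mu / 2 * X.
  by rewrite mulrA ler_wpM2r.
have am : 0 <= a * mu / 2 by rewrite divr_ge0 ?mulr_ge0 ?ltW.
have am16 : a * mu / 2 <= dl / 16 by have := stepsize_mu; lra.
have step w y z : 0 < w -> 0 <= z -> y <= z -> a * mu / 2 * (w * y) <= w * (dl / 16) * z.
  move=> w0 z0 yz; apply: (@le_trans _ _ (a * mu / 2 * (w * z))).
    by rewrite ler_wpM2l// ler_wpM2l// ltW.
  by rewrite [leRHS]mulrAC [leRHS]mulrC ler_wpM2r// mulr_ge0// ltW.
have t5 := step _ _ _ consensus_weight_gt0 H0 pH.
have t6 := step _ _ _ tracking_weight_gt0 V0 qV.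
have wH : 0 <= consensus_weight * dl * H.
  by apply: mulr_ge0 => //; apply: mulr_ge0; apply: ltW => //; exact: consensus_weight_gt0.
have wV : 0 <= tracking_weight * dl * V.
  by apply: mulr_ge0 => //; apply: mulr_ge0; apply: ltW => //; exact: tracking_weight_gt0.
have tL : 3 * a * L * H = 3 / 16 * (consensus_weight * dl * H) by rewrite /consensus_weight; field.
move: t1 t2 t2' t3 t4 t5 t6 wH wV tL; move: consensus_weight tracking_weight => A B.
by lra.
Qed.

End StepScalars.

Section DeterministicStep.
Context {R : realType} {N d : nat}.
Variables (mu L : R) (f : 'I_N -> 'rV[R]_d -> R) (xs : 'rV[R]_d).
Variables (W : nat -> 'M[R]_N) (tau : nat) (lambda a : R).
Hypotheses (N0 : (0 < N)%N) (mu0 : 0 < mu) (muL : mu <= L) (a0 : 0 < a).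
Hypothesis Hf : function_assumption mu L f xs.
Hypothesis HW : network_assumption W tau lambda.
Local Notation dl := (delta tau lambda).
Hypothesis small : 18432 * a ^+ 2 * L ^+ 3 <= mu * dl ^+ 4.
Local Notation Pi := (avg_mx R N).
Local Notation Wt k := (W k - Pi).
Implicit Types (B V S : 'M[R]_(N, d)).

Let NR0 : 0 < (N%:R : R). Proof. by rewrite ltr0n. Qed.
Let tau0 : 0 < (tau%:R : R). Proof. by case: HW => _ t _ _; rewrite ltr0n. Qed.
Let l01 : 0 <= lambda < 1. Proof. by case: HW. Qed.
Let dW k : doubly_stochastic (W k). Proof. by case: HW. Qed.

Lemma delta_gt0 : 0 < dl.
Proof.
by rewrite divr_gt0// subr_gt0; have /andP[? ?] := l01; rewrite expr_lt1.
Qed.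

Lemma delta_le1 : dl <= 1.
Proof.
rewrite ler_pdivrMr// mul1r; apply: (@le_trans _ _ 1).
  by rewrite gerBl sqr_ge0.
by case: HW => _ t _ _; rewrite ler1n.
Qed.

Definition optgrads : 'M[R]_(N, d) := grads f (\matrix_i xs).

(** The mean is driven by the consensus error, the consensus error by the
    tracking deviation, and both deviations by the distance of the mean to the
    optimum; the weights make this loop contract. *)
Definition lyapunov k B V : R :=
  sqnorm (row_mean B - xs)
  + consensus_weight a L dl / (N%:R * tau%:R) * window_energy W tau k ((1%:M - Pi) *m B)
  + tracking_weight a L dl / (N%:R * tau%:R) * window_energy W tau k V.

Definition mean_next B : 'rV[R]_d := row_mean B - xs - a *: row_mean (grads f B).

Definition consensus_next k B V : 'M[R]_(N, d) :=
  Wt k *m ((1%:M - Pi) *m B - a *: (V + (grads f B - optgrads))).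

Definition track_next k B V : 'M[R]_(N, d) :=
  Wt k *m V + (W k - 1%:M) *m (grads f B - optgrads).

Let dl_tau : 1 - lambda ^+ 2 = dl * tau%:R.
Proof. by rewrite /delta mulfVK// gt_eqF. Qed.

(** Young's inequality with parameter dl / 2: the growth of the first energy is
    at most dl * tau / 2 times the squared norm, half of its decrement. *)
Lemma window_energy_perturbed_step k n (A E : 'M[R]_(N, n)) :
  window_energy W tau k.+1 (Wt k *m A + E) <=
  window_energy W tau k A - dl * tau%:R / 2 * sqnorm A + 3 * tau%:R / dl * sqnorm E.
Proof.
have b0 : 0 < dl / 2 by rewrite divr_gt0// delta_gt0.
apply: le_trans (window_energyD_young W tau k.+1 _ _ b0) _.
apply: lerD.
  have := window_energy_step HW k A; rewrite dl_tau => H.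
  apply: (@le_trans _ _ ((1 + dl / 2) * (window_energy W tau k A - dl * tau%:R * sqnorm A))).
    by rewrite ler_wpM2l// addr_ge0// ltW.
  have H2 : dl / 2 * window_energy W tau k A <= dl / 2 * (tau%:R * sqnorm A).
    by rewrite ler_wpM2l ?(ltW b0)//; exact: (window_energy_le N0 HW).
  have : 0 <= dl / 2 * (dl * tau%:R * sqnorm A).
    apply: mulr_ge0 (ltW b0) (mulr_ge0 (mulr_ge0 (ltW delta_gt0) (ltW tau0)) _).
    exact: sqnorm_ge0.
  by lra.
apply: (@le_trans _ _ (3 / dl * (tau%:R * sqnorm E))); last first.
  by rewrite mulrA [3 / dl * _]mulrAC.
apply: ler_pM; [|exact: window_energy_ge0| |exact: (window_energy_le N0 HW)].
  by rewrite addr_ge0// invr_ge0 ltW.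
have -> : 3 / dl = dl^-1 + (dl / 2)^-1 by field; rewrite gt_eqF ?delta_gt0.
by rewrite lerD2r -[leLHS]invr1 lef_pV2 ?posrE ?delta_gt0// delta_le1.
Qed.

Lemma lyapunov_deterministic_step k B V :
  sqnorm (mean_next B)
  + consensus_weight a L dl / (N%:R * tau%:R) * window_energy W tau k.+1 (consensus_next k B V)
  + tracking_weight a L dl / (N%:R * tau%:R) * window_energy W tau k.+1 (track_next k B V)
  <= (1 - a * mu / 2) * lyapunov k B V.
Proof.
have dl0 := delta_gt0; have dn0 : dl != 0 by rewrite gt_eqF.
have dl1 := delta_le1.
set D := grads f B - optgrads; set xh := (1%:M - Pi) *m B.
set NT := N%:R * tau%:R; have NT0 : 0 < NT by exact: mulr_gt0.
have wx0 : 0 < consensus_weight a L dl by apply: (consensus_weight_gt0 a0 mu0 muL).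
have wv0 : 0 < tracking_weight a L dl by apply: (tracking_weight_gt0 a0 mu0 muL).
have L0 : 0 < L by exact: lt_le_trans muL.
have h1 : sqnorm (mean_next B) <= (1 - a * mu) * sqnorm (row_mean B - xs)
    + 3 * a * L * (sqnorm xh / N%:R).
  have := inexact_gradient_step N0 mu0 muL Hf B a0 (stepsize_L a0 mu0 muL dl0 dl1 small).
  by rewrite -/xh [X in _ <= _ + X]mulrAC -[X in _ <= _ + X]mulrA.
have hD : sqnorm D / N%:R <= L ^+ 2 * (sqnorm xh / N%:R + sqnorm (row_mean B - xs)).
  rewrite ler_pdivrMr//; have := sqnorm_grads_sub mu0 muL Hf B (\matrix_i xs).
  rewrite -/optgrads -/D sqnorm_sub_cst// -/xh => /le_trans; apply.
  rewrite -[X in _ <= X]mulrA; apply: ler_wpM2l; first exact: sqr_ge0.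
  by rewrite mulrDl divfK ?gt_eqF// [X in _ <= _ + X]mulrC.
have c30 : 0 <= 3 * tau%:R / dl.
  by apply: divr_ge0 (ltW dl0); apply: mulr_ge0 => //; exact: ltW.
have hx : window_energy W tau k.+1 (consensus_next k B V) <=
    window_energy W tau k xh - dl * tau%:R / 2 * sqnorm xh
    + 6 * a ^+ 2 * tau%:R / dl * (sqnorm V + sqnorm D).
  rewrite /consensus_next -/D -/xh mulmxBr.
  apply: le_trans (window_energy_perturbed_step _ _ _) _; rewrite lerD2l sqnormN.
  have -> : 6 * a ^+ 2 * tau%:R / dl * (sqnorm V + sqnorm D) =
      3 * tau%:R / dl * (a ^+ 2 * (2 * sqnorm V + 2 * sqnorm D)) by field.
  apply: (ler_wpM2l c30).
  apply: le_trans (sqnorm_deviation N0 _ (dW k)) _.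
  rewrite sqnormZ; apply: ler_wpM2l (sqnormD_le2 _ _); exact: sqr_ge0.
have hv : window_energy W tau k.+1 (track_next k B V) <=
    window_energy W tau k V - dl * tau%:R / 2 * sqnorm V + 12 * tau%:R / dl * sqnorm D.
  apply: le_trans (window_energy_perturbed_step _ _ _) _; rewrite lerD2l.
  have -> : 12 * tau%:R / dl * sqnorm D = 3 * tau%:R / dl * (4 * sqnorm D) by field.
  apply: (ler_wpM2l c30).
  exact: sqnorm_mixing_sub1.
have key := step_scalars a0 mu0 muL dl0 dl1 small (sqnorm_ge0 (row_mean B - xs))
  (divr_ge0 (sqnorm_ge0 xh) (ltW NR0)) (divr_ge0 (sqnorm_ge0 V) (ltW NR0)) hD
  (p := window_energy W tau k xh / NT) (q := window_energy W tau k V / NT).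
have le_q n (A : 'M[R]_(N, n)) : window_energy W tau k A / NT <= sqnorm A / N%:R.
  rewrite ler_pdivrMr// /NT mulrA divfK ?gt_eqF// mulrC.
  exact: (window_energy_le N0 HW).
have {}key := key (le_q _ _) (le_q _ _).
rewrite /lyapunov -/NT -/xh.
have -> : consensus_weight a L dl / NT * window_energy W tau k xh =
    consensus_weight a L dl * (window_energy W tau k xh / NT).
  by rewrite mulrAC mulrA.
have -> : tracking_weight a L dl / NT * window_energy W tau k V =
    tracking_weight a L dl * (window_energy W tau k V / NT).
  by rewrite mulrAC mulrA.
apply: le_trans key; rewrite lerD//; first rewrite lerD//.
  rewrite -mulrA ler_wpM2l ?(ltW wx0)// mulrC ler_pdivrMr//; apply: le_trans hx _.
  rewrite le_eqVlt; apply/orP; left; apply/eqP; rewrite /NT; field.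
  by rewrite dn0 !gt_eqF.
rewrite -mulrA ler_wpM2l ?(ltW wv0)// mulrC ler_pdivrMr//; apply: le_trans hv _.
rewrite le_eqVlt; apply/orP; left; apply/eqP; rewrite /NT; field.
by rewrite dn0 !gt_eqF.
Qed.

End DeterministicStep.

(** * The recursion of gradient tracking *)
Section TrackingAlgebra.
Context {R : realType} {N d : nat} (X : 'I_N -> Type).
Variables (F : forall i, 'rV[R]_d -> X i -> R) (W : nat -> 'M[R]_N) (a : R).
Variables (x0 : 'I_N -> 'rV[R]_d) (s : nat -> forall i, X i).
Hypothesis N0 : (0 < N)%N.
Hypothesis dW : forall k, doubly_stochastic (W k).
Local Notation Pi := (avg_mx R N).
Local Notation Wt k := (W k - Pi).
Local Notation x_ k := (sgt (@F) W a x0 s k).1.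
Local Notation g_ k := (sgt (@F) W a x0 s k).2.

Definition sample_grads k : 'M[R]_(N, d) :=
  stack (fun i => sgrad (@F i) (x_ k i) (s k i)).

Lemma stackD (u v : 'I_N -> 'rV[R]_d) :
  stack (fun i => u i + v i) = stack u + stack v.
Proof. by apply/matrixP => i j; rewrite !mxE. Qed.

Lemma stackB (u v : 'I_N -> 'rV[R]_d) :
  stack (fun i => u i - v i) = stack u - stack v.
Proof. by apply/matrixP => i j; rewrite !mxE. Qed.

Lemma stackZ (c : R) (u : 'I_N -> 'rV[R]_d) :
  stack (fun i => c *: u i) = c *: stack u.
Proof. by apply/matrixP => i j; rewrite !mxE. Qed.

Lemma stack_mix (A : 'M[R]_N) (u : 'I_N -> 'rV[R]_d) :
  stack (fun i => \sum_j A i j *: u j) = A *m stack u.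
Proof.
apply/matrixP => i j; rewrite !mxE summxE; apply: eq_bigr => k _.
by rewrite !mxE.
Qed.

Lemma stack_iterateS k :
  stack (x_ k.+1) = W k *m (stack (x_ k) - a *: stack (g_ k)).
Proof.
by rewrite /=; case: (sgt _ _ _ _ _ k) => x g /=; rewrite stack_mix stackB stackZ.
Qed.

Lemma stack_trackerS k :
  stack (g_ k.+1) = W k *m stack (g_ k) + sample_grads k.+1 - sample_grads k.
Proof.
rewrite /sample_grads /=; case: (sgt _ _ _ _ _ k) => x g /=.
by rewrite stackB stackD stack_mix.
Qed.

Lemma stack_tracker0 : stack (g_ 0) = sample_grads 0.
Proof. by []. Qed.

Lemma row_meanD n (A B : 'M[R]_(N, n)) : row_mean (A + B) = row_mean A + row_mean B.
Proof.
rewrite /row_mean -scalerDr -big_split; congr (_ *: _); apply: eq_bigr => i _.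
by rewrite linearD.
Qed.

Lemma row_meanZ n (c : R) (A : 'M[R]_(N, n)) : row_mean (c *: A) = c *: row_mean A.
Proof.
rewrite /row_mean; under eq_bigr do rewrite linearZ /=.
by rewrite -scaler_sumr !scalerA mulrC.
Qed.

Lemma row_mean_tracker k : row_mean (stack (g_ k)) = row_mean (sample_grads k).
Proof.
elim: k => [//|k IH]; rewrite stack_trackerS row_meanB row_meanD row_mean_mulmx//.
by rewrite IH addrAC subrr add0r.
Qed.

Lemma row_mean_iterate k : row_mean (stack (x_ k.+1)) =
  row_mean (stack (x_ k)) - a *: row_mean (sample_grads k).
Proof.
by rewrite stack_iterateS row_mean_mulmx// row_meanB row_meanZ row_mean_tracker.
Qed.

Variable gs : 'M[R]_(N, d).

(** At step k this depends only on samples drawn before step k, so that the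
    fresh noise is orthogonal to it.  The shift by the gradients at the optimum
    makes it vanish at the fixed point, and makes it start from the term of C0
    in these gradients. *)
Definition track_dev k : 'M[R]_(N, d) :=
  (1%:M - Pi) *m (stack (g_ k) - sample_grads k + gs).

Lemma track_dev0 : track_dev 0 = (1%:M - Pi) *m gs.
Proof. by rewrite /track_dev stack_tracker0 subrr add0r. Qed.

Lemma track_devS_tracker k : track_dev k.+1 =
  Wt k *m stack (g_ k) - (1%:M - Pi) *m (sample_grads k - gs).
Proof.
rewrite /track_dev stack_trackerS.
rewrite (_ : _ - _ + gs = W k *m stack (g_ k) - (sample_grads k - gs)).
  by rewrite mulmxBr mulmxA center_deviation.
by apply/matrixP => i j; rewrite !mxE; ring.
Qed.

Lemma deviation_track k : Wt k *m track_dev k =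
  Wt k *m stack (g_ k) - Wt k *m (sample_grads k - gs).
Proof.
rewrite /track_dev mulmxA deviation_center// -mulmxBr; congr (_ *m _).
by apply/matrixP => i j; rewrite !mxE; ring.
Qed.

Lemma center_iterateS k (E : 'M[R]_(N, d)) :
  (1%:M - Pi) *m stack (x_ k.+1) =
  Wt k *m ((1%:M - Pi) *m stack (x_ k) - a *: (track_dev k + E))
  + (- a *: Wt k) *m (sample_grads k - gs - E).
Proof.
rewrite stack_iterateS mulmxA center_deviation//.
rewrite (mulmxBr _ (stack _)) -scalemxAr [in RHS]mulmxBr mulmxA deviation_center//.
rewrite -[in RHS]scalemxAr mulmxDr deviation_track -scalemxAl.
rewrite [Wt k *m (sample_grads k - gs - E)]mulmxBr.
move: (Wt k *m stack (x_ k)) (Wt k *m stack (g_ k)) (Wt k *m E).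
move: (Wt k *m (sample_grads k - gs)) => A1 A2 A3 A4.
by apply/matrixP => i j; rewrite !mxE; ring.
Qed.

Lemma track_devS k (E : 'M[R]_(N, d)) : track_dev k.+1 =
  Wt k *m track_dev k + (W k - 1%:M) *m E
  + (W k - 1%:M) *m (sample_grads k - gs - E).
Proof.
rewrite track_devS_tracker deviation_track -[in RHS]addrA -mulmxDr.
rewrite [E + _]addrC subrK !mulmxBl !mul1mx.
move: (Wt k *m stack (g_ k)) (Pi *m (sample_grads k - gs)) => A1 A2.
move: (W k *m (sample_grads k - gs)) => A3.
by apply/matrixP => i j; rewrite !mxE; ring.
Qed.

End TrackingAlgebra.

(** * Square-integrable random matrices *)
Section SquareIntegrable.
Context {R : realType} {dT : measure_display} {T : measurableType dT}.
Variable (P : probability T R).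
Implicit Types (Y Z : T -> R).

Definition sqint Y := measurable_fun setT Y /\ intble P (fun w => Y w ^+ 2).

Lemma intble_mul Y Z : sqint Y -> sqint Z -> intble P (fun w => Y w * Z w).
Proof.
move=> [mY iY] [mZ iZ]; apply: (@intble_le _ _ _ _ _ (fun w => Y w ^+ 2 + Z w ^+ 2)).
- exact: measurable_funM.
- move=> w; rewrite ler_norml.
  have := sqr_ge0 (Y w + Z w); have := sqr_ge0 (Y w - Z w).
  have := sqr_ge0 (Y w); have := sqr_ge0 (Z w).
  by move=> *; apply/andP; split; lra.
- exact: intbleD.
Qed.

Lemma sqint_le Y Z : measurable_fun setT Y -> intble P Z ->
  (forall w, Y w ^+ 2 <= Z w) -> sqint Y.
Proof.
move=> mY iZ YZ; split => //; apply: (intble_le _ _ iZ).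
  exact: measurable_funX.
by move=> w; rewrite ger0_norm ?sqr_ge0.
Qed.

Lemma sqintD Y Z : sqint Y -> sqint Z -> sqint (fun w => Y w + Z w).
Proof.
move=> [mY iY] [mZ iZ].
apply: (@sqint_le _ (fun w => 2 * Y w ^+ 2 + 2 * Z w ^+ 2)).
- exact: measurable_funD.
- by apply: intbleD; exact: intbleZ.
- by move=> w; have := sqr_ge0 (Y w - Z w); lra.
Qed.

Lemma sqintZ c Y : sqint Y -> sqint (fun w => c * Y w).
Proof.
move=> [mY iY]; split; first exact: measurable_funM.
by under eq_fun do rewrite exprMn; exact: intbleZ.
Qed.

Lemma sqint_cst c : sqint (fun=> c).
Proof. by split; [exact: measurable_cst|exact: intble_cst]. Qed.

Lemma sqint_sum (I : Type) (r : seq I) (Y : I -> T -> R) :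
  (forall i, sqint (Y i)) -> sqint (fun w => \sum_(i <- r) Y i w).
Proof.
move=> sY; elim: r => [|i r IH].
  by under eq_fun do rewrite big_nil; exact: sqint_cst.
by under eq_fun do rewrite big_cons; exact: sqintD.
Qed.

Definition mxsqint m n (A : T -> 'M[R]_(m, n)) :=
  forall i j, sqint (fun w => A w i j).

Lemma mxsqintD m n (A B : T -> 'M[R]_(m, n)) :
  mxsqint A -> mxsqint B -> mxsqint (fun w => A w + B w).
Proof. by move=> sA sB i j; under eq_fun do rewrite mxE; exact: sqintD. Qed.

Lemma mxsqintZ m n c (A : T -> 'M[R]_(m, n)) :
  mxsqint A -> mxsqint (fun w => c *: A w).
Proof. by move=> sA i j; under eq_fun do rewrite mxE; exact: sqintZ. Qed.

Lemma mxsqintB m n (A B : T -> 'M[R]_(m, n)) :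
  mxsqint A -> mxsqint B -> mxsqint (fun w => A w - B w).
Proof.
move=> sA sB; under eq_fun do rewrite -scaleN1r.
by apply: mxsqintD => //; exact: mxsqintZ.
Qed.

Lemma mxsqint_mull p m n (M : 'M[R]_(p, m)) (A : T -> 'M[R]_(m, n)) :
  mxsqint A -> mxsqint (fun w => M *m A w).
Proof.
move=> sA i j; under eq_fun do rewrite mxE.
by apply: sqint_sum => k; exact: sqintZ.
Qed.

Lemma mxsqint_cst m n (A : 'M[R]_(m, n)) : mxsqint (fun=> A).
Proof. by move=> i j; exact: sqint_cst. Qed.

Lemma intble_sqnorm m n (A : T -> 'M[R]_(m, n)) :
  mxsqint A -> intble P (fun w => sqnorm (A w)).
Proof.
by move=> sA; apply: intble_sum => i; apply: intble_sum => j; case: (sA i j).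
Qed.

Definition mxwrt (G : set (set T)) m n (A : T -> 'M[R]_(m, n)) :=
  forall i j, measurable_wrt G (fun w => A w i j).

Section Orthogonality.
Variable (G : set (set T)).
Hypotheses (sG : sigma_algebra setT G) (GT : G `<=` measurable).

Lemma measurable_wrtD Y Z : measurable_wrt G Y -> measurable_wrt G Z ->
  measurable_wrt G (fun w => Y w + Z w).
Proof.
move=> /(measurable_wrtP sG) mY /(measurable_wrtP sG) mZ.
by apply/measurable_wrtP => //; exact: measurable_funD.
Qed.

Lemma measurable_wrtZ c Y : measurable_wrt G Y -> measurable_wrt G (fun w => c * Y w).
Proof. by move=> mY; apply: measurable_wrtM => //; exact: measurable_wrt_cst. Qed.

Lemma mxwrtD m n (A B : T -> 'M[R]_(m, n)) :
  mxwrt G A -> mxwrt G B -> mxwrt G (fun w => A w + B w).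
Proof. by move=> sA sB i j; under eq_fun do rewrite mxE; exact: measurable_wrtD. Qed.

Lemma mxwrtZ m n c (A : T -> 'M[R]_(m, n)) :
  mxwrt G A -> mxwrt G (fun w => c *: A w).
Proof. by move=> sA i j; under eq_fun do rewrite mxE; exact: measurable_wrtZ. Qed.

Lemma mxwrtB m n (A B : T -> 'M[R]_(m, n)) :
  mxwrt G A -> mxwrt G B -> mxwrt G (fun w => A w - B w).
Proof.
move=> sA sB; under eq_fun do rewrite -scaleN1r.
by apply: mxwrtD => //; exact: mxwrtZ.
Qed.

Lemma mxwrt_mull p m n (M : 'M[R]_(p, m)) (A : T -> 'M[R]_(m, n)) :
  mxwrt G A -> mxwrt G (fun w => M *m A w).
Proof.
move=> sA i j; under eq_fun do rewrite mxE.
elim: (index_enum _) => [|k r IH].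
  by under eq_fun do rewrite big_nil; exact: measurable_wrt_cst.
by under eq_fun do rewrite big_cons; apply: measurable_wrtD => //; exact: measurable_wrtZ.
Qed.

Lemma mxwrt_cst m n (A : 'M[R]_(m, n)) : mxwrt G (fun=> A).
Proof. by move=> i j; exact: measurable_wrt_cst. Qed.

(** The cross term is a combination of products of a G-measurable entry of A
    with a noise entry centred given G. *)
Lemma expect_sqnormD N p n (A : T -> 'M[R]_(p, n)) (M : 'M[R]_(p, N))
    (S : T -> 'M[R]_(N, n)) :
  mxsqint A -> mxwrt G A -> mxsqint S ->
  (forall i j, cond_mean_zero P G (fun w => S w i j)) ->
  expect P (fun w => sqnorm (A w + M *m S w)) =
  expect P (fun w => sqnorm (A w)) + expect P (fun w => sqnorm (M *m S w)).
Proof.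
move=> iA mA iS S0; have iMS := mxsqint_mull M iS.
have iAB i j : intble P (fun w => A w i j * (M *m S w) i j) by exact: intble_mul.
have id : intble P (fun w => mdot (A w) (M *m S w)).
  by apply: intble_sum => i; apply: intble_sum => j.
rewrite (eq_expect P (fun w => sqnormD (A w) (M *m S w))).
rewrite expectD; [|by apply: intbleD; [exact: intble_sqnorm|exact: intbleZ]|
  exact: intble_sqnorm].
rewrite expectD; [|exact: intble_sqnorm|exact: intbleZ].
rewrite expectZ// [X in 2 * X](_ : _ = 0) ?mulr0 ?addr0//.
rewrite expect_sum; last by move=> i; apply: intble_sum => j.
apply: big1 => i _; rewrite expect_sum//; apply: big1 => j _.
have iM k : intble P (fun w => M i k * (A w i j * S w k j)).
  by apply: intbleZ; exact: intble_mul.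
rewrite (@eq_expect _ _ _ P _ (fun w => \sum_k M i k * (A w i j * S w k j))).
  rewrite expect_sum//; apply: big1 => k _.
  have iAS : intble P (fun w => A w i j * S w k j) by exact: intble_mul.
  by rewrite expectZ// (cond_mean_zero_orth sG GT (S0 k j) (mA i j))// mulr0.
by move=> w; rewrite mxE mulr_sumr; apply: eq_bigr => k _; rewrite mulrCA.
Qed.

End Orthogonality.

(** Orthogonality across the agents leaves the diagonal terms of the squared
    sum, N out of N^2. *)
Lemma expect_row_mean N n (S : T -> 'M[R]_(N, n)) : (0 < N)%N -> mxsqint S ->
  (forall i i' j, i != i' -> expect P (fun w => S w i' j * S w i j) = 0) ->
  expect P (fun w => sqnorm (row_mean (S w))) =
  N%:R ^- 2 * expect P (fun w => sqnorm (S w)).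
Proof.
move=> N0 iS S0.
have ij i i' j : intble P (fun w => S w i j * S w i' j) by exact: intble_mul.
rewrite (@eq_expect _ _ _ P _ (fun w => N%:R ^- 2 *
    \sum_j \sum_i \sum_i' S w i j * S w i' j)); last first.
  move=> w; rewrite /sqnorm big_ord1 mulr_sumr; apply: eq_bigr => j _.
  rewrite row_meanE exprMn exprVn; congr (_ * _); rewrite expr2 mulr_suml.
  by apply: eq_bigr => i _; rewrite mulr_sumr.
rewrite expectZ; last by do 3 (apply: intble_sum => ?).
congr (_ * _); rewrite expect_sum; last by move=> j; do 2 (apply: intble_sum => ?).
rewrite (@eq_expect _ _ _ P (fun w => sqnorm (S w))
  (fun w => \sum_j \sum_i S w i j ^+ 2)); last first.
  by move=> w; rewrite /sqnorm exchange_big.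
rewrite expect_sum; last by move=> j; apply: intble_sum => i; case: (iS i j).
apply: eq_bigr => j _; rewrite expect_sum; last by move=> i; apply: intble_sum.
rewrite expect_sum; last by move=> i; case: (iS i j).
apply: eq_bigr => i _; rewrite expect_sum// (bigD1 i)//= big1 ?addr0//.
by move=> i' ii'; apply: S0.
Qed.

End SquareIntegrable.

(** * Measurability of gradients *)
Section GradientMeasurability.
Context {R : realType} {N d : nat}.
Variables (mu L : R) (f : 'I_N -> 'rV[R]_d -> R) (xs : 'rV[R]_d).
Hypotheses (mu0 : 0 < mu) (muL : mu <= L).
Hypothesis Hf : function_assumption mu L f xs.

Let L0 : 0 <= L. Proof. exact: le_trans (ltW mu0) muL. Qed.

Lemma sqr_entry_le m n (A : 'M[R]_(m, n)) i j : A i j ^+ 2 <= sqnorm A.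
Proof.
rewrite /sqnorm (bigD1 i)//= (bigD1 j)//= -addrA lerDl addr_ge0//.
  by apply: sumr_ge0 => *; exact: sqr_ge0.
by apply: sumr_ge0 => *; apply: sumr_ge0 => *; exact: sqr_ge0.
Qed.

Lemma sqnorm_le_l1 (u : 'rV[R]_d) : sqnorm u <= (\sum_j `|u 0 j|) ^+ 2.
Proof.
rewrite /sqnorm big_ord1 expr2 mulr_suml; apply: ler_sum => j _.
rewrite -real_normK ?num_real// expr2 ler_wpM2l//.
by rewrite (bigD1 j)//= lerDl sumr_ge0.
Qed.

Lemma grad_entry_lipschitz i j x y :
  `|grad (f i) x 0 j - grad (f i) y 0 j| <= L * \sum_l `|x 0 l - y 0 l|.
Proof.
have S0 : 0 <= \sum_l `|x 0 l - y 0 l| by exact: sumr_ge0.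
rewrite -ler_sqr ?nnegrE ?mulr_ge0// real_normK ?num_real// exprMn.
have := sqr_entry_le (grad (f i) x - grad (f i) y) 0 j; rewrite !mxE.
move=> /le_trans; apply; apply: le_trans (grad_sqnorm_lipschitz mu0 muL Hf i x y) _.
apply: ler_wpM2l; first exact: sqr_ge0.
apply: le_trans (sqnorm_le_l1 _) _.
by under eq_bigr do rewrite !mxE.
Qed.

Context {dT : measure_display} {T : measurableType dT} (P : probability T R).

Lemma mxwrt_grads (G : set (set T)) (B : T -> 'M[R]_(N, d)) :
  sigma_algebra setT G -> mxwrt G B -> mxwrt G (fun w => grads f (B w)).
Proof.
move=> sG mB i j; apply/measurable_wrtP => //.
under eq_fun do rewrite mxE.
apply: (@measurable_fun_lipschitz _ _ (g_sigma_algebraType G) _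
  (fun x => grad (f i) x 0 j) L (fun w => row i (B w))) => //.
  by move=> x y; exact: grad_entry_lipschitz.
by move=> l; under eq_fun do rewrite mxE; apply/measurable_wrtP.
Qed.

Lemma mxsqint_grads (B : T -> 'M[R]_(N, d)) :
  mxsqint P B -> mxsqint P (fun w => grads f (B w)).
Proof.
move=> iB i j.
apply: (@sqint_le _ _ _ _ _ (fun w =>
  2 * (L ^+ 2 * sqnorm (row i (B w))) + 2 * sqnorm (grad (f i) 0))).
- under eq_fun do rewrite mxE.
  apply: (@measurable_fun_lipschitz _ _ T _
    (fun x => grad (f i) x 0 j) L (fun w => row i (B w))) => //.
    by move=> x y; exact: grad_entry_lipschitz.
  by move=> l; under eq_fun do rewrite mxE; case: (iB i l).
- apply: intbleD; last exact: intble_cst.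
  apply: intbleZ; apply: intbleZ; apply: intble_sqnorm => i' j'.
  by under eq_fun do rewrite mxE.
- move=> w; rewrite mxE; apply: le_trans (sqr_entry_le _ 0 j) _.
  rewrite -[X in sqnorm X](subrK (grad (f i) 0)); apply: le_trans (sqnormD_le2 _ _) _.
  rewrite lerD2r ler_wpM2l//.
  by have := grad_sqnorm_lipschitz mu0 muL Hf i (row i (B w)) 0; rewrite subr0.
Qed.

Lemma measurable_wrt_sgrad (G : set (set T)) dX (X : measurableType dX)
    (Fi : 'rV[R]_d -> X -> R) (x : T -> 'rV[R]_d) (z : T -> X) j :
  sigma_algebra setT G ->
  measurable_fun setT (fun p : d.-tuple R * X =>
    sgrad Fi (\row_l tnth p.1 l) p.2 0 j) ->
  (forall l, measurable_wrt G (fun w => x w 0 l)) -> measurable_wrt G z ->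
  measurable_wrt G (fun w => sgrad Fi (x w) (z w) 0 j).
Proof.
move=> sG mF mx /(measurable_wrtP sG) mz; apply/measurable_wrtP => //.
pose pr (w : g_sigma_algebraType G) : d.-tuple R * X := ([tuple x w 0 l | l < d], z w).
have -> : (fun w => sgrad Fi (x w) (z w) 0 j) =
    (fun p : d.-tuple R * X => sgrad Fi (\row_l tnth p.1 l) p.2 0 j) \o pr.
  apply/funext => w /=; congr (sgrad Fi _ _ 0 j).
  by apply/rowP => l; rewrite mxE tnth_mktuple.
apply: measurableT_comp => //; apply/measurable_fun_pairP; split => //.
apply/measurable_fun_tnthP => l /=.
rewrite (_ : _ \o _ = fun w => x w 0 l); first exact/measurable_wrtP.
by apply/funext => w /=; rewrite tnth_mktuple.
Qed.

End GradientMeasurability.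

(** * The Lyapunov function in expectation *)
Section StochasticStep.
Context {R : realType} {N d : nat}.
Variables (mu L : R) (f : 'I_N -> 'rV[R]_d -> R) (xs : 'rV[R]_d).
Variables (W : nat -> 'M[R]_N) (tau : nat) (lambda sigma a : R).
Variable x0 : 'I_N -> 'rV[R]_d.
Hypotheses (N0 : (0 < N)%N) (mu0 : 0 < mu) (muL : mu <= L) (a0 : 0 < a).
Hypothesis Hf : function_assumption mu L f xs.
Hypothesis HW : network_assumption W tau lambda.
Local Notation dl := (delta tau lambda).
Hypothesis small : 18432 * a ^+ 2 * L ^+ 3 <= mu * dl ^+ 4.
Context (dX : 'I_N -> measure_display) (X : forall i, measurableType (dX i)).
Context (D : forall i, probability (X i) R) (F : forall i, 'rV[R]_d -> X i -> R).
Context (dT : measure_display) (T : measurableType dT) (P : probability T R).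
Context (xi : nat -> forall i, {mfun T >-> X i}) (Fil : nat -> set (set T)).
Hypothesis HO : oracle_assumption f D F.
Hypothesis HN : noise_assumption f F W a x0 xi P Fil sigma.
Local Notation Pi := (avg_mx R N).
Local Notation Wt k := (W k - Pi).

Let dW k : doubly_stochastic (W k). Proof. by case: HW. Qed.
Let NR0 : 0 < (N%:R : R). Proof. by rewrite ltr0n. Qed.
Let tau0 : 0 < (tau%:R : R). Proof. by case: HW => _ t _ _; rewrite ltr0n. Qed.
Let sFil k : sigma_algebra setT (Fil k). Proof. by case: HN => /(_ k)[]. Qed.
Let FilT k : Fil k `<=` measurable. Proof. by case: HN => /(_ k)[]. Qed.

Definition sample_path (w : T) : nat -> forall i, X i := fun l i => xi l i w.
Definition iterates k w : 'M[R]_(N, d) := stack (iterate F W a x0 xi k w).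
Definition trackers k w : 'M[R]_(N, d) := stack (tracker F W a x0 xi k w).
Definition noises k w : 'M[R]_(N, d) :=
  stack (fun i => noise f F W a x0 xi k i w).
Definition samples k w : 'M[R]_(N, d) := sample_grads F W a x0 (sample_path w) k.
Local Notation gs := (optgrads f xs).
Definition deviations k w : 'M[R]_(N, d) := track_dev F W a x0 (sample_path w) gs k.

Lemma stackE (u : 'I_N -> 'rV[R]_d) i j : stack u i j = u i 0 j.
Proof. by rewrite mxE. Qed.

Lemma gradsE (B : 'M[R]_(N, d)) i j : grads f B i j = grad (f i) (row i B) 0 j.
Proof. by rewrite mxE. Qed.

Lemma matrix_subE m n (A B : 'M[R]_(m, n)) i j : (A - B) i j = A i j - B i j.
Proof. by rewrite !mxE. Qed.

Lemma noisesE k w : noises k w = samples k w - grads f (iterates k w).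
Proof.
apply/matrixP => i j; rewrite [RHS]matrix_subE gradsE !stackE /noise matrix_subE.
by rewrite (_ : row i (iterates k w) = iterate F W a x0 xi k w i) // /iterates rowK.
Qed.

Lemma samplesE k w : samples k w = grads f (iterates k w) + noises k w.
Proof. by rewrite noisesE addrC subrK. Qed.

Lemma samples_noise k w :
  samples k w - gs - (grads f (iterates k w) - gs) = noises k w.
Proof. by rewrite noisesE opprB addrA subrK. Qed.

Lemma mxwrt_iterates k : mxwrt (Fil k) (iterates k).
Proof.
move=> i j; under eq_fun do rewrite stackE.
by case: HN => _ [h _] _ _ _; exact: h.
Qed.

Lemma mxwrt_past_samples k : mxwrt (Fil k.+1) (samples k).
Proof.
move=> i j; under eq_fun do rewrite stackE.
case: HN => _ [_ /(_ k.+1 k i (ltnSn k)) [mz mx _]] _ _ _.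
apply: (@measurable_wrt_sgrad _ _ _ _ _ _ _ (@F i) (fun w => iterate F W a x0 xi k w i) (xi k i)) => //.
by case: HO => _ _ _; exact.
Qed.

Lemma mxwrt_past_trackers k : mxwrt (Fil k.+1) (trackers k).
Proof.
move=> i j; under eq_fun do rewrite stackE.
by case: HN => _ [_ /(_ k.+1 k i (ltnSn k)) [_ _ h]] _ _ _; exact: h.
Qed.

(** The tracking recursion expresses the deviation through the tracker and the
    samples of the previous step, which belong to the past. *)
Lemma mxwrt_deviations k : mxwrt (Fil k) (deviations k).
Proof.
case: k => [|k].
  rewrite /deviations; under eq_fun do rewrite track_dev0.
  exact: mxwrt_cst.
rewrite /deviations; under eq_fun do rewrite track_devS_tracker//.
apply: mxwrtB => //; apply: mxwrt_mull => //; first exact: mxwrt_past_trackers.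
by apply: mxwrtB => //; [exact: mxwrt_past_samples|exact: mxwrt_cst].
Qed.

Lemma noises_mean_zero k i j : cond_mean_zero P (Fil k) (fun w => noises k w i j).
Proof.
under eq_fun do rewrite stackE.
have [_ _ _ /(_ k i j) h _] := HN.
have := cond_exp_mean_zero (@FilT k) h.
by under eq_fun do rewrite subr0.
Qed.

Lemma mxsqint_noises k : mxsqint P (noises k).
Proof.
move=> i j; have [_ _ _ _ /(_ k i) [Z [[iY _ _ _] _]]] := HN.
apply: (sqint_le _ iY); first by apply: (@intble_measurable _ _ _ P); case: (noises_mean_zero k i j).
by move=> w; rewrite stackE; exact: sqr_entry_le.
Qed.

Lemma noises_sqnorm k : expect P (fun w => sqnorm (noises k w)) <= N%:R * sigma ^+ 2.
Proof.
rewrite (@eq_expect _ _ _ P _ (fun w => \sum_i sqnorm (noise f F W a x0 xi k i w))); last first.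
  by move=> w; rewrite sqnorm_row; apply: eq_bigr => i _; rewrite rowK.
have h i : intble P (fun w => sqnorm (noise f F W a x0 xi k i w)) /\
    expect P (fun w => sqnorm (noise f F W a x0 xi k i w)) <= sigma ^+ 2.
  have [_ _ _ _ /(_ k i) [Z [[iY iZ _ YZ] Zs]]] := HN; split => //.
  have := YZ setT; rewrite /expect /Rintegral => ->; last first.
    by have [s0 sC _] := sFil k; rewrite -(setD0 setT); exact: sC.
  rewrite -[leRHS](expect_cst P).
  have mZ := intble_measurable iZ.
  (* Z is bounded by sigma^2 only almost everywhere. *)
  have mM : measurable_fun setT (fun w => Num.min (Z w) (sigma ^+ 2)).
    by apply: measurable_minr => //; exact: measurable_cst.
  rewrite (_ : fine _ = expect P (fun w => Num.min (Z w) (sigma ^+ 2))).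
    apply: le_expect; [|exact: intble_cst|by move=> w; rewrite ge_min lexx orbT].
    apply: (@intble_le _ _ _ _ _ (fun w => `|Z w| + sigma ^+ 2)) => //.
      move=> w; rewrite minElt; case: ifP => _; first by rewrite lerDl sqr_ge0.
      by rewrite ger0_norm ?sqr_ge0// lerDr.
    by apply: intbleD; [exact: integrable_norm|exact: intble_cst].
  congr fine; apply: ae_eq_integral => //; [exact/measurable_EFinP|exact/measurable_EFinP|].
  by apply: filterS Zs => w /= /min_idPl ->.
have E : expect P (fun w => \sum_i sqnorm (noise f F W a x0 xi k i w)) <=
    \sum_(i < N) sigma ^+ 2.
  rewrite expect_sum; last by move=> i; case: (h i).
  by apply: ler_sum => i _; case: (h i).
by apply: le_trans E _; rewrite sumr_const card_ord -(mulr_natl (sigma ^+ 2)).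
Qed.

(** The noise of agent i is a function of its current point, known given the
    past, and of its own sample. *)
Lemma measurable_wrt_noises k i j :
  measurable_wrt <<s joint_sets (Fil k) (fun i => xi k i) i >> (fun w => noises k w i j).
Proof.
set H := <<s _ >>.
have sH : sigma_algebra setT H by exact: joint_sigma_algebra.
have FH : Fil k `<=` H by exact: sub_joint_sigma.
have mx l : measurable_wrt H (fun w => iterate F W a x0 xi k w i 0 l).
  by move=> B mB; apply: FH; have := mxwrt_iterates k i l mB; under eq_fun do rewrite stackE.
rewrite (_ : (fun w => _) = (fun w =>
  sgrad (@F i) (iterate F W a x0 xi k w i) (xi k i w) 0 j + (-1) * grads f (iterates k w) i j)); last first.
  by apply/funext => w; rewrite noisesE matrix_subE stackE mulN1r.
apply: measurable_wrtD => //.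
  apply: measurable_wrt_sgrad => //; first by case: HO => _ _ _; exact.
  exact: (measurable_wrt_joint (@sFil k)).
apply: measurable_wrtZ => //.
by move=> B mB; apply: FH; exact: (mxwrt_grads mu0 muL Hf (@sFil k) (@mxwrt_iterates k)).
Qed.

Lemma noises_orth k i i' j : i != i' ->
  expect P (fun w => noises k w i' j * noises k w i j) = 0.
Proof.
move=> ii'; apply: (@cond_independent_orth _ _ _ P (Fil k) (@sFil k) (@FilT k) N dX X
  (fun i => xi k i) _ _ i i' (fun w => noises k w i j) (fun w => noises k w i' j)) => //.
- by case: HN => _ _ /(_ k).
- exact: measurable_wrt_noises.
- exact: measurable_wrt_noises.
- exact: noises_mean_zero.
- by apply: intble_mul; exact: mxsqint_noises.
Qed.

Lemma mxsqint_state k : mxsqint P (iterates k) /\ mxsqint P (trackers k).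
Proof.
have iS k' : mxsqint P (iterates k') -> mxsqint P (samples k').
  move=> iX; rewrite (_ : samples k' = fun w => grads f (iterates k' w) + noises k' w).
    apply: mxsqintD; [exact: (mxsqint_grads mu0 muL Hf iX)|exact: mxsqint_noises].
  by apply/funext => w; exact: samplesE.
elim: k => [|k [iX iG]].
  have iX0 : mxsqint P (iterates 0) by exact: (mxsqint_cst P (stack x0)).
  by split => //; exact: iS.
have iX' : mxsqint P (iterates k.+1).
  rewrite (_ : iterates k.+1 = fun w => W k *m (iterates k w - a *: trackers k w)).
    by apply: mxsqint_mull; apply: mxsqintB => //; exact: mxsqintZ.
  by apply/funext => w; exact: stack_iterateS.
split => //.
rewrite (_ : trackers k.+1 = fun w => W k *m trackers k w + samples k.+1 w - samples k w).
  apply: mxsqintB; last exact: iS.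
  by apply: mxsqintD; [exact: mxsqint_mull|exact: iS].
by apply/funext => w; exact: stack_trackerS.
Qed.

Lemma mxsqint_samples k : mxsqint P (samples k).
Proof.
rewrite (_ : samples k = fun w => grads f (iterates k w) + noises k w).
  apply: mxsqintD; last exact: mxsqint_noises.
  by apply: (mxsqint_grads mu0 muL Hf); case: (mxsqint_state k).
by apply/funext => w; exact: samplesE.
Qed.

Lemma mxsqint_deviations k : mxsqint P (deviations k).
Proof.
apply: mxsqint_mull; apply: mxsqintD; last exact: mxsqint_cst.
apply: mxsqintB; last exact: mxsqint_samples.
by case: (mxsqint_state k).
Qed.

Lemma intble_window_energy k n (A : T -> 'M[R]_(N, n)) : mxsqint P A ->
  intble P (fun w => window_energy W tau k (A w)).
Proof.
by move=> iA; apply: intble_sum => s; apply: intble_sqnorm; exact: mxsqint_mull.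
Qed.

Lemma expect_window_energyD k l (A : T -> 'M[R]_(N, d)) (M : 'M[R]_N) :
  mxsqint P A -> mxwrt (Fil k) A ->
  expect P (fun w => window_energy W tau l (A w + M *m noises k w)) =
  expect P (fun w => window_energy W tau l (A w))
  + expect P (fun w => window_energy W tau l (M *m noises k w)).
Proof.
move=> iA mA; have iS := mxsqint_noises k.
have iAl s : mxsqint P (fun w => transition W l s *m A w) by exact: mxsqint_mull.
have iMl s : mxsqint P (fun w => transition W l s *m (M *m noises k w)).
  by do 2 apply: mxsqint_mull.
rewrite expect_sum; last first.
  by move=> s; apply: intble_sqnorm; apply: mxsqint_mull; apply: mxsqintD => //; exact: mxsqint_mull.
rewrite [X in _ = X + _]expect_sum; last by move=> s; exact: intble_sqnorm.
rewrite [X in _ = _ + X]expect_sum; last by move=> s; exact: intble_sqnorm.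
rewrite -big_split; apply: eq_bigr => s _ /=.
rewrite (@eq_expect _ _ _ P _ (fun w => sqnorm (transition W l s *m A w
    + (transition W l s *m M) *m noises k w))); last first.
  by move=> w; rewrite mulmxDr mulmxA.
rewrite (expect_sqnormD (@sFil k) (@FilT k))//; last 2 first.
- exact: mxwrt_mull.
- exact: noises_mean_zero.
by congr (_ + _); apply: eq_expect => w; rewrite mulmxA.
Qed.

Lemma expect_window_energy_noise k l (M : 'M[R]_N) (c : R) : 0 <= c ->
  (forall B : 'M[R]_(N, d), sqnorm (M *m B) <= c * sqnorm B) ->
  expect P (fun w => window_energy W tau l (M *m noises k w)) <= tau%:R * (c * (N%:R * sigma ^+ 2)).
Proof.
move=> c0 cM; have iS := intble_sqnorm (mxsqint_noises k).
apply: (@le_trans _ _ (expect P (fun w => (tau%:R * c) * sqnorm (noises k w)))).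
  apply: le_expect.
  - by apply: intble_window_energy; apply: mxsqint_mull; exact: mxsqint_noises.
  - exact: intbleZ.
  - move=> w; apply: le_trans (window_energy_le N0 HW _ _) _; rewrite -mulrA.
    by rewrite ler_wpM2l// ltW.
rewrite expectZ// -mulrA; apply: ler_wpM2l; first exact: ltW.
by apply: ler_wpM2l => //; exact: noises_sqnorm.
Qed.

Definition potential k w : R :=
  lyapunov L xs W tau lambda a k (iterates k w) (deviations k w).

Let c1 := consensus_weight a L dl / (N%:R * tau%:R).
Let c2 := tracking_weight a L dl / (N%:R * tau%:R).

Let c10 : 0 <= c1.
Proof.
apply: divr_ge0; last by apply: mulr_ge0; exact: ltW.
by apply/ltW/(consensus_weight_gt0 a0 mu0 muL)/(delta_gt0 HW).
Qed.

Let c20 : 0 <= c2.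
Proof.
apply: divr_ge0; last by apply: mulr_ge0; exact: ltW.
by apply/ltW/(tracking_weight_gt0 a0 mu0 muL)/(delta_gt0 HW).
Qed.

Let rm : 'M[R]_(1, N) := const_mx (- a / N%:R).

Let rmE (B : 'M[R]_(N, d)) : rm *m B = - a *: row_mean B.
Proof.
apply/matrixP => i j; rewrite ord1 [RHS]mxE row_meanE mxE mulrA mulr_sumr.
by apply: eq_bigr => l _; rewrite mxE.
Qed.

Let noise_part k w : R := sqnorm (rm *m noises k w)
  + c1 * window_energy W tau k.+1 ((- a *: Wt k) *m noises k w)
  + c2 * window_energy W tau k.+1 ((W k - 1%:M) *m noises k w).

Let det_part k w : R := sqnorm (mean_next f xs a (iterates k w))
  + c1 * window_energy W tau k.+1 (consensus_next f xs W a k (iterates k w) (deviations k w))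
  + c2 * window_energy W tau k.+1 (track_next f xs W k (iterates k w) (deviations k w)).

(** Each component is its value in a noiseless step plus a linear image of the
    noise. *)
Lemma potentialS k w : potential k.+1 w =
  sqnorm (mean_next f xs a (iterates k w) + rm *m noises k w)
  + c1 * window_energy W tau k.+1 (consensus_next f xs W a k (iterates k w) (deviations k w)
                          + (- a *: Wt k) *m noises k w)
  + c2 * window_energy W tau k.+1 (track_next f xs W k (iterates k w) (deviations k w)
                          + (W k - 1%:M) *m noises k w).
Proof.
rewrite /potential /lyapunov -/c1 -/c2; congr (_ + _ * _ + _ * _).
- rewrite rmE /mean_next /iterates (row_mean_iterate _ _ _ _ N0 dW).
  rewrite -/(samples k w) samplesE row_meanD scalerDr scaleNr opprD.
  congr sqnorm; rewrite -!addrA; congr (_ + _).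
  by rewrite [RHS]addrC -!addrA; congr (_ + _); rewrite addrC.
- congr window_energy; rewrite /consensus_next -(samples_noise k w).
  exact: center_iterateS.
- congr window_energy; rewrite /track_next -(samples_noise k w).
  exact: track_devS.
Qed.

Lemma mxsqint_row_mean (B : T -> 'M[R]_(N, d)) :
  mxsqint P B -> mxsqint P (fun w => row_mean (B w)).
Proof.
move=> iB i j; rewrite (ord1 i); under eq_fun do rewrite row_meanE.
by apply: sqintZ; apply: sqint_sum => l; exact: iB.
Qed.

Lemma mxsqint_mean_next k : mxsqint P (fun w => mean_next f xs a (iterates k w)).
Proof.
have [iX _] := mxsqint_state k; have iG := mxsqint_grads mu0 muL Hf iX.
apply: mxsqintB; last by apply: mxsqintZ; exact: mxsqint_row_mean.
by apply: mxsqintB; [exact: mxsqint_row_mean|exact: mxsqint_cst].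
Qed.

Lemma mxwrt_mean_next k : mxwrt (Fil k) (fun w => mean_next f xs a (iterates k w)).
Proof.
have mG := mxwrt_grads mu0 muL Hf (@sFil k) (@mxwrt_iterates k).
have rmean (B : T -> 'M[R]_(N, d)) : mxwrt (Fil k) B -> mxwrt (Fil k) (fun w => row_mean (B w)).
  move=> mB; rewrite (_ : (fun w => _) = fun w => (const_mx N%:R^-1 : 'rV[R]_N) *m B w).
    exact: mxwrt_mull.
  apply/funext => w; apply/matrixP => i j; rewrite ord1 row_meanE mxE mulr_sumr.
  by apply: eq_bigr => l _; rewrite mxE.
apply: mxwrtB => //; last by apply: mxwrtZ => //; exact: rmean.
apply: mxwrtB => //; last exact: mxwrt_cst.
by apply: rmean; exact: mxwrt_iterates.
Qed.

Lemma mxsqint_consensus_next k :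
  mxsqint P (fun w => consensus_next f xs W a k (iterates k w) (deviations k w)).
Proof.
have [iX _] := mxsqint_state k; have iG := mxsqint_grads mu0 muL Hf iX.
apply: mxsqint_mull; apply: mxsqintB; first exact: mxsqint_mull.
apply: mxsqintZ; apply: mxsqintD; first exact: mxsqint_deviations.
by apply: mxsqintB => //; exact: mxsqint_cst.
Qed.

Lemma mxwrt_consensus_next k :
  mxwrt (Fil k) (fun w => consensus_next f xs W a k (iterates k w) (deviations k w)).
Proof.
have mG := mxwrt_grads mu0 muL Hf (@sFil k) (@mxwrt_iterates k).
apply: mxwrt_mull => //; apply: mxwrtB => //.
  by apply: mxwrt_mull => //; exact: mxwrt_iterates.
apply: mxwrtZ => //; apply: mxwrtD => //; first exact: mxwrt_deviations.
by apply: mxwrtB => //; exact: mxwrt_cst.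
Qed.

Lemma mxsqint_track_next k :
  mxsqint P (fun w => track_next f xs W k (iterates k w) (deviations k w)).
Proof.
have [iX _] := mxsqint_state k; have iG := mxsqint_grads mu0 muL Hf iX.
apply: mxsqintD; apply: mxsqint_mull; first exact: mxsqint_deviations.
by apply: mxsqintB => //; exact: mxsqint_cst.
Qed.

Lemma mxwrt_track_next k :
  mxwrt (Fil k) (fun w => track_next f xs W k (iterates k w) (deviations k w)).
Proof.
have mG := mxwrt_grads mu0 muL Hf (@sFil k) (@mxwrt_iterates k).
apply: mxwrtD => //; apply: mxwrt_mull => //; first exact: mxwrt_deviations.
by apply: mxwrtB => //; exact: mxwrt_cst.
Qed.

Lemma intble_potential k : intble P (potential k).
Proof.
have [iX _] := mxsqint_state k.
apply: intbleD; first apply: intbleD.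
- apply: intble_sqnorm; apply: mxsqintB; last exact: mxsqint_cst.
  exact: mxsqint_row_mean.
- by apply: intbleZ; apply: intble_window_energy; exact: mxsqint_mull.
- by apply: intbleZ; apply: intble_window_energy; exact: mxsqint_deviations.
Qed.

Let expect3 (Y1 Y2 Y3 : T -> R) : intble P Y1 -> intble P Y2 -> intble P Y3 ->
  expect P (fun w => Y1 w + c1 * Y2 w + c2 * Y3 w) =
  expect P Y1 + c1 * expect P Y2 + c2 * expect P Y3.
Proof.
move=> i1 i2 i3; rewrite expectD; [|by apply: intbleD => //; exact: intbleZ|exact: intbleZ].
by rewrite expectD ?expectZ//; exact: intbleZ.
Qed.

Lemma expect_potentialS k : expect P (potential k.+1) =
  expect P (det_part k) + expect P (noise_part k).
Proof.
have iS := mxsqint_noises k.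
have iM n (M : 'M[R]_(n, N)) : mxsqint P (fun w => M *m noises k w) by exact: mxsqint_mull.
have im := mxsqint_mean_next k; have idv := mxsqint_consensus_next k.
have it := mxsqint_track_next k.
rewrite (eq_expect P (potentialS k)) expect3; first last.
- by apply: intble_window_energy; exact: mxsqintD.
- by apply: intble_window_energy; exact: mxsqintD.
- by apply: intble_sqnorm; exact: mxsqintD.
rewrite (expect_sqnormD (@sFil k) (@FilT k))//; last 2 first.
- exact: mxwrt_mean_next.
- exact: noises_mean_zero.
rewrite (expect_window_energyD _ _ idv (@mxwrt_consensus_next k)).
rewrite (expect_window_energyD _ _ it (@mxwrt_track_next k)).
have -> : expect P (det_part k) = _ :=
  expect3 (intble_sqnorm im) (intble_window_energy _ idv) (intble_window_energy _ it).
have -> : expect P (noise_part k) = _ :=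
  expect3 (intble_sqnorm (iM _ rm)) (intble_window_energy _ (iM _ _)) (intble_window_energy _ (iM _ _)).
by rewrite !mulrDr [RHS]addrACA; congr (_ + _); rewrite [RHS]addrACA.
Qed.

(** The noise enters through the mean, where averaging gains 1 / N, and through
    the two energies. *)
Definition noise_level : R :=
  a ^+ 2 * sigma ^+ 2 / N%:R + (consensus_weight a L dl * a ^+ 2 + 4 * tracking_weight a L dl) * sigma ^+ 2.

Lemma expect_noise_part k : expect P (noise_part k) <= noise_level.
Proof.
have iS := mxsqint_noises k.
have iM n (M : 'M[R]_(n, N)) : mxsqint P (fun w => M *m noises k w) by exact: mxsqint_mull.
have -> : expect P (noise_part k) = _ :=
  expect3 (intble_sqnorm (iM _ rm)) (intble_window_energy _ (iM _ _)) (intble_window_energy _ (iM _ _)).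
have a20 : 0 <= a ^+ 2 by exact: sqr_ge0.
have h1 : expect P (fun w => sqnorm (rm *m noises k w)) <= a ^+ 2 * sigma ^+ 2 / N%:R.
  rewrite (@eq_expect _ _ _ P _ (fun w => a ^+ 2 * sqnorm (row_mean (noises k w)))); last first.
    by move=> w; rewrite rmE sqnormZ sqrrN.
  have irm : intble P (fun w => sqnorm (row_mean (noises k w))).
    by apply: intble_sqnorm; exact: mxsqint_row_mean.
  rewrite expectZ// -mulrA; apply: ler_wpM2l => //.
  rewrite expect_row_mean//; last by move=> i i' j; exact: noises_orth.
  rewrite ler_pdivlMr// [leLHS]mulrC mulrA.
  apply: (@le_trans _ _ (N%:R^-1 * (N%:R * sigma ^+ 2))); last first.
    by rewrite mulKf// gt_eqF.
  rewrite (_ : N%:R * N%:R ^- 2 = N%:R^-1); last by field; rewrite gt_eqF.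
  by apply: ler_wpM2l; [rewrite invr_ge0 ltW|exact: noises_sqnorm].
have h2 : expect P (fun w => window_energy W tau k.+1 ((- a *: Wt k) *m noises k w)) <=
    tau%:R * (a ^+ 2 * (N%:R * sigma ^+ 2)).
  apply: expect_window_energy_noise => // B; rewrite -scalemxAl sqnormZ sqrrN.
  by apply: ler_wpM2l => //; exact: sqnorm_deviation.
have h3 : expect P (fun w => window_energy W tau k.+1 ((W k - 1%:M) *m noises k w)) <=
    tau%:R * (4 * (N%:R * sigma ^+ 2)).
  by apply: expect_window_energy_noise => // B; exact: sqnorm_mixing_sub1.
apply: le_trans (lerD (lerD h1 (ler_wpM2l c10 h2)) (ler_wpM2l c20 h3)) _.
rewrite /noise_level -addrA lerD2l le_eqVlt; apply/orP; left; apply/eqP.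
by rewrite /c1 /c2; field; rewrite !gt_eqF.
Qed.

Lemma expect_potential_step k : expect P (potential k.+1) <=
  (1 - a * mu / 2) * expect P (potential k) + noise_level.
Proof.
apply: (@le_trans _ _ (expect P (det_part k) + expect P (noise_part k))).
  by rewrite le_eqVlt; apply/orP; left; apply/eqP; exact: expect_potentialS.
apply: (lerD _ (expect_noise_part k)).
rewrite -(expectZ _ (intble_potential k)).
apply: le_expect; last first.
- by move=> w; exact: (lyapunov_deterministic_step N0 mu0 muL a0 Hf HW small).
- by apply: intbleZ; exact: intble_potential.
- apply: intbleD; first apply: intbleD.
  + by apply: intble_sqnorm; exact: mxsqint_mean_next.
  + by apply: intbleZ; apply: intble_window_energy; exact: mxsqint_consensus_next.
  + by apply: intbleZ; apply: intble_window_energy; exact: mxsqint_track_next.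
Qed.

Definition lyapunov0 : R := lyapunov L xs W tau lambda a 0 (stack x0) ((1%:M - Pi) *m gs).

Lemma expect_potential k : expect P (potential k) <=
  (1 - a * mu / 2) ^+ k * lyapunov0 + 2 / (a * mu) * noise_level.
Proof.
have am : 0 < a * mu by exact: mulr_gt0.
have n0 : 0 <= noise_level.
  rewrite addr_ge0//; first by rewrite divr_ge0 ?ler0n// mulr_ge0 ?sqr_ge0.
  rewrite mulr_ge0 ?sqr_ge0// addr_ge0//.
    by rewrite mulr_ge0 ?sqr_ge0// ltW// (consensus_weight_gt0 a0 mu0 muL (delta_gt0 HW)).
  by rewrite mulr_ge0// ltW// (tracking_weight_gt0 a0 mu0 muL (delta_gt0 HW)).
have q0 : 0 <= 1 - a * mu / 2.
  have := stepsize_mu a0 mu0 muL (delta_gt0 HW) (delta_le1 HW) small.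
  by have := delta_le1 HW; lra.
elim: k => [|k IH].
  rewrite expr0 mul1r (@eq_expect _ _ _ P _ (fun=> lyapunov0)).
    by rewrite expect_cst lerDl mulr_ge0// divr_ge0// ltW.
  by move=> w; rewrite /potential /deviations track_dev0.
apply: le_trans (expect_potential_step k) _.
apply: le_trans (lerD (ler_wpM2l q0 IH) (lexx _)) _.
rewrite exprS le_eqVlt; apply/orP; left; apply/eqP; field.
by rewrite !gt_eqF.
Qed.

Lemma expect_error k : ('E_P[(fun w : T =>
    sqnorm (avg (iterate F W a x0 xi k w) - xs))] <=
  ((1 - a * mu / 2) ^+ k * lyapunov0 + 2 / (a * mu) * noise_level)%:E)%E.
Proof.
have [iX _] := mxsqint_state k.
have E w : avg (iterate F W a x0 xi k w) = row_mean (iterates k w).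
  by rewrite /avg /row_mean; congr (_ *: _); apply: eq_bigr => i _; rewrite /iterates rowK.
have i1 : intble P (fun w => sqnorm (avg (iterate F W a x0 xi k w) - xs)).
  under eq_fun do rewrite E.
  apply: intble_sqnorm; apply: mxsqintB; last exact: mxsqint_cst.
  exact: mxsqint_row_mean.
rewrite unlock; apply: (@le_trans _ _ (expect P (fun w =>
    sqnorm (avg (iterate F W a x0 xi k w) - xs)))%:E).
  by rewrite /expect /Rintegral fineK//; exact: integrable_fin_num.
rewrite lee_fin; apply: le_trans (expect_potential k).
apply: le_expect => //; first exact: intble_potential.
move=> w; rewrite E /potential /lyapunov -addrA lerDl.
exact: addr_ge0 (mulr_ge0 c10 (window_energy_ge0 _ _ _ _)) (mulr_ge0 c20 (window_energy_ge0 _ _ _ _)).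
Qed.

End StochasticStep.

(** * Size of the stepsize *)
Definition rate_const {R : realType} : R := 1000^-1.
(* 2 * 16 comes from the consensus weight and 97 bounds dl^2 + 96. *)
Definition noise_const {R : realType} : R := 97 * 32.

Lemma rate_const_gt0 (R : realType) : 0 < (rate_const : R).
Proof. by rewrite /rate_const invr_gt0 ltr0n. Qed.

Lemma noise_const_gt0 (R : realType) : 0 < (noise_const : R).
Proof. exact: mulr_gt0. Qed.

Section StepsizeBounds.
Context {R : realType}.
Variables (mu L : R) (tau : nat) (lambda : R).
Hypotheses (mu0 : 0 < mu) (muL : mu <= L) (tau1 : (1 <= tau)%N).
Hypothesis l01 : 0 <= lambda < 1.
Local Notation ka := (kappa mu L).
Local Notation et := (Defs.eta tau lambda).
Local Notation dl := (delta tau lambda).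
Local Notation Q := (Qcst tau lambda).
Local Notation ab := (alphabar mu L tau lambda).
Local Notation gap := ((1 - lambda) / tau%:R).

Let L0 : 0 < L. Proof. exact: lt_le_trans muL. Qed.
Let tau0 : 0 < (tau%:R : R). Proof. by rewrite ltr0n. Qed.
Let l1 : 0 < 1 - lambda. Proof. by rewrite subr_gt0; case/andP: l01. Qed.

Lemma kappa_ge1 : 1 <= ka. Proof. by rewrite ler_pdivlMr// mul1r. Qed.
Let ka0 : 0 < ka. Proof. exact: lt_le_trans kappa_ge1. Qed.

Lemma gap_gt0 : 0 < gap. Proof. exact: divr_gt0. Qed.

Lemma gap_le1 : gap <= 1.
Proof.
rewrite ler_pdivrMr// mul1r; apply: (@le_trans _ _ 1).
  by case/andP: l01 => ? _; lra.
by rewrite ler1n.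
Qed.

Lemma etaE : et = gap / 2.
Proof. by rewrite /Defs.eta; field; rewrite gt_eqF. Qed.

Lemma delta_ge_gap : gap <= dl.
Proof.
rewrite ler_pM2r ?invr_gt0//; case/andP: l01 => l0 /ltW l1'.
by rewrite lerD2l lerN2 expr2 ler_piMr.
Qed.

Let dl0 : 0 < dl. Proof. exact: lt_le_trans gap_gt0 delta_ge_gap. Qed.
Let gn0 : gap != 0. Proof. by rewrite gt_eqF ?gap_gt0. Qed.

Let QE : Q = 1 + 32 / gap ^+ 2.
Proof.
rewrite /Qcst etaE; congr (_ + _); move: gn0; move: gap => g g0.
by field.
Qed.

Let Q0 : 0 < Q.
Proof. by rewrite QE addr_gt0// divr_gt0// exprn_gt0// gap_gt0. Qed.

Lemma Q_lower : 32 <= Q * dl ^+ 2.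
Proof.
have h : gap ^+ 2 <= dl ^+ 2.
  by rewrite ler_sqr ?nnegrE ?delta_ge_gap// ltW ?gap_gt0.
apply: (@le_trans _ _ (32 / gap ^+ 2 * dl ^+ 2)).
  by rewrite mulrAC ler_pdivlMr ?exprn_gt0 ?gap_gt0// ler_pM2l.
apply: ler_wpM2r; first exact: sqr_ge0.
by rewrite QE lerDr.
Qed.

Lemma Q_upper : Q * gap ^+ 2 <= 33.
Proof.
rewrite QE mulrDl mul1r divfK ?expf_neq0//.
have : gap ^+ 2 <= 1 by rewrite expr_le1 ?gap_le1// ltW ?gap_gt0.
by lra.
Qed.

Lemma alphabar_gt0 : 0 < ab.
Proof.
have c0 : 0 < (320 : R) by rewrite ltr0n.
have s0 (c : R) : 0 < c -> 0 < Num.sqrt c by rewrite sqrtr_gt0.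
apply: divr_gt0 dl0 (mulr_gt0 (mulr_gt0 (s0 _ c0) L0) (s0 _ (mulr_gt0 Q0 ka0))).
Qed.

Lemma alphabar_sqr : ab ^+ 2 = dl ^+ 2 / (320 * L ^+ 2 * (Q * ka)).
Proof.
have c0 : 0 <= (320 : R) by rewrite ler0n.
rewrite /alphabar; move: (320 : R) c0 => c c0.
rewrite exprMn exprVn !exprMn (sqr_sqrtr c0) sqr_sqrtr//.
exact: ltW (mulr_gt0 Q0 ka0).
Qed.

(** As Q * delta^2 >= 32, the square of alphabar is at most
    delta^4 / (10240 L^2 kappa); halving the stepsize gains the factor 4 that
    brings 10240 above 18432. *)
Lemma stepsize_small a : 0 < a -> a <= ab / 2 ->
  18432 * a ^+ 2 * L ^+ 3 <= mu * dl ^+ 4.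
Proof.
move=> a0 aab; have a2 : a ^+ 2 <= ab ^+ 2 / 4.
  have -> : ab ^+ 2 / 4 = (ab / 2) ^+ 2 by field.
  by rewrite ler_sqr ?nnegrE ?(ltW a0)// ltW// divr_gt0// alphabar_gt0.
have QK : a ^+ 2 * (1280 * L ^+ 2 * (Q * ka)) <= dl ^+ 2.
  have c0 : 0 < (1280 : R) by rewrite ltr0n.
  rewrite -(ler_pdivlMr _ _ (mulr_gt0 (mulr_gt0 c0 (exprn_gt0 2 L0)) (mulr_gt0 Q0 ka0))).
  apply: le_trans a2 _; rewrite alphabar_sqr le_eqVlt; apply/orP; left; apply/eqP.
  by field; rewrite !gt_eqF.
have kE : mu * ka = L by rewrite /kappa mulrC divfK// gt_eqF.
pose x := a ^+ 2 * L ^+ 2 * ka.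
have x0 : 0 <= x.
  by apply: mulr_ge0; [apply: mulr_ge0; exact: sqr_ge0|exact: ltW].
have h1 := ler_wpM2l x0 Q_lower.
have h2 := ler_wpM2r (sqr_ge0 dl) QK.
have e : mu * dl ^+ 4 * ka = L * (dl ^+ 2 * dl ^+ 2).
  by rewrite (_ : _ * ka = mu * ka * (dl ^+ 2 * dl ^+ 2)); [rewrite kE|ring].
rewrite -(ler_pM2r ka0) e.
have := ler_wpM2l (ltW L0) h2; have := ler_wpM2l (ltW L0) h1; have := mulr_ge0 (ltW L0) x0.
by rewrite /x; lra.
Qed.

Lemma powR32 : ka `^ (3 / 2) = ka * Num.sqrt ka.
Proof.
rewrite (_ : 3 / 2 = 1 + 2^-1 :> R); last by field.
rewrite powRD; last by rewrite (gt_eqF ka0) implybT.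
by rewrite powRr1 ?ltW// powR12_sqrt// ltW.
Qed.

(** As Q * gap^2 <= 33 and delta >= gap, alphabar is at least of order
    gap^2 / (L sqrt kappa), and mu / L is 1 / kappa.  Squaring removes the roots;
    the constants c = 1000 and e = 320 are kept abstract until the inequality
    16 * 33 * e <= c^2 between them. *)
Lemma alphabar_rate : rate_const * (gap ^+ 2 / ka `^ (3 / 2)) <= ab * mu / 4.
Proof.
have k32 : 0 < ka `^ (3 / 2) by exact: powR_gt0.
have gd : gap ^+ 2 <= dl ^+ 2.
  by rewrite ler_sqr ?nnegrE ?delta_ge_gap// ltW ?gap_gt0.
have h : gap ^+ 2 * (Q * gap ^+ 2) <= dl ^+ 2 * 33.
  apply: ler_pM => //; [exact: sqr_ge0| |exact: Q_upper].
  by apply: mulr_ge0; [exact: ltW|exact: sqr_ge0].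
have kE : mu * ka = L by rewrite /kappa mulrC divfK// gt_eqF.
have am : 0 <= ab * mu / 4.
  by rewrite divr_ge0// mulr_ge0// ltW// alphabar_gt0.
have key (c e : R) : 0 < c -> 0 < e -> ab ^+ 2 = dl ^+ 2 / (e * L ^+ 2 * (Q * ka)) ->
    16 * 33 * e <= c ^+ 2 -> c^-1 * (gap ^+ 2 / ka `^ (3 / 2)) <= ab * mu / 4.
  move=> c0 e0 abE ec.
  have [z zE] : exists z : R, z = ab * mu / 4 by exists (ab * mu / 4).
  rewrite -zE in am *; rewrite mulrA ler_pdivrMr// mulrC ler_pdivrMr//.
  rewrite -ler_sqr ?nnegrE; [|exact: sqr_ge0|by rewrite !mulr_ge0// ltW].
  rewrite powR32.
  have -> : (z * (ka * Num.sqrt ka) * c) ^+ 2 =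
      ab ^+ 2 * mu ^+ 2 / 16 * ka ^+ 2 * (Num.sqrt ka) ^+ 2 * c ^+ 2.
    by rewrite zE; field.
  rewrite sqr_sqrtr ?(ltW ka0)// abE (_ : L ^+ 2 = (mu * ka) ^+ 2); last by rewrite kE.
  have -> : dl ^+ 2 / (e * (mu * ka) ^+ 2 * (Q * ka)) * mu ^+ 2 / 16 * ka ^+ 2 * ka * c ^+ 2 =
      dl ^+ 2 * c ^+ 2 / (16 * e * Q).
    by move: Q0 ka0; move: dl Q ka => D q k q0 k0; field; rewrite !gt_eqF.
  rewrite ler_pdivlMr ?mulr_gt0//.
  have -> : (gap ^+ 2) ^+ 2 * (16 * e * Q) = 16 * e * (gap ^+ 2 * (Q * gap ^+ 2)) by ring.
  apply: (@le_trans _ _ (16 * e * (dl ^+ 2 * 33))).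
    by apply: ler_wpM2l h; rewrite mulr_ge0// ltW.
  have -> : 16 * e * (dl ^+ 2 * 33) = dl ^+ 2 * (16 * 33 * e) by ring.
  by apply: ler_wpM2l ec; exact: sqr_ge0.
have c0 : 0 < (1000 : R) by rewrite ltr0n.
have e0 : 0 < (320 : R) by rewrite ltr0n.
by apply: (key _ _ c0 e0 alphabar_sqr); lra.
Qed.

Lemma noise_level_le (a sigma : R) (n : nat) : 0 < a -> (0 < n)%N ->
  2 / (a * mu) * (a ^+ 2 * sigma ^+ 2 / n%:R
     + (consensus_weight a L dl * a ^+ 2 + 4 * tracking_weight a L dl) * sigma ^+ 2) <=
  2 * a / mu * (sigma ^+ 2 / n%:R) + noise_const * (ka * a ^+ 2 * (sigma ^+ 2 / gap ^+ 3)).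
Proof.
move=> a0 n0; have nr0 : 0 < (n%:R : R) by rewrite ltr0n.
rewrite mulrDr; apply: lerD.
  by rewrite le_eqVlt; apply/orP; left; apply/eqP; field; rewrite !gt_eqF.
have d2 : dl ^+ 2 <= 1.
  rewrite expr_le1 ?(ltW dl0)//; rewrite ler_pdivrMr// mul1r.
  by apply: (@le_trans _ _ 1); [rewrite gerBl sqr_ge0|rewrite ler1n].
have -> : 2 / (a * mu) * ((consensus_weight a L dl * a ^+ 2 + 4 * tracking_weight a L dl) * sigma ^+ 2) =
    32 * ka * a ^+ 2 * sigma ^+ 2 / dl ^+ 3 * (dl ^+ 2 + 96).
  by move: dl0; rewrite /tracking_weight /consensus_weight /kappa; move: dl => e e0; field; rewrite !gt_eqF.
have c0 : 0 <= 32 * ka * a ^+ 2 * sigma ^+ 2.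
  by rewrite (mulr_ge0 (mulr_ge0 (mulr_ge0 _ (ltW ka0)) (sqr_ge0 _)) (sqr_ge0 _)).
apply: (@le_trans _ _ (32 * ka * a ^+ 2 * sigma ^+ 2 / dl ^+ 3 * 97)).
  apply: ler_wpM2l; first by rewrite divr_ge0// exprn_ge0// ltW.
  by move: d2; lra.
have -> : noise_const * (ka * a ^+ 2 * (sigma ^+ 2 / gap ^+ 3)) =
    32 * ka * a ^+ 2 * sigma ^+ 2 / gap ^+ 3 * 97 by rewrite /noise_const; ring.
apply: ler_wpM2r => //; apply: (ler_wpM2l c0).
rewrite lef_pV2 ?posrE ?exprn_gt0 ?gap_gt0//.
by rewrite lerXn2r// ?nnegrE ?delta_ge_gap// ltW// gap_gt0.
Qed.

(** A window energy is at most tau times the squared norm.  In the last term,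
    halving alphabar gains a factor 8 in its cube, and delta >= 2 eta turns
    1 / delta^2 into 1 / (4 eta^2). *)
Lemma lyapunov0_le_C0 (N d : nat) (f : 'I_N -> 'rV[R]_d -> R) (xs : 'rV[R]_d)
    (W : nat -> 'M[R]_N) (x0 : 'I_N -> 'rV[R]_d) (a : R) :
  (0 < N)%N -> network_assumption W tau lambda -> 0 < a -> a <= ab / 2 ->
  lyapunov L xs W tau lambda a 0 (stack x0) ((1%:M - avg_mx R N) *m optgrads f xs)
  <= C0 mu L tau lambda f xs x0.
Proof.
move=> N0 HW a0 aab; have NR0 : 0 < (N%:R : R) by rewrite ltr0n.
have ab0 := alphabar_gt0.
have wx0 : 0 < consensus_weight a L dl by exact: (consensus_weight_gt0 a0 mu0 muL).
have wv0 : 0 < tracking_weight a L dl by exact: (tracking_weight_gt0 a0 mu0 muL).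
have ly n (B : 'M[R]_(N, n)) w : 0 < w ->
    w / (N%:R * tau%:R) * window_energy W tau 0 B <= w / N%:R * sqnorm B.
  move=> w0; apply: (@le_trans _ _ (w / (N%:R * tau%:R) * (tau%:R * sqnorm B))).
    by apply: ler_wpM2l (window_energy_le N0 HW 0 B); rewrite divr_ge0 ?mulr_ge0// ltW.
  by rewrite le_eqVlt; apply/orP; left; apply/eqP; field; rewrite !gt_eqF.
rewrite /lyapunov /C0; apply: lerD; first apply: lerD.
- rewrite (_ : row_mean (stack x0) = avg x0)//.
  by rewrite /row_mean /avg; congr (_ *: _); apply: eq_bigr => i _; rewrite rowK.
- apply: le_trans (ly _ _ _ wx0) _; apply: ler_wpM2r; first exact: sqnorm_ge0.
  rewrite /consensus_weight (_ : 16 * ab * L / (dl * N%:R) = 16 * L / (dl * N%:R) * ab); last by ring.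
  rewrite (_ : 16 * a * L / dl / N%:R = 16 * L / (dl * N%:R) * a); last first.
    by move: dl0; move: dl => e e0; field; rewrite !gt_eqF.
  apply: ler_wpM2l; last by lra.
  by rewrite (divr_ge0 (mulr_ge0 _ (ltW L0)) (mulr_ge0 (ltW dl0) (ltW NR0))).
- apply: le_trans (ly _ _ _ wv0) _.
  have og : optgrads f xs = stack (fun i => grad (f i) xs).
    by apply/matrixP => i j; rewrite !mxE /= (_ : row i _ = xs)// rowK.
  apply: ler_pM; [by rewrite divr_ge0// ltW|exact: sqnorm_ge0| |].
    have pow_le n (u v : R) : 0 <= u -> u <= v -> u ^+ n <= v ^+ n.
      by move=> u0 uv; rewrite lerXn2r// nnegrE// (le_trans u0).
    have a3 : 8 * a ^+ 3 <= ab ^+ 3.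
      have -> : 8 * a ^+ 3 = (2 * a) ^+ 3 by ring.
      by apply: pow_le; [exact: mulr_ge0 _ (ltW a0)|move: aab; lra].
    have e0 : 0 < Defs.eta tau lambda by rewrite etaE divr_gt0// gap_gt0.
    have ed : (2 * Defs.eta tau lambda) ^+ 2 <= dl ^+ 2.
      apply: pow_le; first exact: mulr_ge0 _ (ltW e0).
      by rewrite etaE mulrC divfK// delta_ge_gap.
    rewrite /tracking_weight /consensus_weight; move: dl0 ed e0 a3 ab0.
    move: dl (Defs.eta _ _) ab => D E A D0 ED E0 a3 A0.
    have -> : 24 * (16 * a * L / D) * a ^+ 2 / D ^+ 2 / N%:R =
       (8 * a ^+ 3) * (48 * L / (D * N%:R)) * (D ^+ 2)^-1 by field; rewrite !gt_eqF.
    have -> : 32 * A ^+ 3 * L / (E ^+ 2 * D * N%:R) =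
       A ^+ 3 * (48 * L / (D * N%:R)) * (2 / (3 * E ^+ 2)) by field; rewrite !gt_eqF.
    have p0 : 0 <= 48 * L / (D * N%:R).
      by rewrite (divr_ge0 (mulr_ge0 _ (ltW L0)) (mulr_ge0 (ltW D0) (ltW NR0))).
    apply: ler_pM.
    + by rewrite mulr_ge0// mulr_ge0// exprn_ge0// ltW.
    + by rewrite invr_ge0 sqr_ge0.
    + exact: ler_wpM2r.
    + rewrite -[leLHS]mul1r ler_pdivrMr ?exprn_gt0// mulrAC ler_pdivlMr ?mulr_gt0 ?exprn_gt0//.
      by move: ED; rewrite exprMn; have := sqr_ge0 E; lra.
  by rewrite og; exact: sqnorm_center_le.
Qed.

End StepsizeBounds.

(** * Choice of the stepsize for a horizon *)
Section Horizon.
Context {R : realType}.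
Variables (mu L : R) (tau : nat) (lambda sigma c0 : R) (N K : nat).
Hypotheses (mu0 : 0 < mu) (muL : mu <= L) (tau1 : (1 <= tau)%N).
Hypotheses (l01 : 0 <= lambda < 1) (s0 : 0 < sigma) (c00 : 0 <= c0).
Hypotheses (N0 : (0 < N)%N) (K0 : (0 < K)%N).
Local Notation ka := (kappa mu L).
Local Notation ab := (alphabar mu L tau lambda).
Local Notation gap := ((1 - lambda) / tau%:R).
Local Notation TK := (Tlog mu sigma N c0 K).
Local Notation l := (ln TK).

Let NR0 : 0 < (N%:R : R). Proof. by rewrite ltr0n. Qed.
Let KR0 : 0 < (K%:R : R). Proof. by rewrite ltr0n. Qed.
Let tau0 : 0 < (tau%:R : R). Proof. by rewrite ltr0n. Qed.
Let g0 : 0 < gap. Proof. exact: gap_gt0. Qed.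
Let ka1 : 1 <= ka. Proof. exact: kappa_ge1. Qed.
Let ka_gt0 : 0 < ka. Proof. exact: lt_le_trans ka1. Qed.
Let ka_mu0 : 0 <= ka / mu ^+ 2. Proof. exact: divr_ge0 (ltW ka_gt0) (sqr_ge0 _). Qed.
Let s20 : 0 < sigma ^+ 2. Proof. exact: exprn_gt0. Qed.
Let lam1 : 0 < 1 - lambda. Proof. by rewrite subr_gt0; case/andP: l01. Qed.

Let speedup0 : 0 <= sigma ^+ 2 / (N%:R * K%:R).
Proof. exact: divr_ge0 (sqr_ge0 _) (mulr_ge0 (ltW NR0) (ltW KR0)). Qed.

Let residue0 : 0 <= 2 / mu ^+ 2 * (sigma ^+ 2 / (N%:R * K%:R)).
Proof. by apply: mulr_ge0 => //; exact: divr_ge0 _ (sqr_ge0 _). Qed.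

Lemma Tlog_gt0 : 0 < TK.
Proof. by rewrite lt_max expR_gt0. Qed.

Lemma ln_Tlog_ge1 : 1 <= l.
Proof.
rewrite -[leLHS]expRK ler_ln ?posrE ?expR_gt0 ?Tlog_gt0//.
by rewrite le_max lexx.
Qed.

(** The argument of the logarithm is chosen for this: dividing C0 by it leaves a
    term of the order of the noise. *)
Lemma C0_div_Tlog : c0 * expR (- l) <= 2 / mu ^+ 2 * (sigma ^+ 2 / (N%:R * K%:R)).
Proof.
rewrite expRN lnK ?posrE ?Tlog_gt0// ler_pdivrMr ?Tlog_gt0//.
have h : mu ^+ 2 * N%:R * c0 * K%:R / (2 * sigma ^+ 2) <= TK by rewrite le_max lexx orbT.
apply: le_trans (ler_wpM2l _ h); last first.
  exact: residue0.
rewrite le_eqVlt; apply/orP; left; apply/eqP; field.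
by rewrite !gt_eqF.
Qed.

(** With stepsize 2 ln T / (mu K) the initial error is divided by T after K
    steps.  When this stepsize is too large to be admissible, alphabar / 2 is
    used and the exponential term of the bound accounts for the initial error. *)
Definition horizon_stepsize : R := Num.min (ab / 2) (2 * l / (mu * K%:R)).
Local Notation a := horizon_stepsize.

Lemma horizon_stepsize_gt0 : 0 < a.
Proof.
rewrite lt_min divr_gt0 ?alphabar_gt0//= divr_gt0 ?mulr_gt0//.
exact: lt_le_trans ln_Tlog_ge1.
Qed.

Lemma horizon_stepsize_le : a <= ab / 2.
Proof. by rewrite ge_min lexx. Qed.

Lemma contraction_horizon : (1 - a * mu / 2) ^+ K * c0 <=
  c0 * expR (- (rate_const * (1 - lambda) ^+ 2 * K%:R / (ka `^ (3 / 2) * tau%:R ^+ 2)))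
  + 2 / mu ^+ 2 * (sigma ^+ 2 / (N%:R * K%:R)).
Proof.
have am : 0 <= a * mu / 2 <= 1.
  have a0 := horizon_stepsize_gt0.
  rewrite divr_ge0 ?mulr_ge0 ?(ltW a0) ?(ltW mu0)//=.
  have dl0 : 0 < delta tau lambda by exact: lt_le_trans (delta_ge_gap tau1 l01).
  have dl1 : delta tau lambda <= 1.
    rewrite ler_pdivrMr// mul1r.
    by apply: (@le_trans _ _ 1); [rewrite gerBl sqr_ge0|rewrite ler1n].
  have := stepsize_mu a0 mu0 muL dl0 dl1
    (stepsize_small mu0 muL tau1 l01 a0 horizon_stepsize_le).
  by move: dl1; lra.
have exp_le : (1 - a * mu / 2) ^+ K <= expR (- (a * mu / 2 * K%:R)).
  move: (a * mu / 2) am => q am.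
  rewrite -mulNr expRM_natr lerXn2r ?nnegrE ?expR_ge0//.
    by rewrite subr_ge0; case/andP: am.
  exact: expR_ge1Dx.
have q0 : 0 <= c0 * expR (- (rate_const * (1 - lambda) ^+ 2 * K%:R
    / (ka `^ (3 / 2) * tau%:R ^+ 2))).
  by rewrite mulr_ge0// expR_ge0.
have r0 := residue0.
rewrite mulrC; apply: le_trans (ler_wpM2l c00 exp_le) _.
have [aE|aE] : a = ab / 2 \/ a = 2 * l / (mu * K%:R).
  by rewrite /horizon_stepsize minElt; case: ifP; [left|right].
- rewrite -[leLHS]addr0; apply: lerD => //; apply: ler_wpM2l => //.
  rewrite ler_expR lerN2.
  have := alphabar_rate mu0 muL tau1 l01.
  have k32 : 0 < ka `^ (3 / 2) by rewrite powR_gt0// ?ka_gt0.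
  move: (rate_const : R) => c.
  have -> : c * (1 - lambda) ^+ 2 * K%:R / (ka `^ (3 / 2) * tau%:R ^+ 2) =
     c * (gap ^+ 2 / ka `^ (3 / 2)) * K%:R.
    by field; rewrite !gt_eqF.
  move=> /(ler_wpM2r (ltW KR0))/le_trans; apply.
  by rewrite aE le_eqVlt; apply/orP; left; apply/eqP; field.
- rewrite -[leLHS]add0r; apply: lerD => //.
  rewrite (_ : a * mu / 2 * K%:R = l); first exact: C0_div_Tlog.
  by rewrite aE; field; rewrite !gt_eqF.
Qed.

Definition budget_const : R := 1 + 6 / mu ^+ 2 + 4 * noise_const * (ka / mu ^+ 2).

Lemma budget_const_gt0 : 0 < budget_const.
Proof.
have p : 0 <= 4 * noise_const * (ka / mu ^+ 2).
  by apply: mulr_ge0 ka_mu0; exact: mulr_ge0 _ (ltW (noise_const_gt0 R)).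
have p' : 0 <= 6 / mu ^+ 2 by rewrite divr_ge0 ?sqr_ge0.
by rewrite /budget_const; lra.
Qed.

Lemma horizon_bound :
  (1 - a * mu / 2) ^+ K * c0
  + (2 * a / mu * (sigma ^+ 2 / N%:R) + noise_const * (ka * a ^+ 2 * (sigma ^+ 2 / gap ^+ 3)))
  <= budget_const * l ^+ 2 *
    (sigma ^+ 2 / (N%:R * K%:R)
     + tau%:R ^+ 3 * sigma ^+ 2 / ((1 - lambda) ^+ 3 * K%:R ^+ 2)
     + c0 * expR (- (rate_const * (1 - lambda) ^+ 2 * K%:R / (ka `^ (3 / 2) * tau%:R ^+ 2)))).
Proof.
have h1 := contraction_horizon; have l1 := ln_Tlog_ge1.
have a0 := horizon_stepsize_gt0.
have al : a <= 2 * l / (mu * K%:R) by rewrite ge_min lexx orbT.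
have h2 : 2 * a / mu * (sigma ^+ 2 / N%:R) <=
    4 / mu ^+ 2 * l * (sigma ^+ 2 / (N%:R * K%:R)).
  rewrite [leLHS](_ : _ = 2 / mu * (sigma ^+ 2 / N%:R) * a); last by ring.
  rewrite [leRHS](_ : _ = 2 / mu * (sigma ^+ 2 / N%:R) * (2 * l / (mu * K%:R))); last first.
    by field; rewrite !gt_eqF.
  by apply: ler_wpM2l => //; rewrite mulr_ge0// divr_ge0// ltW.
have h3 : noise_const * (ka * a ^+ 2 * (sigma ^+ 2 / gap ^+ 3)) <=
    4 * noise_const * (ka / mu ^+ 2) * l ^+ 2 *
    (tau%:R ^+ 3 * sigma ^+ 2 / ((1 - lambda) ^+ 3 * K%:R ^+ 2)).
  have a2 : a ^+ 2 <= (2 * l / (mu * K%:R)) ^+ 2.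
    by rewrite ler_sqr ?nnegrE ?(ltW a0)// (le_trans (ltW a0) al).
  have [c cE] : exists c : R, c = noise_const by exists noise_const.
  have c_ge0 : 0 <= c by rewrite cE ltW// noise_const_gt0.
  rewrite -cE [leLHS](_ : _ = c * ka * (sigma ^+ 2 / gap ^+ 3) * a ^+ 2); last by ring.
  rewrite [leRHS](_ : _ = c * ka * (sigma ^+ 2 / gap ^+ 3) * (2 * l / (mu * K%:R)) ^+ 2); last first.
    by field; rewrite !gt_eqF.
  apply: ler_wpM2l a2; apply: mulr_ge0; last by rewrite divr_ge0 ?sqr_ge0// exprn_ge0// ltW.
  exact: mulr_ge0 c_ge0 (ltW ka_gt0).
have l2 : 1 <= l ^+ 2 by rewrite expr_ge1// (le_trans _ l1).
have ll2 : l <= l ^+ 2 by rewrite expr2 ler_peMr// (le_trans _ l1).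
have A0 : 0 <= sigma ^+ 2 / (N%:R * K%:R) by rewrite divr_ge0 ?sqr_ge0// mulr_ge0.
have B0 : 0 <= tau%:R ^+ 3 * sigma ^+ 2 / ((1 - lambda) ^+ 3 * K%:R ^+ 2).
  by apply: divr_ge0; apply: mulr_ge0 => //; rewrite ?sqr_ge0 ?exprn_ge0// ltW.
set E := c0 * expR _ in h1 *.
have E0 : 0 <= E by rewrite mulr_ge0// expR_ge0.
move: h1 h2 h3 A0 B0 E0.
set A := sigma ^+ 2 / (N%:R * K%:R); set B := tau%:R ^+ 3 * _ / _.
have u0 : 0 <= (mu ^+ 2)^-1 by rewrite invr_ge0 sqr_ge0.
rewrite /budget_const.
have v0 := ka_mu0.
have := ltW (noise_const_gt0 R); move: (noise_const : R) => c c_ge0.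
move: u0 v0 l1 l2 ll2.
move: (mu ^+ 2)^-1 (ka / mu ^+ 2) => u v; move: l => q; move: a => b.
move=> u0 v0 l1 l2 ll2 h1 h2 h3 A0 B0 E0.
have q0 : 0 <= q ^+ 2 by rewrite sqr_ge0.
have m1 : E <= q ^+ 2 * E by rewrite ler_peMl.
have m2 : 2 * u * A <= 2 * u * (q ^+ 2 * A).
  by apply: ler_wpM2l; [rewrite mulr_ge0|rewrite ler_peMl].
have m3 : 4 * u * q * A <= 4 * u * (q ^+ 2 * A).
  rewrite -mulrA; apply: ler_wpM2l; first by rewrite mulr_ge0.
  exact: ler_wpM2r.
have uA : 0 <= q ^+ 2 * A by rewrite mulr_ge0.
have uB : 0 <= q ^+ 2 * B by rewrite mulr_ge0.
have uE : 0 <= q ^+ 2 * E by rewrite mulr_ge0.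
have p1 : 0 <= u * (q ^+ 2 * B) by rewrite mulr_ge0.
have p2 : 0 <= u * (q ^+ 2 * E) by rewrite mulr_ge0.
have p3 := mulr_ge0 (mulr_ge0 c_ge0 v0) uA.
have p4 := mulr_ge0 (mulr_ge0 c_ge0 v0) uE.
by lra.
Qed.

(** The second summand of the transient time makes the term in 1 / K^2 at most
    sigma^2 / (N K); the first one makes the exponential at most 1 / T. *)
Lemma transient_bound :
  rate_const^-1 * l * (ka `^ (3 / 2) * tau%:R ^+ 2 / (1 - lambda) ^+ 2
      + N%:R * ka * tau%:R ^+ 3 / (1 - lambda) ^+ 3) <= K%:R ->
  sigma ^+ 2 / (N%:R * K%:R)
   + tau%:R ^+ 3 * sigma ^+ 2 / ((1 - lambda) ^+ 3 * K%:R ^+ 2)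
   + c0 * expR (- (rate_const * (1 - lambda) ^+ 2 * K%:R / (ka `^ (3 / 2) * tau%:R ^+ 2)))
  <= (2 + 2 / mu ^+ 2) * (sigma ^+ 2 / (N%:R * K%:R)).
Proof.
have l1 := ln_Tlog_ge1.
have c1 : 1 <= (rate_const : R)^-1 by rewrite /rate_const invrK ler1n.
have := rate_const_gt0 R; move: (rate_const : R) c1 => c c1 c_gt0.
set A := ka `^ (3 / 2) * tau%:R ^+ 2 / (1 - lambda) ^+ 2.
set B := N%:R * ka * tau%:R ^+ 3 / (1 - lambda) ^+ 3 => H.
have k32 : 0 < ka `^ (3 / 2) by rewrite powR_gt0// ?ka_gt0.
have A0 : 0 < A by rewrite divr_gt0 ?mulr_gt0 ?exprn_gt0.
have B0 : 0 < B.
  exact: divr_gt0 (mulr_gt0 (mulr_gt0 NR0 ka_gt0) (exprn_gt0 3 tau0)) (exprn_gt0 3 lam1).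
have lA : 0 < l * A by rewrite mulr_gt0// (lt_le_trans _ l1).
have lB : B <= l * B by rewrite ler_peMl// ltW.
have HB : B <= K%:R.
  apply: le_trans H; rewrite -mulrA; apply: (@le_trans _ _ (l * (A + B))).
    by move: lA lB; rewrite mulrDr; lra.
  by rewrite ler_peMl// mulr_ge0 ?addr_ge0 ?(le_trans _ l1)// ltW.
have HA : c^-1 * (l * A) <= K%:R.
  apply: le_trans H; rewrite -mulrA ler_wpM2l ?invr_ge0 ?(ltW c_gt0)//.
  by rewrite mulrDr lerDl (le_trans _ lB)// ltW.
have t1 : tau%:R ^+ 3 * sigma ^+ 2 / ((1 - lambda) ^+ 3 * K%:R ^+ 2) <=
    sigma ^+ 2 / (N%:R * K%:R).
  have -> : tau%:R ^+ 3 * sigma ^+ 2 / ((1 - lambda) ^+ 3 * K%:R ^+ 2) =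
     sigma ^+ 2 / (N%:R * K%:R) * (B / (ka * K%:R)).
    rewrite /B; move: ka_gt0; move: ka => q q_gt0.
    by field; rewrite !gt_eqF.
  apply: ler_piMr => //.
  rewrite ler_pdivrMr; last exact: mulr_gt0 ka_gt0 KR0.
  rewrite mul1r.
  by apply: le_trans HB _; rewrite ler_peMl.
have t2 : c0 * expR (- (c * (1 - lambda) ^+ 2 * K%:R / (ka `^ (3 / 2) * tau%:R ^+ 2)))
    <= 2 / mu ^+ 2 * (sigma ^+ 2 / (N%:R * K%:R)).
  apply: le_trans C0_div_Tlog; apply: ler_wpM2l => //; rewrite ler_expR lerN2.
  have -> : c * (1 - lambda) ^+ 2 * K%:R / (ka `^ (3 / 2) * tau%:R ^+ 2) = K%:R / (c^-1 * A).
    by rewrite /A; move: k32; move: (ka `^ _) => q q0; field; rewrite !gt_eqF.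
  have cA : 0 < c^-1 * A by apply: mulr_gt0 A0; rewrite invr_gt0.
  by rewrite ler_pdivlMr// mulrCA.
by move: t1 t2; lra.
Qed.

End Horizon.

Lemma C0_ge0 (R : realType) (N d : nat) (mu L : R) (tau : nat) (lambda : R)
    (f : 'I_N -> 'rV[R]_d -> R) (xs : 'rV[R]_d) (x0 : 'I_N -> 'rV[R]_d) :
  0 < mu -> mu <= L -> (1 <= tau)%N -> 0 <= lambda < 1 ->
  0 <= C0 mu L tau lambda f xs x0.
Proof.
move=> mu0 muL tau1 l01.
have dl0 : 0 <= delta tau lambda.
  exact: ltW (lt_le_trans (gap_gt0 tau1 l01) (delta_ge_gap tau1 l01)).
have ab0 := ltW (alphabar_gt0 mu0 muL tau1 l01).
have L0 : 0 <= L by exact: le_trans (ltW mu0) muL.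
rewrite /C0; move: (alphabar _ _ _ _) (delta _ _) (Defs.eta _ _) ab0 dl0 => A D E A0 D0.
apply: addr_ge0; first apply: addr_ge0.
- exact: sqnorm_ge0.
- by apply: mulr_ge0; [rewrite divr_ge0 ?mulr_ge0|exact: sqnorm_ge0].
- apply: mulr_ge0; last exact: sqnorm_ge0.
  apply: divr_ge0; first by rewrite !mulr_ge0// exprn_ge0.
  by rewrite (mulr_ge0 (mulr_ge0 (sqr_ge0 E) D0)).
Qed.

Theorem corollary1 (R : realType) :
  exists c p1 p2 p3 : R,
    [/\ 0 < c, 0 <= p1, 0 <= p2 & 0 <= p3] /\
  forall mu L : R, 0 < mu -> mu <= L ->
  exists C1 C2 C3 : R,
    [/\ 0 < C1, 0 < C2 & 0 < C3] /\
  forall (N d : nat) (f : 'I_N -> 'rV[R]_d -> R) (xstar : 'rV[R]_d)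
    (W : nat -> 'M[R]_N) (tau : nat) (lambda sigma : R)
    (x0 : 'I_N -> 'rV[R]_d),
  (1 <= N)%N -> (1 <= d)%N -> 0 < sigma ->
  function_assumption mu L f xstar ->
  network_assumption W tau lambda ->
  forall K : nat, (1 <= K)%N ->
  let k := kappa mu L in
  let c0 := C0 mu L tau lambda f xstar x0 in
  let TK := Tlog mu sigma N c0 K in
  (* The noise assumption bears on the iterates, hence on alpha: the samples and
     the filtration may depend on alpha and are quantified after it. *)
  exists alpha : R, 0 < alpha <= alphabar mu L tau lambda /\
  forall (dX : 'I_N -> measure_display) (X : forall i, measurableType (dX i))
    (D : forall i, probability (X i) R) (F : forall i, 'rV[R]_d -> X i -> R)
    (dT : measure_display) (T : measurableType dT) (P : probability T R)
    (xi : nat -> forall i, {mfun T >-> X i}) (Fil : nat -> set (set T)),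
  oracle_assumption f D F ->
  noise_assumption f F W alpha x0 xi P Fil sigma ->
  let err := ('E_P[(fun w : T =>
                sqnorm (avg (iterate F W alpha x0 xi K w) - xstar))])%E in
  (err <= (Otilde C1 p1 TK
            (sigma ^+ 2 / (N%:R * K%:R)
             + tau%:R ^+ 3 * sigma ^+ 2 / ((1 - lambda) ^+ 3 * K%:R ^+ 2)
             + c0 * expR (- (c * (1 - lambda) ^+ 2 * K%:R
                             / (k `^ (3 / 2) * tau%:R ^+ 2)))))%:E)%E /\
  (Otilde C3 p3 TK
     (k `^ (3 / 2) * tau%:R ^+ 2 / (1 - lambda) ^+ 2
      + N%:R * k * tau%:R ^+ 3 / (1 - lambda) ^+ 3) <= K%:R ->
   (err <= (Otilde C2 p2 TK (sigma ^+ 2 / (N%:R * K%:R)))%:E)%E).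
Proof.
exists rate_const, 2, 2, 1; split; first by split=> //; exact: rate_const_gt0.
move=> mu L mu0 muL.
have bc0 := budget_const_gt0 mu0 muL.
exists (budget_const mu L), (budget_const mu L * (2 + 2 / mu ^+ 2)), rate_const^-1.
split.
  split=> //; last by rewrite invr_gt0 rate_const_gt0.
  by rewrite mulr_gt0// ltr_wpDr// divr_ge0// sqr_ge0.
move=> N d f xstar W tau lambda sigma x0 N1 d1 s0 Hf HW K K1 k c0 TK.
have [_ tau1 l01 _] := HW.
have c00 : 0 <= c0 by exact: C0_ge0.
pose a := horizon_stepsize mu L tau lambda sigma c0 N K.
have a0 : 0 < a by exact: horizon_stepsize_gt0.
have aab : a <= alphabar mu L tau lambda / 2 by exact: horizon_stepsize_le.
exists a; split.
  rewrite a0 (le_trans aab)//.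
  have := alphabar_gt0 mu0 muL tau1 l01; move: (alphabar _ _ _ _) => A A0.
  by lra.
move=> dX X D F dT T P xi Fil HO HN err.
have small := stepsize_small mu0 muL tau1 l01 a0 aab.
have key : (err <= (Otilde (budget_const mu L) 2 TK
    (sigma ^+ 2 / (N%:R * K%:R)
     + tau%:R ^+ 3 * sigma ^+ 2 / ((1 - lambda) ^+ 3 * K%:R ^+ 2)
     + c0 * expR (- (rate_const * (1 - lambda) ^+ 2 * K%:R
                     / (k `^ (3 / 2) * tau%:R ^+ 2)))))%:E)%E.
  apply: le_trans (expect_error N1 mu0 muL a0 Hf HW small HO HN K) _.
  rewrite lee_fin /Otilde powR_mulrn; last first.
    by apply: le_trans (ln_Tlog_ge1 _ _ _ _ _).
  apply: le_trans (horizon_bound mu0 muL tau1 l01 s0 c00 N1 K1).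
  apply: lerD; last exact: noise_level_le.
  apply: ler_wpM2l; last exact: lyapunov0_le_C0.
  apply: exprn_ge0.
  have := stepsize_mu a0 mu0 muL (delta_gt0 HW) (delta_le1 HW) small.
  by have := delta_le1 HW; lra.
split=> [//|]; rewrite /Otilde powRr1; last first.
  exact: le_trans ler01 (ln_Tlog_ge1 mu sigma c0 N K).
move=> /(transient_bound mu0 muL tau1 l01 s0 c00 N1 K1) tr.
apply: le_trans key _; rewrite lee_fin /Otilde.
have m0 : 0 <= budget_const mu L * (ln TK `^ 2).
  by rewrite mulr_ge0 ?powR_ge0// ltW.
apply: le_trans (ler_wpM2l m0 tr) _.
by rewrite le_eqVlt; apply/orP; left; apply/eqP; ring.
Qed.
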